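(* For every holomorphic vector field $Y=f_0V_0+f_1V_1+hX$ on the space-time region $U$, the $\tau$-function of the $\tilde X$-invariant bundle $E$, defined by the 1-form $Y\lrcorner d\log\tau=\mathcal L_Y\sigma/\sigma$, satisfies $$Y\lrcorner d\log\tau=-\frac{i}{2\pi}\oint_{\partial D_+}h\,\mathrm{tr}\Big(\tfrac12 (Vg)g^{-1}(dg)g^{-1}+\Phi\,(dg)g^{-1}\Big)$$ at points where $\sigma\neq0$, with $\bar\partial_\alpha=g\circ\bar\partial_0\circ g^{-1}$ on each $\mathbb{CP}^1$ and $d$ the differential along $\mathbb{CP}^1$.
   Context: Twistor setting. Space-time is $\mathbb C^3$ with coordinates $(t,x,v)$. Minitwistor space $\mathcal Z$ is the total space of $\mathcal O(2)\to\mathbb{CP}^1$, with base coordinate $\lambda$ and fibre coordinate $\mu$. The correspondence space $\mathcal F=\mathbb C^3\times\mathbb{CP}^1$ is mapped to $\mathcal Z$ by $q$: $\mu=v+\lambda x+\lambda^2t$; the fibres of $q$ are spanned by $V_0=\partial_x-\lambda\partial_v$, $V_1=\partial_t-\lambda\partial_x$. A vector field $$X=a\partial_t+b\partial_x+c\partial_v+\alpha_0(2v\partial_x+x\partial_t)+\beta_0(v\partial_v-t\partial_t)-\gamma_0(x\partial_v+2t\partial_x)+\delta_0(v\partial_v+x\partial_x+t\partial_t)$$ (constant coefficients) lifts to $\hat X=X+V$ on $\mathcal F$, $V=(\alpha_0\lambda^2+\beta_0\lambda+\gamma_0)\partial_\lambda$, and $\hat X$ descends to a holomorphic vector field $\tilde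 X$ on $\mathcal Z$. Let $E\to\mathcal Z$ be a holomorphic rank-2 $SL(2,\mathbb C)$-bundle invariant under $\tilde X$, represented as the product bundle $\mathbb C^2$ with $\bar\partial$-operator $\bar\partial_\alpha=\bar\partial+\alpha$, $\alpha=a\,d\bar\lambda$ with $a$ $\mathfrak{sl}(2,\mathbb C)$-valued and holomorphic in $\mu$. Pulled back to $\mathcal F$ this gives a family, parametrized by $(t,x,v)$, of $\bar\partial$-operators on the product bundle over $\mathbb{CP}^1$. $V_0$, $V_1$ and the Lie derivative operator $\mathcal L_{\hat X}=\hat X+\Phi$ ($\Phi$ a trace-free matrix function, the lift of the symmetry) commute with $\bar\partial_\alpha$. A vector field $Y$ on $\mathbb C^3$ is written $Y=f_0V_0+f_1V_1+hX$ with $f_0,f_1,h$ meromorphic in $\lambda$; then $$\mathcal L_Y\alpha=-\mathcal L_{hV}\alpha+\bar\partial_\alpha(h\Phi).$$ Work on a region $U\subset\mathbb C^3$ and decompose $\mathbb{CP}^1=D_+\cup D_-$, with $D_-$ a finite disjoint union of open discs and $D_+$ its complement ($\partial D_+$ with boundary orientation), so that the poles of $h$ lie in $D_-\times U$, $h$ is holomorphic on $D_+$, and the support of $q^*\alpha$ lies in $D_+\times U$, so that $\alpha=0$ and $g$ is holomorphic near $\partial D_+$. Determinant bundle. $\mathcal A_+$ is the space of $SU(2)$-connections $d+A$ on the product bundle over $D_+$, smooth up to the boundary, identified with $\bar\partial$-operators $\bar\partial+\alpha$ by $A=\alpha-\alpha^*$. Operators are extended to $E_0=\mathbb C^2\otimes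 H^{-1}\to\mathbb{CP}^1$ ($H^{-1}$ the tautological bundle, with standard $\bar\partial$-operator $\bar\partial_0$) by $\bar\partial_0$ over $D_-$, with $E_0|_{D_+}$ identified with the product bundle. $\mathrm{Det}\to\mathcal A_+$ is Quillen's holomorphic determinant line bundle, $\sigma$ its canonical section, nonzero iff $\bar\partial_\alpha=g\circ\bar\partial_0\circ g^{-1}$ for some $g:\mathbb{CP}^1\to SL_2(\mathbb C)$, and where $\sigma\ne0$ the Quillen connection is $\nabla_\theta\sigma=\big(\frac{i}{2\pi}\int_{D_+}\mathrm{tr}(h_0^{-1}\partial h_0\wedge g^{-1}\theta g)\big)\sigma$, $h_0=g^*g$, for a tangent vector with $(0,1)$-part $\theta$ (Quillen's construction being assumed to extend to operators with jumps along $\partial D_+$). Lifts. An infinitesimal gauge transformation $u$ (acting by $\delta\alpha=-\bar\partial_\alpha u$) lifts to $\mathrm{Det}$ as the complex-linear extension of $\mathcal L_u=\nabla_{-d_Au}-iH_u$, $H_u(A)=-\frac1{2\pi}\int_{D_+}\mathrm{tr}(F_Au)+\frac1{2\pi}\oint\mathrm{tr}(Au)$. A complex vector field $\xi$ on $D_+$, tangent to $\partial D_+$, with holomorphic $(1,0)$-part (acting by $\delta A=\mathcal L_\xi A$) lifts as the complex-linear extension of $\mathcal L_\xi=\nabla_{\mathcal L_\xi A}-iH_\xi$, $H_\xi(A)=\frac1{2\pi}\int_{D_+}\mathrm{tr}(F_AA(\xi))-\frac1{4\pi}\oint\mathrm{tr}(AA(\xi))$; a holomorphic $(1,0)$-vector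 field is lifted by completing it with a $(0,1)$-part making it tangent to $\partial D_+$ (this can be taken to vanish on the support of $\alpha$, and the result does not depend on the choice). $\mathcal L_Y$ denotes the lift to $\mathrm{Det}$ of the variation of $\bar\partial_\alpha$ along $Y$, namely the sum of the lift of the vector field $\xi=-hV$ and the lift of the gauge transformation $u=-h\Phi$. The 1-form $d\log\tau$ is defined by $(Y\lrcorner d\log\tau)\sigma=\mathcal L_Y\sigma$; it defines $\tau$ up to a constant wherever it is closed. *)

(* Defs.v *)
From HB Require Import structures.
From mathcomp Require Import all_boot all_order all_algebra.
From mathcomp Require Import all_classical all_reals all_analysis.
From mathcomp Require Import complex.
From mathcomp Require Import ring.

Set Implicit Arguments.
Unset Strict Implicit.
Unset Printing Implicit Defensive.

Import Order.TTheory GRing.Theory Num.Theory.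
Import numFieldNormedType.Exports.
Local Open Scope classical_set_scope.
Local Open Scope ring_scope.
Local Open Scope complex_scope.

Section Calculus.
Variable R : realType.
Local Notation C := R[i].

Definition curve_diff (c : R -> C) (s : R) : Prop :=
  derivable (fun x => complex.Re (c x)) s 1 /\
  derivable (fun x => complex.Im (c x)) s 1.

Definition curve_deriv (c : R -> C) (s : R) : C :=
  derive1 (fun x => complex.Re (c x)) s +i*
  derive1 (fun x => complex.Im (c x)) s.

Section OnSpace.
Variable V : normedModType C.

(** The line through [z] in the direction [d], with a *real* parameter. *)
Definition along (f : V -> C) (d z : V) (s : R) : C := f (z + s%:C *: d).

Definition ddir (d : V) (f : V -> C) (z : V) : C := curve_deriv (along f d z) 0.

(** [n] times continuously differentiable in the real sense on an open [O]. *)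
Fixpoint Ck (n : nat) (O : set V) (f : V -> C) : Prop :=
  (forall z, O z -> {for z, continuous (f : V -> C^o)}) /\
  (if n is m.+1 then
     forall d : V, (forall z, O z -> curve_diff (along f d z) 0) /\
                   Ck m O (ddir d f)
   else True).

Definition smooth_on (O : set V) (f : V -> C) : Prop := forall n, Ck n O f.

Definition smooth_at (z : V) (f : V -> C) : Prop :=
  exists O : set V, [/\ open O, O z & smooth_on O f].

(** Wirtinger derivatives along the complex line spanned by [d]. *)
Definition dhol (d : V) (f : V -> C) (z : V) : C :=
  (ddir d f z - 'i * ddir ('i *: d) f z) / 2.
Definition dbar (d : V) (f : V -> C) (z : V) : C :=
  (ddir d f z + 'i * ddir ('i *: d) f z) / 2.

Definition holo_on (O : set V) (f : V -> C) : Prop :=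
  smooth_on O f /\ forall d z, O z -> dbar d f z = 0.

Definition holo_at (z : V) (f : V -> C) : Prop :=
  exists O : set V, [/\ open O, O z & holo_on O f].

Definition mx_smooth_at m n (z : V) (F : V -> 'M[C]_(m, n)) : Prop :=
  forall i j, smooth_at z (fun w => F w i j).

Definition mx_dhol m n (d : V) (F : V -> 'M[C]_(m, n)) (z : V) : 'M[C]_(m, n) :=
  \matrix_(i, j) dhol d (fun w => F w i j) z.
Definition mx_dbar m n (d : V) (F : V -> 'M[C]_(m, n)) (z : V) : 'M[C]_(m, n) :=
  \matrix_(i, j) dbar d (fun w => F w i j) z.

End OnSpace.

Definition mero_at (z : C) (f : C -> C) : Prop :=
  exists (k : nat) (F : C^o -> C), holo_at (z : C^o) F /\
    \forall w \near (z : C^o), w != z -> (w - z) ^+ k * f w = F w.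

End Calculus.

Section Sphere.
Variable R : realType.
Local Notation C := R[i].
Local Notation Mx := 'M[C]_2.

(** [Some l] is the point of coordinate lambda = [l], [None] is infinity. *)
Definition CP1 : Type := option C.

(** [chart false] is the coordinate lambda, [chart true] is 1 / lambda. *)
Definition chart (k : bool) (z : C^o) : CP1 :=
  if k then (if z == 0 then None else Some z^-1) else Some z.

Definition fun_smooth_near (S : set CP1) (f : CP1 -> C) : Prop :=
  forall k z, S (chart k z) -> smooth_at z (fun w => f (chart k w)).

Definition fun_holo_near (S : set CP1) (f : CP1 -> C) : Prop :=
  forall k z, S (chart k z) -> holo_at z (fun w => f (chart k w)).

Definition mx_smooth_near (S : set CP1) (F : CP1 -> Mx) : Prop :=
  forall k z, S (chart k z) -> mx_smooth_at z (fun w => F (chart k w)).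

Definition mx_continuous (F : CP1 -> Mx) : Prop :=
  forall k (z : C^o) i j, {for z, continuous (fun w : C^o => F (chart k w) i j : C^o)}.

Definition meromorphic (f : CP1 -> C) : Prop :=
  forall k z, mero_at z (fun w => f (chart k w)).

(** A (0,1)-form, a (1,0)-vector field and a (0,1)-vector field are given by
    their coefficients on d(conj lambda), d/d lambda and d/d(conj lambda).  The
    condition at infinity is smoothness of the coefficient in the coordinate
    zeta = 1 / lambda, obtained from d(conj lambda) = - (conj zeta)^-2 d(conj
    zeta) and d/d lambda = - zeta^2 d/d zeta. *)
Definition form01_smooth_near (S : set CP1) (a : C -> Mx) : Prop :=
  (forall l : C^o, S (Some l) -> mx_smooth_at l (a : C^o -> Mx)) /\
  (S None -> exists a1 : C^o -> Mx, mx_smooth_at 0 a1 /\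
     \forall z \near (0 : C^o), z != 0 -> a z^-1 = - (z^* ^+ 2) *: a1 z).

Definition vect01_smooth_near (S : set CP1) (x : C -> C) : Prop :=
  (forall l : C^o, S (Some l) -> smooth_at l (x : C^o -> C)) /\
  (S None -> exists x1 : C^o -> C, smooth_at 0 x1 /\
     \forall z \near (0 : C^o), z != 0 -> x z^-1 = - x1 z / (z^* ^+ 2)).

Definition dl m n (F : C -> 'M[C]_(m, n)) : C -> 'M[C]_(m, n) :=
  mx_dhol (1 : C^o) (F : C^o -> 'M[C]_(m, n)).
Definition dlb m n (F : C -> 'M[C]_(m, n)) : C -> 'M[C]_(m, n) :=
  mx_dbar (1 : C^o) (F : C^o -> 'M[C]_(m, n)).

(** Matrix-valued 1-forms on the lambda-plane: coefficients of d lambda and of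
    d(conj lambda).  A 2-form is its coefficient on d lambda /\ d(conj lambda). *)
Definition form1 : Type := ((C -> Mx) * (C -> Mx))%type.

Definition adj (m : Mx) : Mx := map_mx Num.conj m^T.

Definition wedge (w e : form1) (l : C) : Mx :=
  w.1 l *m e.2 l - w.2 l *m e.1 l.

Definition d0 (u : C -> Mx) : form1 := (dl u, dlb u).

Definition d1 (w : form1) (l : C) : Mx := dl w.2 l - dlb w.1 l.

(** A complex vector field [x.1 d/d lambda + x.2 d/d(conj lambda)]. *)
Definition vect : Type := ((C -> C) * (C -> C))%type.

Definition contr1 (x : vect) (w : form1) (l : C) : Mx :=
  x.1 l *: w.1 l + x.2 l *: w.2 l.

Definition contr2 (x : vect) (f : C -> Mx) : form1 :=
  (fun l => - x.2 l *: f l, fun l => x.1 l *: f l).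

Definition lie1 (x : vect) (w : form1) : form1 :=
  (fun l => (contr2 x (d1 w)).1 l + (d0 (contr1 x w)).1 l,
   fun l => (contr2 x (d1 w)).2 l + (d0 (contr1 x w)).2 l).

(** The unitary connection form A = alpha - alpha^*, alpha = [a] d(conj lambda). *)
Definition conn (a : C -> Mx) : form1 := (fun l => - adj (a l), a).

Definition curv (a : C -> Mx) (l : C) : Mx :=
  d1 (conn a) l + wedge (conn a) (conn a) l.

Definition cov_d (a : C -> Mx) (u : C -> Mx) : form1 :=
  (fun l => (d0 u).1 l + ((conn a).1 l *m u l - u l *m (conn a).1 l),
   fun l => (d0 u).2 l + ((conn a).2 l *m u l - u l *m (conn a).2 l)).

Definition mobius (m : Mx) (z : C) : CP1 :=
  let den := m 1 0 * z + m 1 1 in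
  if den == 0 then None else Some ((m 0 0 * z + m 0 1) / den).

(** Discs of the Riemann sphere: images of the unit disc under Moebius
    transformations (discs of the lambda-plane, open half-planes, and
    complements of closed discs with infinity added). *)
Definition odisc (m : Mx) : set CP1 := [set mobius m z | z in [set z | `|z| < 1]].
Definition cdisc (m : Mx) : set CP1 := [set mobius m z | z in [set z | `|z| <= 1]].

Record discs : Type := Discs {
  ndiscs : nat;
  dmob : 'I_ndiscs -> Mx;
  dmob_unit : forall j, dmob j \in unitmx;
  dmob_disj : forall j k, j != k -> cdisc (dmob j) `&` cdisc (dmob k) = set0
}.

Section Decomposition.
Variable D : discs.

Definition Dminus : set CP1 := \bigcup_(j in [set: 'I_(ndiscs D)]) odisc (dmob j).
Definition Dminus_closed : set CP1 :=
  \bigcup_(j in [set: 'I_(ndiscs D)]) cdisc (dmob j).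
Definition Dplus : set CP1 := ~` Dminus.
Definition bdry : set CP1 := Dminus_closed `\` Dminus.

(** Boundary of the [j]-th disc in the coordinate lambda, counterclockwise; the
    value is irrelevant at the at most one angle where the circle meets
    infinity. *)
Definition circ (j : 'I_(ndiscs D)) (s : R) : C :=
  odflt 0 (mobius (dmob j) (cos s +i* sin s)).

(** [int_bdry] is the integral over the boundary of [Dplus] of the scalar form
    [w1 d lambda + w2 d(conj lambda)]; the boundary orientation of [Dplus] is
    opposite to that of the discs. *)
Definition circ_integrand (w1 w2 : C -> C) (j : 'I_(ndiscs D)) (s : R) : C :=
  w1 (circ j s) * curve_deriv (circ j) s +
  w2 (circ j s) * (curve_deriv (circ j) s)^*.

Definition int_bdry (w1 w2 : C -> C) : C :=
  - \sum_(j < ndiscs D)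
     ((\int[lebesgue_measure]_(s in `[0%R, 2 * pi])
          complex.Re (circ_integrand w1 w2 j s)) +i*
      (\int[lebesgue_measure]_(s in `[0%R, 2 * pi])
          complex.Im (circ_integrand w1 w2 j s))).

(** The integral over [Dplus] of [f d lambda /\ d(conj lambda)]: for
    lambda = x + i y, d lambda /\ d(conj lambda) = -2i dx /\ dy. *)
Definition Dplus_plane : set (R * R) := [set xy | Dplus (Some (xy.1 +i* xy.2))].

Definition int_Dplus (f : C -> C) : C :=
  - 2 * 'i *
  ((\int[(lebesgue_measure \x lebesgue_measure)%E]_(xy in Dplus_plane)
       complex.Re (f (xy.1 +i* xy.2))) +i*
   (\int[(lebesgue_measure \x lebesgue_measure)%E]_(xy in Dplus_plane)
       complex.Im (f (xy.1 +i* xy.2)))).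

(** The space of connections on the product bundle over [Dplus], and its
    tangent space, through the (0,1)-parts. *)
Definition sl2_form01 (a : C -> Mx) : Prop :=
  form01_smooth_near Dplus a /\ forall l, Dplus (Some l) -> \tr (a l) = 0.

Definition smooth_upto (S : set CP1) (F : CP1 -> Mx) : Prop :=
  exists G, mx_smooth_near S G /\ forall z, S z -> F z = G z.

(** At the point [l], dbar + a = g o dbar o g^-1 on sections.  In a local
    holomorphic frame of the tautological bundle this is also the condition on
    sections of C^2 (x) H^-1. *)
Definition conjugates_at (a : C -> Mx) (g : CP1 -> Mx) (l : C) : Prop :=
  forall s : C -> 'cV[C]_2, (forall z : C^o, mx_smooth_at z (s : C^o -> 'cV[C]_2)) ->
    dlb s l + a l *m s l =
    g (Some l) *m dlb (fun w => invmx (g (Some w)) *m s w) l.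

(** Extension by the standard dbar-operator over [Dminus]. *)
Definition extend (a : C -> Mx) (l : C) : Mx :=
  if `[< Dplus (Some l) >] then a l else 0.

(** [g] carries the standard operator to the extension of dbar + a, which may
    jump across the boundary. *)
Definition trivializes (a : C -> Mx) (g : CP1 -> Mx) : Prop :=
  [/\ forall z, \det (g z) = 1,
      mx_continuous g,
      smooth_upto Dplus g,
      smooth_upto Dminus_closed g &
      forall l, ~ bdry (Some l) -> conjugates_at (extend a) g l].

Definition quillen_form (g : CP1 -> Mx) (th : C -> Mx) : C :=
  let g' := fun l => g (Some l) in
  let h0 := fun l => adj (g' l) *m g' l in
  'i / (2 * pi%:C) *
  int_Dplus (fun l => \tr (wedge
     (fun l => invmx (h0 l) *m dl h0 l, fun=> 0)
     (fun=> 0, fun l => invmx (g' l) *m th l *m g' l) l)).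

(** Quillen's determinant line bundle with its canonical section and the
    covariant derivative of that section in the direction of the tangent vector
    with (0,1)-part [th].  Only the values at elements of the space of
    connections are constrained.  Since the form is complex-linear in [th], so
    is the derivative, which extends it to complex tangent vectors. *)
Record quillen_det : Type := QuillenDet {
  det_line : (C -> Mx) -> vectType C;
  det_line_dim : forall a, sl2_form01 a -> \dim {: det_line a} = 1%N;
  det_sec : forall a, det_line a;
  det_sec_neq0 : forall a, sl2_form01 a ->
    det_sec a != 0 <-> exists g, trivializes a g;
  det_nabla : forall a : C -> Mx, (C -> Mx) -> det_line a;
  det_nablaE : forall a g th, sl2_form01 a -> sl2_form01 th ->
    trivializes a g -> det_nabla a th = quillen_form g th *: det_sec a
}.

Definition int_bdry_tr (w : form1) : C :=
  int_bdry (fun l => \tr (w.1 l)) (fun l => \tr (w.2 l)).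

Definition mulf (w : form1) (u : C -> Mx) : form1 :=
  (fun l => w.1 l *m u l, fun l => w.2 l *m u l).

Definition H_gauge (a u : C -> Mx) : C :=
  - (1 / (2 * pi%:C)) * int_Dplus (fun l => \tr (curv a l *m u l)) +
  1 / (2 * pi%:C) * int_bdry_tr (mulf (conn a) u).

Definition H_vect (a : C -> Mx) (x : vect) : C :=
  1 / (2 * pi%:C) * int_Dplus (fun l => \tr (curv a l *m contr1 x (conn a) l)) -
  1 / (4 * pi%:C) * int_bdry_tr (mulf (conn a) (contr1 x (conn a))).

Variable Q : quillen_det.

(** For su(2)-valued [u] and real vector fields [x] these are the lifts; every
    ingredient is complex-linear in [u] and [x], so that the same formulas give
    the complex-linear extension. *)
Definition lift_gauge (a u : C -> Mx) : det_line Q a :=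
  det_nabla Q a (fun l => - (cov_d a u).2 l) - ('i * H_gauge a u) *: det_sec Q a.

Definition lift_vect (a : C -> Mx) (x : vect) : det_line Q a :=
  det_nabla Q a (lie1 x (conn a)).2 - ('i * H_vect a x) *: det_sec Q a.

(** [e] is a (0,1)-part making [x + e] tangent to the boundary: there,
    (x, e) is a complex multiple of the tangent vector (c', conj c'). *)
Definition completes (x e : C -> C) : Prop :=
  vect01_smooth_near Dplus e /\
  forall (j : 'I_(ndiscs D)) (s : R),
    mobius (dmob j) (cos s +i* sin s) != None ->
    x (circ j s) * (curve_deriv (circ j) s)^* =
    e (circ j s) * curve_deriv (circ j) s.

End Decomposition.

Definition line_quotient (L : vectType C) (x s : L) : C :=
  xget 0 [set c | x = c *: s].

End Sphere.

Section Twistor.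
Variable R : realType.
Local Notation C := R[i].
Local Notation Mx := 'M[C]_2.

(** Points [(t, x, v)] and vectors [(Y^t, Y^x, Y^v)]. *)
Definition C3 : Type := (C^o * C^o * C^o)%type.
Definition ct (p : C3) : C := p.1.1.
Definition cx (p : C3) : C := p.1.2.
Definition cv (p : C3) : C := p.2.

Definition holo_vect_on (U : set C3) (Y : C3 -> C3) : Prop :=
  [/\ holo_on U (fun p => ct (Y p)), holo_on U (fun p => cx (Y p)) &
      holo_on U (fun p => cv (Y p))].

Record sym_coef : Type := SymCoef {
  s_a : C; s_b : C; s_c : C;
  s_al : C; s_be : C; s_ga : C; s_de : C
}.

Definition V0 (l : C) : C3 := (0, 1, - l).
Definition V1 (l : C) : C3 := (1, - l, 0).

Section Symmetry.
Variable X : sym_coef.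

Definition Xfield (p : C3) : C3 :=
  (s_a X + s_al X * cx p - s_be X * ct p + s_de X * ct p,
   s_b X + 2 * s_al X * cv p - 2 * s_ga X * ct p + s_de X * cx p,
   s_c X + s_be X * cv p - s_ga X * cx p + s_de X * cv p).

Definition Vcoef (l : C) : C := s_al X * l ^+ 2 + s_be X * l + s_ga X.

Definition mu (p : C3) (l : C) : C := cv p + l * cx p + l ^+ 2 * ct p.

(** The vector field on minitwistor space is
    [Vcoef d/d lambda + Mcoef d/d mu]. *)
Definition Mcoef (l m : C) : C :=
  s_c X + s_b X * l + s_a X * l ^+ 2 + (s_be X + s_de X + 2 * s_al X * l) * m.

(** The lift of [X] to the correspondence space descends: its derivative of mu
    depends on mu and lambda only. *)
Lemma Xlift_mu (p : C3) (l : C) :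
  cv (Xfield p) + l * cx (Xfield p) + l ^+ 2 * ct (Xfield p) +
  Vcoef l * (cx p + 2 * l * ct p) = Mcoef l (mu p l).
Proof. by rewrite /Xfield /Vcoef /Mcoef /mu /ct /cx /cv /=; ring. Qed.

End Symmetry.

(** Points of the total space of O(2): a base point, with the fibre coordinate
    mu over [Some l] and nu = mu / lambda^2 over infinity. *)
Definition minitwistor : Type := (CP1 R * C)%type.

(** Coordinates (lambda, mu), resp. (zeta, nu) = (1 / lambda, mu / lambda^2). *)
Definition zchart (k : bool) (w : C^o * C^o) : minitwistor :=
  if k then (chart true w.1, if w.1 == 0 then w.2 else w.2 / w.1 ^+ 2)
  else (Some w.1, w.2).

Definition qmap (p : C3) (z : CP1 R) : minitwistor :=
  if z is Some l then (Some l, mu p l) else (None, ct p).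

Definition dl2 m n : (C^o * C^o -> 'M[C]_(m, n)) -> C^o * C^o -> 'M[C]_(m, n) :=
  mx_dhol ((1, 0) : C^o * C^o).
Definition dm2 m n : (C^o * C^o -> 'M[C]_(m, n)) -> C^o * C^o -> 'M[C]_(m, n) :=
  mx_dhol ((0, 1) : C^o * C^o).
Definition dlb2 m n : (C^o * C^o -> 'M[C]_(m, n)) -> C^o * C^o -> 'M[C]_(m, n) :=
  mx_dbar ((1, 0) : C^o * C^o).
Definition dmb2 m n : (C^o * C^o -> 'M[C]_(m, n)) -> C^o * C^o -> 'M[C]_(m, n) :=
  mx_dbar ((0, 1) : C^o * C^o).

(** The product bundle with the operator dbar + a d(conj lambda); [tb_a] is [a]
    in the coordinates (lambda, mu), and [tb_smooth_infty] is smoothness of the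
    form over lambda = infinity. *)
Record twistor_bundle : Type := TwistorBundle {
  tb_a : C^o * C^o -> Mx;
  tb_smooth : forall w, mx_smooth_at w tb_a;
  tb_smooth_infty : exists a1 : C^o * C^o -> Mx,
    (forall w, mx_smooth_at w a1) /\
    forall z n : C, z != 0 -> tb_a (z^-1, n / z ^+ 2) = - (z^* ^+ 2) *: a1 (z, n);
  tb_tr : forall w, \tr (tb_a w) = 0;
  tb_holo_mu : forall w, dmb2 tb_a w = 0
}.

(** The two components of the dbar-operator on sections over the chart
    (lambda, mu), and the Lie derivative along the symmetry lifted by [phi].
    The vector field being holomorphic, its Lie derivative acts on (0,1)-forms
    componentwise. *)
Definition dbarE_l (E : twistor_bundle) (s : C^o * C^o -> 'cV[C]_2) (w : C^o * C^o) :=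
  dlb2 s w + tb_a E w *m s w.
Definition dbarE_m (s : C^o * C^o -> 'cV[C]_2) (w : C^o * C^o) := dmb2 s w.
Definition lieE (X : sym_coef) (phi : C^o * C^o -> Mx)
    (s : C^o * C^o -> 'cV[C]_2) (w : C^o * C^o) :=
  Vcoef X w.1 *: dl2 s w + Mcoef X w.1 w.2 *: dm2 s w + phi w *m s w.

(** Invariance of the bundle: a lift of the symmetry commuting with the
    dbar-operator. *)
Record invariant_under (X : sym_coef) (E : twistor_bundle) : Type := InvariantUnder {
  iv_phi : minitwistor -> Mx;
  iv_smooth : forall k w, mx_smooth_at w (fun w' => iv_phi (zchart k w'));
  iv_tr : forall z, \tr (iv_phi z) = 0;
  iv_commutes : forall s : C^o * C^o -> 'cV[C]_2, (forall w, mx_smooth_at w s) ->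
    let L := lieE X (fun w => iv_phi (zchart false w)) in
    forall w, L (dbarE_l E s) w = dbarE_l E (L s) w /\
              L (dbarE_m s) w = dbarE_m (L s) w
}.

Definition pull_a (E : twistor_bundle) (p : C3) (l : C) : Mx := tb_a E (l, mu p l).

Definition pull_phi X E (I : invariant_under X E) (p : C3) (z : CP1 R) : Mx :=
  iv_phi I (qmap p z).

(** [Y = f0 V0 + f1 V1 + h X] at [p], away from the poles. *)
Definition decomposes (X : sym_coef) (p y : C3) (f0 f1 h : CP1 R -> C) : Prop :=
  forall l : C^o, holo_at l (fun w => f0 (Some w)) ->
    holo_at l (fun w => f1 (Some w)) -> holo_at l (fun w => h (Some w)) ->
    y =
      (f0 (Some l) *: V0 l +
       f1 (Some l) *: V1 l +
       h (Some l) *: Xfield X p).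

Definition vanishes_near (S : set (CP1 R)) (a : C -> Mx) : Prop :=
  forall k z, S (chart k z) ->
    \forall w \near (z : C^o), forall l, chart k w = Some l -> a l = 0.

Section Tau.
Variables (D : discs R) (Q : quillen_det D).
Variables (X : sym_coef) (E : twistor_bundle) (I : invariant_under X E).
Variables (p : C3) (h : CP1 R -> C).

Definition xi10 (l : C) : C := - (h (Some l) * Vcoef X l).

(** The lift of the variation of the dbar-operator along [Y], applied to the
    canonical section; [e] completes [- h V] to a field tangent to the boundary. *)
Definition lift_Y (e : C -> C) : det_line Q (pull_a E p) :=
  lift_vect Q (pull_a E p) (xi10, e) +
  lift_gauge Q (pull_a E p) (fun l => - h (Some l) *: pull_phi I p (Some l)).

Definition Y_dlog_tau (e : C -> C) : C :=
  line_quotient (lift_Y e) (det_sec Q (pull_a E p)).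

(** [tau_form g w] is h tr (1/2 (V g) g^-1 w g^-1 + Phi w g^-1) for a component
    [w] of [d g]. *)
Definition tau_form (g : CP1 R -> Mx) (w : C -> Mx) (l : C) : C :=
  let g' := fun l => g (Some l) in
  let gi := invmx (g' l) in
  h (Some l) * \tr (2^-1 *: ((Vcoef X l *: dl g' l) *m gi *m w l *m gi) +
                    pull_phi I p (Some l) *m w l *m gi).

End Tau.
End Twistor.

(* Main.v *)
Require Import Defs.
From mathcomp Require Import all_boot all_order all_algebra.
From mathcomp Require Import all_classical all_reals all_analysis.
From mathcomp Require Import complex measurable_realfun.
From mathcomp Require Import ring lra.

Set Implicit Arguments.
Unset Strict Implicit.
Unset Printing Implicit Defensive.

Import Order.TTheory GRing.Theory Num.Theory.
Import numFieldNormedType.Exports.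
Local Open Scope classical_set_scope.
Local Open Scope ring_scope.
Local Open Scope complex_scope.

(** Write [a = - (dbar g) g^-1], [G = (dl g) g^-1] and [c = - a^* + G], the
    difference of the (1,0)-parts of the connection [A = a - a^*] and of the flat
    connection which [g] trivializes; then [F_A = - (dbar c + [a, c])].  Quillen's
    form is the integral of [tr (c theta)].  With [w = A(xi) - u] the tangent
    vector of the variation along [Y] is [theta = xi F_A + dbar w + [a, w]], so
    that, [xi] having a holomorphic (1,0)-part [x1], the integrands of the
    connection form and of the two functions [H] add up to
    [dbar (- x1 tr (c^2) / 2 + tr (c w))].  By Stokes' theorem only an integral
    over the boundary remains, and there [a = 0], [c = G].

    Stokes' theorem on the complement of the discs: a cutoff extends the form to
    the whole sphere, where the integral of [dbar] of a (1,0)-form vanishes; the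
    integral over each disc is pulled back to the unit disc by a Moebius
    transformation and computed there by Fubini.  The Jacobian formula for
    Moebius transformations is reduced to translations, similarities and
    inversion, and these to shears, hence to affine maps of the line. *)

(** * Calculus on complex normed spaces *)

(** The two functions [H] are what makes the sum exact: pairing [c] with [dbar w + [a, w]] produces
    [tr (F_A w)] besides an exact term, and the area integrals of [H] remove precisely this. The
    factor [1/2] comes from [tr (c dbar c) = dbar tr (c ^ 2) / 2], the commutator contributing [tr
    (c [a, c]) = 0]. The obstacle is infinity: it may lie in [Dplus], in a disc or on a circle,
    while every integral is written in the coordinate lambda. Coefficients therefore carry a
    transition law under [z = 1 / lambda], and integrability over a possibly unbounded [Dplus] is
    deduced from continuity on the compact sphere. Smoothness is given through iterated directional
    derivatives, so the chain rule and the symmetry of second derivatives have to be drawn from the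
    mean value theorem on segments. Only discs are accessible to direct computation; [Dplus] is
    reached as the sphere minus the discs, although the form to be integrated is controlled near
    [Dplus] only. *)

Section ComplexContinuity.
Variable R : realType.
Local Notation C := R[i].
Local Notation re := (@complex.Re R).
Local Notation im := (@complex.Im R).

Lemma complex_ext (x y : C) : re x = re y -> im x = im y -> x = y.
Proof. by case: x => a b; case: y => c d /= -> ->. Qed.

Lemma ReD (x y : C) : re (x + y) = re x + re y.
Proof. by case: x => a b; case: y. Qed.
Lemma ImD (x y : C) : im (x + y) = im x + im y.
Proof. by case: x => a b; case: y. Qed.
Lemma ReN (x : C) : re (- x) = - re x.
Proof. by case: x. Qed.
Lemma ImN (x : C) : im (- x) = - im x.
Proof. by case: x. Qed.
Lemma ReM (x y : C) : re (x * y) = re x * re y - im x * im y.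
Proof. by case: x => a b; case: y. Qed.
Lemma ImM (x y : C) : im (x * y) = re x * im y + im x * re y.
Proof. by case: x => a b; case: y. Qed.
Lemma Re_conjc (x : C) : re (conjc x) = re x.
Proof. by case: x. Qed.
Lemma Im_conjc (x : C) : im (conjc x) = - im x.
Proof. by case: x. Qed.
Lemma ReC (x : R) : re x%:C = x. Proof. by []. Qed.
Lemma ImC (x : R) : im x%:C = 0. Proof. by []. Qed.

Definition reimE := (ReD, ImD, ReN, ImN, ReM, ImM, Re_conjc, Im_conjc, ReC, ImC).

Lemma conj_conjc (x : C) : Num.conj x = conjc x.
Proof. by []. Qed.

Lemma re2im2_eq0 (x : C) : (re x ^+ 2 + im x ^+ 2 == 0) = (x == 0).
Proof. by rewrite eq_complex /= paddr_eq0 ?sqr_ge0// !sqrf_eq0. Qed.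

Lemma le_Re_norm (x : C) : `|re x|%:C <= `|x|.
Proof. exact: normc_ge_Re. Qed.

Lemma le_Im_norm (x : C) : `|im x|%:C <= `|x|.
Proof.
have := le_Re_norm (x * 'i%C); rewrite ReiNIm normrN normrM.
suff -> : `|'i%C| = 1 :> C by rewrite mulr1.
by rewrite normc_def /= expr0n expr1n /= add0r sqrtr1.
Qed.

Lemma norm_le_ReIm (x : C) : `|x| <= (`|re x| + `|im x|)%:C.
Proof.
rewrite [x in `|x|]complexE (le_trans (ler_normD _ _))//.
rewrite normrM rmorphD /= lerD//.
- by rewrite normc_def /= expr0n addr0 sqrtr_sqr.
- suff -> : `|'i%C| = 1 :> C by rewrite mul1r normc_def /= expr0n addr0 sqrtr_sqr.
  by rewrite normc_def /= expr0n expr1n /= add0r sqrtr1.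
Qed.

Section Cvg.
Context {T : Type} {F : set_system T} {FF : Filter F}.

Lemma cvg_Re (f : T -> C) (l : C) : (f : T -> C^o) @ F --> (l : C^o) ->
  (fun x => re (f x) : R^o) @ F --> (re l : R^o).
Proof.
move=> /cvgrPdist_lt fl; apply/cvgrPdist_lt => e e0.
have e0' : 0 < e%:C :> C by rewrite ltcR.
apply: filterS (fl _ e0') => x lx.
rewrite -ltcR; apply: le_lt_trans lx.
by rewrite -ReN -ReD le_Re_norm.
Qed.

Lemma cvg_Im (f : T -> C) (l : C) : (f : T -> C^o) @ F --> (l : C^o) ->
  (fun x => im (f x) : R^o) @ F --> (im l : R^o).
Proof.
move=> /cvgrPdist_lt fl; apply/cvgrPdist_lt => e e0.
have e0' : 0 < e%:C :> C by rewrite ltcR.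
apply: filterS (fl _ e0') => x lx.
rewrite -ltcR; apply: le_lt_trans lx.
by rewrite -ImN -ImD le_Im_norm.
Qed.

Lemma cvg_ReIm (f : T -> C) (l : C) :
  (fun x => re (f x) : R^o) @ F --> (re l : R^o) ->
  (fun x => im (f x) : R^o) @ F --> (im l : R^o) ->
  (f : T -> C^o) @ F --> (l : C^o).
Proof.
move=> /cvgrPdist_lt fr /cvgrPdist_lt fi; apply/cvgrPdist_lt => e.
(* A positive element of [C] is real, so the complex radius in the limit criterion is a real one. *)
case: e => [e e']; rewrite ltcE /= => /andP[/eqP -> e0].
have e2 : 0 < e / 2 by rewrite divr_gt0.
near=> x; apply: le_lt_trans (norm_le_ReIm _) _.
rewrite ltcR (splitr e) ltrD// !reimE /=.
- by near: x; apply: fr.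
- by near: x; apply: fi.
Unshelve. all: by end_near. Qed.

Lemma cvg_conjc (f : T -> C) (l : C) : (f : T -> C^o) @ F --> (l : C^o) ->
  (fun x => conjc (f x) : C^o) @ F --> (conjc l : C^o).
Proof.
move=> fl; apply: cvg_ReIm.
- rewrite Re_conjc; under eq_cvg do rewrite Re_conjc; exact: cvg_Re.
- rewrite Im_conjc; under eq_cvg do rewrite Im_conjc; apply: cvgN; exact: cvg_Im.
Qed.

Lemma cvg_real_complex (f : T -> R) (l : R) : (f : T -> R^o) @ F --> (l : R^o) ->
  (fun x => (f x)%:C : C^o) @ F --> (l%:C : C^o).
Proof. by move=> fl; apply: cvg_ReIm => //=; exact: cvg_cst. Qed.

End Cvg.
End ComplexContinuity.

(** * Derivatives of complex-valued functions of a real variable *)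

Section CurveCalculus.
Variable R : realType.
Local Notation C := R[i].
Local Notation re := (@complex.Re R).
Local Notation im := (@complex.Im R).

(** Existence and value in one predicate, as for [is_derive]: the rules below then compose without
    separate derivability conditions. *)
Definition is_cderive (c : R -> C) (s : R) (l : C) : Prop :=
  is_derive s 1 (fun x => re (c x)) (re l) /\
  is_derive s 1 (fun x => im (c x)) (im l).

Lemma is_cderiveP c s l :
  is_cderive c s l <-> curve_diff c s /\ curve_deriv c s = l.
Proof.
rewrite /curve_diff /curve_deriv /is_cderive !derive1E; split.
- by move=> [[d1 e1] [d2 e2]]; split; [exact: conj d1 d2|by apply: complex_ext].
- by move=> [[d1 d2] <-]; split; [exact: (DeriveDef d1 erefl)|exact: (DeriveDef d2 erefl)].
Qed.

Lemma curve_diffP c s : curve_diff c s -> is_cderive c s (curve_deriv c s).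
Proof. by move=> h; apply/is_cderiveP. Qed.

Lemma is_cderive_diff c s l : is_cderive c s l -> curve_diff c s.
Proof. by move=> /is_cderiveP[]. Qed.

Lemma is_cderive_deriv c s l : is_cderive c s l -> curve_deriv c s = l.
Proof. by move=> /is_cderiveP[]. Qed.

Lemma is_cderive_eq c s l l' : is_cderive c s l -> l = l' -> is_cderive c s l'.
Proof. by move=> ? <-. Qed.

Lemma is_cderive_near c d s l :
  (\forall x \near s, c x = d x) -> is_cderive c s l -> is_cderive d s l.
Proof.
move=> cd [h1 h2]; split.
- apply: near_eq_is_derive h1.
  by apply: filterS cd => x ->.
- apply: near_eq_is_derive h2.
  by apply: filterS cd => x ->.
Qed.

Lemma is_cderive_cst (k : C) s : is_cderive (fun=> k) s 0.
Proof. by split; exact: is_derive_cst. Qed.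

Lemma is_cderive_real (f : R -> R) (s l : R) :
  is_derive s 1 f l -> is_cderive (fun x => (f x)%:C) s l%:C.
Proof. by move=> h; split => //=; exact: is_derive_cst. Qed.

Lemma is_cderiveN c s l : is_cderive c s l -> is_cderive (fun x => - c x) s (- l).
Proof.
move=> [h1 h2]; split.
- rewrite ReN; under eq_fun do rewrite ReN; exact: is_deriveN.
- rewrite ImN; under eq_fun do rewrite ImN; exact: is_deriveN.
Qed.

Lemma is_cderiveD c d s l m : is_cderive c s l -> is_cderive d s m ->
  is_cderive (fun x => c x + d x) s (l + m).
Proof.
move=> [h1 h2] [k1 k2]; split.
- rewrite ReD; under eq_fun do rewrite ReD; exact: is_deriveD.
- rewrite ImD; under eq_fun do rewrite ImD; exact: is_deriveD.
Qed.

Lemma is_cderiveM c d s l m : is_cderive c s l -> is_cderive d s m ->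
  is_cderive (fun x => c x * d x) s (l * d s + c s * m).
Proof.
move=> [h1 h2] [k1 k2]; split.
- under eq_fun do rewrite ReM.
  apply: (is_derive_eq (is_deriveB (is_deriveM h1 k1) (is_deriveM h2 k2))).
  by rewrite !reimE /GRing.scale /=; ring.
- under eq_fun do rewrite ImM.
  apply: (is_derive_eq (is_deriveD (is_deriveM h1 k2) (is_deriveM h2 k1))).
  by rewrite !reimE /GRing.scale /=; ring.
Qed.

Lemma is_derive1V (f : R -> R) (s l : R) : f s != 0 -> is_derive s 1 f l ->
  is_derive s 1 (fun x => (f x)^-1) (- (l / f s ^+ 2)).
Proof.
move=> f0 [h <-]; have := @derivableV _ _ f s 1 f0 h; move=> hv.
have := @deriveV _ _ f s 1 f0 h => e.
split=> //; rewrite e /GRing.scale /=; field; exact: f0.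
Qed.

Lemma is_cderive_conj c s l :
  is_cderive c s l -> is_cderive (fun x => conjc (c x)) s (conjc l).
Proof.
move=> [h1 h2]; split.
- rewrite Re_conjc; under eq_fun do rewrite Re_conjc; exact: h1.
- rewrite Im_conjc; under eq_fun do rewrite Im_conjc; exact: is_deriveN.
Qed.

(** Writing [1 / c] as [conj c / (c * conj c)] makes the denominator real, so that only the inverse
    of a real function has to be differentiated. *)
Lemma is_cderiveV c s l : c s != 0 -> is_cderive c s l ->
  is_cderive (fun x => (c x)^-1) s (- (l / c s ^+ 2)).
Proof.
move=> c0 hc.
have c0' : conjc (c s) != 0 by rewrite conjc_eq0.
pose n x : R := re (c x) ^+ 2 + im (c x) ^+ 2.
have n0 : n s != 0 by rewrite /n re2im2_eq0.
have nE x : (n x)%:C = c x * conjc (c x).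
  by rewrite /n add_Re2_Im2 sqr_normc.
have [h1 h2] := hc.
have hn := is_deriveD (is_deriveM h1 h1) (is_deriveM h2 h2).
have {}hn : is_derive s 1 n (2 * (re (c s) * re l + im (c s) * im l)).
  apply: is_derive_eq hn _; rewrite /GRing.scale /=; ring.
have hV := is_derive1V n0 hn.
have := is_cderiveM (is_cderive_conj hc) (is_cderive_real hV).
under eq_fun do rewrite fmorphV /= nE.
(* At zeros of [c] both sides are [0], by the convention for the inverse. *)
have -> : (fun x => conjc (c x) / (c x * conjc (c x))) = (fun x => (c x)^-1).
  apply/funext => x; have [->|cx0] := eqVneq (c x) 0; first by rewrite mul0r invr0 mulr0.
  have cx0' : conjc (c x) != 0 by rewrite conjc_eq0.
  by field; apply/andP.
move=> /is_cderive_eq; apply.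
have e : (2 * (re (c s) * re l + im (c s) * im l))%:C =
    c s * conjc l + conjc (c s) * l.
  by apply: complex_ext; rewrite !reimE /=; ring.
have nV : (2 * (re (c s) * re l + im (c s) * im l) / n s ^+ 2)%:C =
    (c s * conjc l + conjc (c s) * l) / (c s * conjc (c s)) ^+ 2.
  by rewrite -e -nE -rmorphXn -fmorphV -rmorphM.
rewrite rmorphN /= nV fmorphV /= nE.
by field; apply/andP.
Qed.

Lemma is_cderive_reparam c (t : R -> R) (s : R) l (t' : R) :
  is_cderive c (t s) l -> is_derive s 1 t t' -> is_cderive (c \o t) s (t'%:C * l).
Proof.
move=> [h1 h2] ht; split.
- have := @is_derive1_comp _ (fun x => re (c x)) t s (re l) t' h1 ht.
  by rewrite !reimE mul0r subr0 mulrC.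
- have := @is_derive1_comp _ (fun x => im (c x)) t s (im l) t' h2 ht.
  by rewrite !reimE mul0r addr0 mulrC.
Qed.

End CurveCalculus.

(** * The classes [Ck] on open sets of a normed space *)

Section Smooth.
Variable R : realType.
Local Notation C := R[i].
Local Notation re := (@complex.Re R).
Local Notation im := (@complex.Im R).
Variable V : normedModType C.
Implicit Types (f g : V -> C) (O : set V) (d e z v : V).

Lemma cvg_line d z (s : R) :
  (fun x : R => z + x%:C *: d) @ s --> z + s%:C *: d.
Proof.
apply: cvgD; first exact: cvg_cst.
apply: (@cvgZr_tmp _ _ _ _ _ (fun x : R => x%:C : C^o) (s%:C) d).
apply: cvg_real_complex; exact: cvg_id.
Qed.

Lemma near_line O d z : open O -> O z -> \forall s \near (0 : R), O (z + s%:C *: d).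
Proof.
move=> oO Oz; have := @cvg_line d z 0; rewrite scale0r addr0; apply.
exact: open_nbhs_nbhs.
Qed.

Lemma along0 f d z : along f d z 0 = f z.
Proof. by rewrite /along scale0r addr0. Qed.

(** [Ck] speaks of derivatives at the parameter [0] only; moving the base point along the line turns
    them into derivatives at every parameter. *)
Lemma is_cderive_along_shift f d z (s : R) l :
  is_cderive (along f d (z + s%:C *: d)) 0 l -> is_cderive (along f d z) s l.
Proof.
move=> h.
have ht : is_derive s 1 (fun x : R => x - s) (1 : R).
  apply: (is_derive_eq (is_deriveB (is_derive_id s 1) (is_derive_cst s s 1))).
  by rewrite subr0.
have := @is_cderive_reparam _ (along f d (z + s%:C *: d)) (fun x => x - s) s l 1.
rewrite subrr mul1r => /(_ h ht); congr (is_cderive _ _ _).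
apply/funext => x; rewrite /= /along -addrA -scalerDl -rmorphD /=.
by rewrite [s + _]addrC subrK.
Qed.

Lemma ddir_is_cderive f d z : curve_diff (along f d z) 0 ->
  is_cderive (along f d z) 0 (ddir d f z).
Proof. exact: curve_diffP. Qed.

Lemma Ck_continuous n O f z : Ck n O f -> O z -> {for z, continuous (f : V -> C^o)}.
Proof. by case: n => [|n] /= [+ _] => h; exact: h. Qed.

Lemma CkS_diff n O f d z : Ck n.+1 O f -> O z -> curve_diff (along f d z) 0.
Proof. by move=> [_ /(_ d)[h _]]; exact: h. Qed.

Lemma CkS_is_cderive n O f d z : Ck n.+1 O f -> O z ->
  is_cderive (along f d z) 0 (ddir d f z).
Proof. by move=> h Oz; apply/ddir_is_cderive/(CkS_diff _ h). Qed.

Lemma CkS_ddir n O f d : Ck n.+1 O f -> Ck n O (ddir d f).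
Proof. by move=> [_ /(_ d)[]]. Qed.

Lemma CkW n O f : Ck n.+1 O f -> Ck n O f.
Proof.
elim: n f => [|n IH] f [h1 h2]; split => // d.
have [h3 h4] := h2 d; split => //; exact: IH.
Qed.

Lemma Ck_sub n O O' f : O' `<=` O -> Ck n O f -> Ck n O' f.
Proof.
move=> s; elim: n f => [|n IH] f [h1 h2]; split => //.
- by move=> z /s; exact: h1.
- by move=> z /s; exact: h1.
- move=> d; have [h3 h4] := h2 d; split; first by move=> z /s; exact: h3.
  exact: IH.
Qed.

Lemma near_along_eq O f g d z : open O -> O z -> (forall w, O w -> f w = g w) ->
  \forall s \near (0 : R), along f d z s = along g d z s.
Proof. by move=> oO Oz fg; apply: filterS (near_line d oO Oz) => s /fg. Qed.

Lemma ddir_ext O f g d z : open O -> O z -> (forall w, O w -> f w = g w) ->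
  curve_diff (along f d z) 0 -> ddir d g z = ddir d f z.
Proof.
move=> oO Oz fg /curve_diffP h; apply: is_cderive_deriv.
apply: is_cderive_near h; exact: near_along_eq fg.
Qed.

Lemma continuous_ext O f g z : open O -> O z -> (forall w, O w -> f w = g w) ->
  {for z, continuous (f : V -> C^o)} -> {for z, continuous (g : V -> C^o)}.
Proof.
move=> oO Oz fg h.
have h' : (f : V -> C^o) @ z --> (f z : C^o) by exact: h.
suff : (g : V -> C^o) @ z --> (g z : C^o) by [].
rewrite -(fg z Oz); apply: cvg_trans h'; apply: near_eq_cvg.
by near=> w; rewrite fg//; near: w; exact: open_nbhs_nbhs.
Unshelve. all: by end_near. Qed.

(** Derivatives are local. The inductions below use this to replace [ddir] of an expression by its
    computed value, which is known on [O] only. *)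
Lemma Ck_ext n O f g : open O -> (forall w, O w -> f w = g w) -> Ck n O f -> Ck n O g.
Proof.
move=> oO; elim: n f g => [|n IH] f g fg [h1 h2].
  by split; last by []; move=> z Oz; exact: continuous_ext oO Oz fg (h1 z Oz).
split; first by move=> z Oz; exact: continuous_ext oO Oz fg (h1 z Oz).
move=> d; have [h3 h4] := h2 d; split.
  move=> z Oz; apply: is_cderive_diff.
  apply: is_cderive_near (curve_diffP (h3 z Oz)); exact: near_along_eq fg.
apply: IH h4 => w Ow; rewrite (ddir_ext oO Ow fg)//; exact: h3.
Qed.

Lemma along_cderive_congr f d z l :
  is_cderive (along f d z) 0 l -> ddir d f z = l.
Proof. exact: is_cderive_deriv. Qed.

Lemma Ck_cst n O (k : C) : open O -> Ck n O (fun=> k).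
Proof.
move=> oO; elim: n k => [|n IH] k; split => //; try by move=> z _; exact: cvg_cst.
move=> d; have h z : is_cderive (along (fun=> k) d z) 0 0 by exact: is_cderive_cst.
split; first by move=> z _; exact: is_cderive_diff (h z).
by apply: (Ck_ext oO _ (IH 0)) => w _; rewrite (along_cderive_congr (h w)).
Qed.

Lemma CkD n O f g : open O -> Ck n O f -> Ck n O g -> Ck n O (fun z => f z + g z).
Proof.
move=> oO; elim: n f g => [|n IH] f g Hf Hg.
  by split => // z Oz; apply: cvgD; [exact: Ck_continuous Hf Oz|exact: Ck_continuous Hg Oz].
split; first by move=> z Oz; apply: cvgD; [exact: Ck_continuous Hf Oz|exact: Ck_continuous Hg Oz].
move=> d.
have h z : O z -> is_cderive (along (fun z => f z + g z) d z) 0 (ddir d f z + ddir d g z).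
  by move=> Oz; exact: is_cderiveD (CkS_is_cderive d Hf Oz) (CkS_is_cderive d Hg Oz).
split; first by move=> z Oz; exact: is_cderive_diff (h z Oz).
apply: (Ck_ext oO _ (IH _ _ (CkS_ddir d Hf) (CkS_ddir d Hg))) => w Ow.
by rewrite (along_cderive_congr (h _ Ow)).
Qed.

Lemma CkM n O f g : open O -> Ck n O f -> Ck n O g -> Ck n O (fun z => f z * g z).
Proof.
move=> oO; elim: n f g => [|n IH] f g Hf Hg.
  by split => // z Oz; apply: cvgM; [exact: Ck_continuous Hf Oz|exact: Ck_continuous Hg Oz].
split; first by move=> z Oz; apply: cvgM; [exact: Ck_continuous Hf Oz|exact: Ck_continuous Hg Oz].
move=> d.
have h z : O z -> is_cderive (along (fun z => f z * g z) d z) 0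
    (ddir d f z * g z + f z * ddir d g z).
  move=> Oz; have := is_cderiveM (CkS_is_cderive d Hf Oz) (CkS_is_cderive d Hg Oz).
  by rewrite !along0.
split; first by move=> z Oz; exact: is_cderive_diff (h z Oz).
have h1 := IH _ _ (CkS_ddir d Hf) (CkW Hg).
have h2 := IH _ _ (CkW Hf) (CkS_ddir d Hg).
apply: (Ck_ext oO _ (CkD oO h1 h2)) => w Ow.
by rewrite (along_cderive_congr (h _ Ow)).
Qed.

Lemma CkN n O f : open O -> Ck n O f -> Ck n O (fun z => - f z).
Proof.
move=> oO Hf; apply: (Ck_ext oO _ (CkM oO (Ck_cst n (-1) oO) Hf)) => w _.
by rewrite mulN1r.
Qed.

Lemma Ck_conj n O f : open O -> Ck n O f -> Ck n O (fun z => conjc (f z)).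
Proof.
move=> oO; elim: n f => [|n IH] f Hf.
  by split => // z Oz; apply: cvg_conjc; exact: Ck_continuous Hf Oz.
split; first by move=> z Oz; apply: cvg_conjc; exact: Ck_continuous Hf Oz.
move=> d.
have h z : O z -> is_cderive (along (fun z => conjc (f z)) d z) 0 (conjc (ddir d f z)).
  by move=> Oz; exact: is_cderive_conj (CkS_is_cderive d Hf Oz).
split; first by move=> z Oz; exact: is_cderive_diff (h z Oz).
apply: (Ck_ext oO _ (IH _ (CkS_ddir d Hf))) => w Ow.
by rewrite (along_cderive_congr (h _ Ow)).
Qed.

Lemma CkV n O f : open O -> (forall z, O z -> f z != 0) ->
  Ck n O f -> Ck n O (fun z => (f z)^-1).
Proof.
move=> oO f0; elim: n => [|n IH] Hf.
  by split => // z Oz; apply: cvgV; [exact: f0|exact: Ck_continuous Hf Oz].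
split; first by move=> z Oz; apply: cvgV; [exact: f0|exact: Ck_continuous Hf Oz].
move=> d.
have h z : O z -> is_cderive (along (fun z => (f z)^-1) d z) 0
    (- (ddir d f z / f z ^+ 2)).
  move=> Oz; have := @is_cderiveV _ _ _ _ _ (CkS_is_cderive d Hf Oz).
  by rewrite !along0; apply; exact: f0.
split; first by move=> z Oz; exact: is_cderive_diff (h z Oz).
have h1 := IH (CkW Hf).
have h2 := CkM oO (CkS_ddir d Hf) (CkM oO h1 h1).
apply: (Ck_ext oO _ (CkN oO h2)) => w Ow.
by rewrite (along_cderive_congr (h _ Ow)) expr2 invfM.
Qed.

Lemma Ck_sum n O (I : Type) (r : seq I) (F : I -> V -> C) : open O ->
  (forall i, Ck n O (F i)) -> Ck n O (fun z => \sum_(i <- r) F i z).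
Proof.
move=> oO h; elim: r => [|i r IH].
  by apply: (Ck_ext oO _ (Ck_cst n 0 oO)) => w _; rewrite big_nil.
by apply: (Ck_ext oO _ (CkD oO (h i) IH)) => w _; rewrite big_cons.
Qed.

(** * One direction of the chain rule, from the mean value theorem *)

Section ChainStep.
Variables (phi psi : V -> R) (e v : V) (O : set V) (oO : open O) (Ov : O v).
Hypothesis dphi : forall w, O w ->
  is_derive (0 : R) 1 (fun s : R => phi (w + s%:C *: e)) (psi w).
Hypothesis cpsi : {for v, continuous (psi : V -> R^o)}.

Lemma is_derive_line w (s : R) : O (w + s%:C *: e) ->
  is_derive s 1 (fun s : R => phi (w + s%:C *: e)) (psi (w + s%:C *: e)).
Proof.
move=> Ow; have h := dphi Ow.
have ht : is_derive s 1 (fun x : R => x - s) (1 : R).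
  apply: (is_derive_eq (is_deriveB (is_derive_id s 1) (is_derive_cst s s 1))).
  by rewrite subr0.
have := @is_derive1_comp _ _ (fun x : R => x - s) s _ 1 _ ht.
move=> /(_ (fun x : R => phi (w + s%:C *: e + x%:C *: e)) (psi (w + s%:C *: e))).
rewrite subrr mulr1 => /(_ h); congr (is_derive _ _ _ _).
apply/funext => x; rewrite /= -addrA -scalerDl -rmorphD /=.
by rewrite [s + _]addrC subrK.
Qed.

(** The bound on absolute values covers both signs of [t]; for [t < 0] the mean value theorem is
    applied on [[t, 0]]. *)
Lemma line_mvt w (t : R) : (forall s : R, `|s| <= `|t| -> O (w + s%:C *: e)) ->
  exists2 s : R, `|s| <= `|t| & phi (w + t%:C *: e) - phi w = t * psi (w + s%:C *: e).
Proof.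
move=> Ow.
have dl (s : R) : `|s| <= `|t| -> is_derive s 1 (fun s : R => phi (w + s%:C *: e))
    (psi (w + s%:C *: e)) by move=> /Ow; exact: is_derive_line.
have cl (a b : R) : (forall s, s \in `[a, b] -> `|s| <= `|t|) ->
    {within `[a, b], continuous (fun s : R => phi (w + s%:C *: e))}.
  move=> ab; apply: derivable_within_continuous => s /ab /dl [+ _] //.
have [t0|t0] := leP 0 t.
- have ab s : s \in `[0, t] -> `|s| <= `|t|.
    by rewrite in_itv /= => /andP[s0 st]; rewrite !ger0_norm.
  have [||s sin] := @MVT_segment _ (fun s : R => phi (w + s%:C *: e))
    (fun s => psi (w + s%:C *: e)) 0 t t0.
  + by move=> s sin; apply/dl/ab; exact: subset_itv_oo_cc.
  + exact: cl.
  + rewrite scale0r addr0 subr0 => eq; exists s; first exact: ab.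
    by rewrite eq mulrC.
- have ab s : s \in `[t, 0] -> `|s| <= `|t|.
    rewrite in_itv /= => /andP[s0 st]; rewrite ler0_norm// ltr0_norm//.
    by rewrite lerN2.
  have [||s sin] := @MVT_segment _ (fun s : R => phi (w + s%:C *: e))
    (fun s => psi (w + s%:C *: e)) t 0 (ltW t0).
  + by move=> s sin; apply/dl/ab; exact: subset_itv_oo_cc.
  + exact: cl.
  + rewrite scale0r addr0 sub0r => eq; exists s; first exact: ab.
    by rewrite -opprB eq; ring.
Qed.

(** Joint continuity of [P h + s e] in [(h, s)] at the origin. *)
Lemma near_segment (P : R -> V) (A : set V) : P 0 = v -> {for 0, continuous (P : R^o -> V)} ->
  nbhs v A -> exists2 delta : R, 0 < delta &
    forall h s : R, `|h| < delta -> `|s| < delta -> A (P h + s%:C *: e).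
Proof.
move=> P0 cP nA.
have : (fun q : R^o * R^o => P q.1 + q.2%:C *: e) @ ((0 : R^o), (0 : R^o)) --> v.
  rewrite -[X in _ --> X]addr0 -[X in _ --> _ + X](scale0r e) -P0.
  apply: cvgD.
    by apply: (@cvg_comp _ _ _ fst P); [exact: cvg_fst|exact: cP].
  apply: (@cvgZr_tmp _ _ _ _ _ (fun x : R^o * R^o => x.2%:C : C^o) 0 e).
  by apply: cvg_real_complex; exact: cvg_snd.
move=> /(_ _ nA) [[B B'] /= [/nbhs_ballP[r r0 rB] /nbhs_ballP[r' r'0 rB']] BA].
exists (Num.min r r'); first by rewrite lt_min r0 r'0.
move=> h s; rewrite !lt_min => /andP[hr _] /andP[_ sr'].
apply: (BA (h, s)); split; [apply: rB|apply: rB'];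
  by rewrite /ball /= sub0r normrN.
Qed.

(** The base point [P s] moves continuously and need not move differentiably: by the mean value
    theorem the increment in the direction [e] is [t s] times a value of [psi] at a point tending to
    [v]. *)
Lemma chain_step_real (P : R -> V) (t : R -> R) (t' : R) :
  P 0 = v -> {for 0, continuous (P : R^o -> V)} -> t 0 = 0 -> is_derive (0 : R) 1 t t' ->
  is_derive (0 : R) 1 (fun s => phi (P s + (t s)%:C *: e) - phi (P s)) (t' * psi v).
Proof.
move=> P0 cP t0 dt.
pose D s := phi (P s + (t s)%:C *: e) - phi (P s).
(* The quotient of the increment by [t], completed by its expected limit where [t] vanishes, so that
   [D = t * q] holds everywhere. *)
pose q h := if t h == 0 then psi v else D h / t h.
have DE h : D h = t h * q h.
  rewrite /q; case: eqP => [th0|/eqP th0]; last by rewrite mulrC divfK.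
  by rewrite /D th0 scale0r addr0 subrr mul0r.
have tcont : {for 0, continuous (t : R^o -> R^o)}.
  by apply: differentiable_continuous; apply/derivable1_diffP; case: dt.
have qlim : (q : R^o -> R^o) @ (0 : R^o) --> (psi v : R^o).
  apply/cvgrPdist_lt => eps eps0.
  have nA : nbhs v (O `&` [set w | `|psi v - psi w| < eps]).
    apply: filterI; first exact: open_nbhs_nbhs.
    by move/cvgrPdist_lt: cpsi; apply.
  have [delta d0 hd] := near_segment P0 cP nA.
  have nt : \forall h \near (0 : R^o), `|t h| < delta.
    move/cvgrPdist_lt: tcont => /(_ _ d0); rewrite t0.
    by apply: filterS => h; rewrite sub0r normrN.
  near=> h; rewrite /q; case: eqP => [_|/eqP th0]; first by rewrite subrr normr0.
  have hdelta : `|h| < delta.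
    by near: h; apply/nbhs_ballP; exists delta => // y; rewrite /ball /= sub0r normrN.
  have thd : `|t h| < delta by near: h.
  have [s st eq] := @line_mvt (P h) (t h) (fun s st => (hd _ _ hdelta (le_lt_trans st thd)).1).
  rewrite /D eq [t h * _]mulrC mulfK//.
  by have [_] := hd _ _ hdelta (le_lt_trans st thd).
have rlim : (fun h => h^-1 *: (t h - t 0)) @ (0 : R^o)^' --> (t' : R^o).
  case: dt => dt <-; rewrite /derive.
  have := dt; rewrite /derivable /= => /cvg_ex[l hl].
  have e1 : (fun h : R => h^-1 *: ((t \o shift 0) (h *: 1) - t 0)) =
      (fun h : R => h^-1 *: (t h - t 0)).
    by apply/funext => h /=; rewrite addr0 /GRing.scale /= mulr1.
  rewrite e1 in hl *; rewrite (cvg_lim _ hl)//.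
have Dlim : (fun h : R => h^-1 *: (D h - D 0)) @ (0 : R^o)^' --> (t' * psi v : R^o).
  have -> : (fun h : R => h^-1 *: (D h - D 0)) = (fun h : R => (h^-1 *: (t h - t 0)) * q h).
    by apply/funext => h; rewrite !DE t0 mul0r !subr0 /GRing.scale /= mulrA.
  apply: cvgM; first exact: rlim.
  by apply: cvg_within_filter; exact: qlim.
have e2 : (fun h : R => h^-1 *: ((D \o shift 0) (h *: 1) - D 0)) =
      (fun h : R => h^-1 *: (D h - D 0)).
  by apply/funext => h /=; rewrite addr0 /GRing.scale /= mulr1.
split; rewrite ?/derive ?/derivable e2; last exact: cvg_lim Dlim.
by apply/cvg_ex; exists (t' * psi v).
Unshelve. all: by end_near. Qed.

End ChainStep.

End Smooth.

(** * The chain rule along finitely many directions *)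

Section Chain.
Variable R : realType.
Local Notation C := R[i].
Local Notation re := (@complex.Re R).
Local Notation im := (@complex.Im R).
Variable V : normedModType C.

Lemma chain_step (f : V -> C) (O : set V) (v e : V) (P : R -> V) (t : R -> R) (t' : R) :
  open O -> O v -> Ck 1 O f ->
  P 0 = v -> {for 0, continuous (P : R^o -> V)} -> t 0 = 0 -> is_derive (0 : R) 1 t t' ->
  is_cderive (fun s => f (P s + (t s)%:C *: e) - f (P s)) 0 (t'%:C * ddir e f v).
Proof.
move=> oO Ov Hf P0 cP t0 dt; split.
- rewrite !reimE mul0r subr0; under eq_fun do rewrite !reimE.
  apply: (@chain_step_real _ _ (re \o f) (re \o ddir e f) e v O oO Ov) => //.
  + by move=> w Ow; have [] := CkS_is_cderive e Hf Ow.
  + by apply: cvg_Re; exact: Ck_continuous (CkS_ddir e Hf) Ov.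
- rewrite !reimE mul0r addr0; under eq_fun do rewrite !reimE.
  apply: (@chain_step_real _ _ (im \o f) (im \o ddir e f) e v O oO Ov) => //.
  + by move=> w Ow; have [] := CkS_is_cderive e Hf Ow.
  + by apply: cvg_Im; exact: Ck_continuous (CkS_ddir e Hf) Ov.
Qed.

Lemma cvg_sum_ord (T : Type) (F : set_system T) (FF : Filter F) (m : nat)
    (g : nat -> T -> V) (l : nat -> V) :
  (forall k, g k @ F --> l k) ->
  (fun x => \sum_(k < m) g k x) @ F --> \sum_(k < m) l k.
Proof.
move=> h; elim: m => [|m IH].
  by rewrite big_ord0; under eq_fun do rewrite big_ord0; exact: cvg_cst.
by rewrite big_ord_recr; under eq_fun do rewrite big_ord_recr; exact: cvgD.
Qed.

(** Induction on the number of directions: the last one is handled by [chain_step], with the sum of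
    the others as its moving base point. *)
Lemma chain_sum (f : V -> C) (O : set V) (v : V) (m : nat)
    (t : nat -> R -> R) (t' : nat -> R) (e : nat -> V) :
  open O -> O v -> Ck 1 O f -> (forall k, is_derive (0 : R) 1 (t k) (t' k)) ->
  is_cderive (fun s => f (v + \sum_(k < m) (t k s - t k 0)%:C *: e k)) 0
    (\sum_(k < m) (t' k)%:C * ddir (e k) f v).
Proof.
move=> oO Ov Hf dt; elim: m => [|m IH].
  rewrite big_ord0; under eq_fun do rewrite big_ord0; exact: is_cderive_cst.
rewrite big_ord_recr /=.
pose P s := v + \sum_(k < m) (t k s - t k 0)%:C *: e k.
have P0 : P 0 = v.
  by rewrite /P big1 ?addr0// => k _; rewrite subrr scale0r.
have dtm k : is_derive (0 : R) 1 (fun s => t k s - t k 0) (t' k).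
  apply: (is_derive_eq (is_deriveB (dt k) (is_derive_cst (t k 0 : R) (0 : R) 1))).
  by rewrite subr0.
have cP : {for 0, continuous (P : R^o -> V)}.
  apply: cvgD; first exact: cvg_cst.
  apply: (@cvg_sum_ord _ _ _ m (fun k (s : R) => (t k s - t k 0)%:C *: e k)
    (fun k => (t k 0 - t k 0)%:C *: e k)) => k.
  apply: (@cvgZr_tmp _ _ _ _ _ (fun x : R => (t k x - t k 0)%:C : C^o)).
  apply: cvg_real_complex.
  apply: (@differentiable_continuous _ R^o R^o 0 (fun s => t k s - t k 0)).
  by apply/derivable1_diffP; case: (dtm k).
have h := @chain_step f O v (e m) P (fun s => t m s - t m 0) (t' m) oO Ov Hf P0 cP
  (subrr _) (dtm m).
have := is_cderiveD IH h.
congr (is_cderive _ _ _); apply/funext => s.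
rewrite big_ord_recr /= [v + (_ + _)]addrA -/(P s); ring.
Qed.

End Chain.

(** * Composition with maps given by real coordinates *)

Section Comp.
Variable R : realType.
Local Notation C := R[i].
Local Notation re := (@complex.Re R).
Local Notation im := (@complex.Im R).
Variables V W : normedModType C.

Section Fixed.
Variables (f : V -> C) (O : set V) (O' : set W) (m : nat).
Variables (tau : nat -> W -> C) (e : nat -> V).
Hypotheses (oO : open O) (oO' : open O').
Hypothesis tau_real : forall k z, (re (tau k z))%:C = tau k z.
Let gam z := \sum_(k < m) tau k z *: e k.
Hypothesis gamO : forall z, O' z -> O (gam z).

Lemma is_cderive_comp d z : O' z -> Ck 1 O f -> (forall k, Ck 1 O' (tau k)) ->
  is_cderive (along (f \o gam) d z) 0
    (\sum_(k < m) ddir d (tau k) z * ddir (e k) f (gam z)).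
Proof.
move=> Oz Hf Ht.
pose t k s := re (along (tau k) d z s).
pose t' k := re (ddir d (tau k) z).
have dt k : is_derive (0 : R) 1 (t k) (t' k).
  by have [] := CkS_is_cderive d (Ht k) Oz.
have t'E k : (t' k)%:C = ddir d (tau k) z.
  apply: complex_ext; first by [].
  have [_ [_ e1]] := CkS_is_cderive d (Ht k) Oz.
  rewrite ImC -e1.
  have -> : (fun s : R => im (along (tau k) d z s)) = cst 0.
    by apply/funext => s; rewrite /along -tau_real.
  by rewrite derive_cst.
have := chain_sum m e oO (gamO Oz) Hf dt.
under eq_bigr do rewrite t'E.
congr (is_cderive _ _ _); apply/funext => s.
rewrite /along /= /gam -big_split /=; congr f; apply: eq_bigr => k _.
by rewrite -scalerDl /t along0 rmorphB /= /along !tau_real addrC subrK.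
Qed.
End Fixed.

(** A derivative of the composite is a sum of products of derivatives of the [tau k] with composites
    of [ddir (e k) f]; the induction on [n] therefore runs over all [f] at once. *)
Lemma Ck_comp n (f : V -> C) (O : set V) (O' : set W) (m : nat)
    (tau : nat -> W -> C) (e : nat -> V) :
  open O -> open O' -> (forall k z, (re (tau k z))%:C = tau k z) ->
  (forall z, O' z -> O (\sum_(k < m) tau k z *: e k)) ->
  Ck n O f -> (forall k, Ck n O' (tau k)) ->
  Ck n O' (fun z => f (\sum_(k < m) tau k z *: e k)).
Proof.
move=> oO oO' tr gO.
have cont n' (g : V -> C) z : O' z -> Ck n' O g -> (forall k, Ck n' O' (tau k)) ->
    {for z, continuous ((fun z => g (\sum_(k < m) tau k z *: e k)) : W -> C^o)}.
  move=> Oz Hg Ht.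
  apply: (@continuous_comp _ _ _ (fun z => \sum_(k < m) tau k z *: e k) (g : V -> C^o)).
    apply: (@cvg_sum_ord _ _ _ _ _ m (fun k (z : W) => tau k z *: e k)
      (fun k => tau k z *: e k)) => k.
    apply: (@cvgZr_tmp _ _ _ _ _ (fun x : W => tau k x : C^o)).
    exact: Ck_continuous (Ht k) Oz.
  by apply: Ck_continuous Hg _; exact: gO.
elim: n f => [|n IH] f Hf Ht.
  by split => // z Oz; exact: cont Hf Ht.
split; first by move=> z Oz; exact: cont Hf Ht.
have Hf1 : Ck 1 O f.
  by elim: n {IH Ht} Hf => [//|n IHn] /CkW.
have Ht1 k : Ck 1 O' (tau k).
  by elim: n {IH Hf} Ht => [//|n IHn] H; apply: IHn => k'; exact: CkW.
move=> d.
have h z (Oz : O' z) := is_cderive_comp oO tr gO d Oz Hf1 Ht1.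
split; first by move=> z Oz; exact: is_cderive_diff (h z Oz).
have IH' g : Ck n O g -> Ck n O' (fun z => g (\sum_(k < m) tau k z *: e k)).
  by move=> Hg; apply: IH Hg _ => k; exact: CkW.
apply: (@Ck_ext _ _ _ _ (fun z => \sum_(k < m) ddir d (tau k) z *
    ddir (e k) f (\sum_(k < m) tau k z *: e k))) => //.
  by move=> w Ow; rewrite (along_cderive_congr (h w Ow)).
apply: Ck_sum => // k; apply: CkM => //; first exact: CkS_ddir.
by apply: (IH' (ddir (e k) f)); exact: CkS_ddir.
Qed.

End Comp.

Section Comp12.
Variable R : realType.
Local Notation C := R[i].
Local Notation re := (@complex.Re R).
Local Notation im := (@complex.Im R).
Variable W : normedModType C.

Definition rec (p : W -> C) (z : W) : C := (re (p z))%:C.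
Definition imc (p : W -> C) (z : W) : C := (im (p z))%:C.

Lemma Ck_rec n (O : set W) p : open O -> Ck n O p -> Ck n O (rec p).
Proof.
move=> oO Hp; have := CkM oO (Ck_cst n (2^-1) oO) (CkD oO Hp (Ck_conj oO Hp)).
by apply: Ck_ext => // w _; rewrite /rec ReJ_add mulrC.
Qed.

Lemma Ck_imc n (O : set W) p : open O -> Ck n O p -> Ck n O (imc p).
Proof.
move=> oO Hp.
have := CkM oO (CkM oO (CkD oO (Ck_conj oO Hp) (CkN oO Hp)) (Ck_cst n (2^-1) oO))
  (Ck_cst n 'i oO).
by apply: Ck_ext => // w _; rewrite /imc ImJ_sub.
Qed.

Lemma is_cderive_reim c (s : R) (l : C) : is_cderive c s l ->
  is_cderive (fun x => (re (c x))%:C) s (re l)%:C /\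
  is_cderive (fun x => (im (c x))%:C) s (im l)%:C.
Proof. by move=> [h1 h2]; split; apply: is_cderive_real. Qed.

Lemma ddir_rec n (O : set W) p d z : Ck n.+1 O p -> O z ->
  ddir d (rec p) z = (re (ddir d p z))%:C.
Proof.
move=> H Oz; apply: along_cderive_congr.
by have [] := is_cderive_reim (CkS_is_cderive d H Oz).
Qed.

Lemma ddir_imc n (O : set W) p d z : Ck n.+1 O p -> O z ->
  ddir d (imc p) z = (im (ddir d p z))%:C.
Proof.
move=> H Oz; apply: along_cderive_congr.
by have [] := is_cderive_reim (CkS_is_cderive d H Oz).
Qed.

(** A complex variable as two real ones, its real and imaginary parts along [1] and [i]: the form
    which [Ck_comp] requires. *)
Definition tau1 (p : W -> C) (k : nat) : W -> C := if k is 0 then rec p else imc p.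
Definition dir1 (k : nat) : C^o := if k is 0 then 1 else 'i%C.

Lemma tau1E p z : \sum_(k < 2) tau1 p k z *: dir1 k = p z :> C^o.
Proof.
rewrite !big_ord_recl big_ord0 addr0 /= [RHS]complexE mulrC /rec /imc.
by rewrite /GRing.scale /= mulr1 mulrC [_ * (im _)%:C]mulrC.
Qed.

Lemma tau1_real p k z : (re (tau1 p k z))%:C = tau1 p k z.
Proof. by case: k. Qed.

Lemma Ck_comp1 n (f : C^o -> C) (p : W -> C) (O : set C^o) (O' : set W) :
  open O -> open O' -> (forall z, O' z -> O (p z)) ->
  Ck n O f -> Ck n O' p -> Ck n O' (fun z => f (p z)).
Proof.
move=> oO oO' pO Hf Hp.
have := @Ck_comp _ _ _ n f O O' 2 (tau1 p) dir1 oO oO' (tau1_real p) _ Hf.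
under eq_fun do rewrite tau1E; apply.
- by move=> z Oz; rewrite tau1E; exact: pO.
- by case=> [|k]; [exact: Ck_rec|exact: Ck_imc].
Qed.

Lemma is_cderive_comp1 (f : C^o -> C) (p : W -> C) (O : set C^o) (O' : set W) d z :
  open O -> open O' -> (forall z, O' z -> O (p z)) ->
  Ck 1 O f -> Ck 1 O' p -> O' z ->
  is_cderive (along (fun z => f (p z)) d z) 0
    ((re (ddir d p z))%:C * ddir (1 : C^o) f (p z) +
     (im (ddir d p z))%:C * ddir ('i%C : C^o) f (p z)).
Proof.
move=> oO oO' pO Hf Hp Oz.
have := @is_cderive_comp _ _ _ f O O' 2 (tau1 p) dir1 oO (tau1_real p) _ d z Oz Hf.
rewrite /comp; under eq_fun do rewrite tau1E.
rewrite tau1E !big_ord_recl big_ord0 addr0 /= (ddir_rec _ Hp Oz) (ddir_imc _ Hp Oz).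
apply.
- by move=> w Ow; rewrite tau1E; exact: pO.
- by case=> [|k]; [exact: (Ck_rec (n := 1) oO' Hp)|exact: (Ck_imc (n := 1) oO' Hp)].
Qed.

Definition tau2 (p q : W -> C) (k : nat) : W -> C :=
  match k with 0 => rec p | 1 => imc p | 2 => rec q | _ => imc q end.
Definition dir2 (k : nat) : C^o * C^o :=
  match k with 0 => (1, 0) | 1 => ('i%C, 0) | 2 => (0, 1) | _ => (0, 'i%C) end.

Lemma tau2E p q z : \sum_(k < 4) tau2 p q k z *: dir2 k = (p z, q z) :> C^o * C^o.
Proof.
rewrite !big_ord_recl big_ord0 addr0 /= /rec /imc.
have h (x : C) : (re x)%:C * 1 + (im x)%:C * 'i%C = x.
  by rewrite mulr1 [_ * 'i%C]mulrC -complexE.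
apply: injective_projections.
- transitivity ((re (p z))%:C * 1 + ((im (p z))%:C * 'i%C +
    ((re (q z))%:C * 0 + (im (q z))%:C * 0)) : C); first by [].
  by rewrite !mulr0 !addr0 h.
- transitivity ((re (p z))%:C * 0 + ((im (p z))%:C * 0 +
    ((re (q z))%:C * 1 + (im (q z))%:C * 'i%C)) : C); first by [].
  by rewrite !mulr0 !add0r h.
Qed.

Lemma Ck_comp2 n (f : C^o * C^o -> C) (p q : W -> C) (O : set (C^o * C^o)) (O' : set W) :
  open O -> open O' -> (forall z, O' z -> O (p z, q z)) ->
  Ck n O f -> Ck n O' p -> Ck n O' q -> Ck n O' (fun z => f (p z, q z)).
Proof.
move=> oO oO' pO Hf Hp Hq.
have := @Ck_comp _ _ _ n f O O' 4 (tau2 p q) dir2 oO oO' _ _ Hf.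
under eq_fun do rewrite tau2E; apply.
- by case=> [|[|[|]]].
- by move=> z Oz; rewrite tau2E; exact: pO.
- by case=> [|[|[|k]]]; [exact: Ck_rec|exact: Ck_imc|exact: Ck_rec|exact: Ck_imc].
Qed.

End Comp12.

(** * Symmetry of second derivatives *)

Section Clairaut.
Variable R : realType.
Local Notation C := R[i].
Local Notation re := (@complex.Re R).
Local Notation im := (@complex.Im R).
Variable V : normedModType C.
Implicit Types (O : set V) (d e z v w : V).

Lemma is_derive_line_shift (phi psi : V -> R) O d (w u : V) : O (w + u) ->
  (forall w, O w -> is_derive (0 : R) 1 (fun s : R => phi (w + s%:C *: d)) (psi w)) ->
  is_derive (0 : R) 1 (fun s : R => phi (w + s%:C *: d + u)) (psi (w + u)).
Proof.
move=> Ow /(_ _ Ow); congr (is_derive _ _ _ _).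
by apply/funext => s; rewrite addrAC.
Qed.

(** The mean value theorem in the direction [d], applied to the increment along [e], and then once
    more in the direction [e]. *)
Lemma double_mvt (phi phid phide : V -> R) O d e v (h : R) :
  (forall w, O w -> is_derive (0 : R) 1 (fun s : R => phi (w + s%:C *: d)) (phid w)) ->
  (forall w, O w -> is_derive (0 : R) 1 (fun s : R => phid (w + s%:C *: e)) (phide w)) ->
  (forall s t : R, `|s| <= `|h| -> `|t| <= `|h| -> O (v + s%:C *: d + t%:C *: e)) ->
  exists s t : R, [/\ `|s| <= `|h|, `|t| <= `|h| &
    phi (v + h%:C *: d + h%:C *: e) - phi (v + h%:C *: d) - phi (v + h%:C *: e) + phi v =
    h * (h * phide (v + s%:C *: d + t%:C *: e))].
Proof.
move=> d1 d2 Oh.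
have O0 s : `|s| <= `|h| -> O (v + s%:C *: d).
  by move=> sh; have := Oh s 0 sh; rewrite normr0 normr_ge0 scale0r addr0; apply.
pose F w := phi (w + h%:C *: e) - phi w.
have dF w : O w /\ O (w + h%:C *: e) -> is_derive (0 : R) 1
    (fun s : R => F (w + s%:C *: d)) (phid (w + h%:C *: e) - phid w).
  move=> [Ow Owh]; apply: is_deriveB; last exact: d1.
  exact: (is_derive_line_shift Owh d1).
have [|s sh eq1] := @line_mvt _ _ F (fun w => phid (w + h%:C *: e) - phid w) d
    (fun w => O w /\ O (w + h%:C *: e)) dF v h.
  by move=> s sh; split; [exact: O0|apply: Oh].
have [|t th eq2] := @line_mvt _ _ phid phide e O d2 (v + s%:C *: d) h.
  by move=> t th; exact: Oh.
exists s, t; split => //; rewrite -eq2 -eq1 /F; ring.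
Qed.

(** The second difference in [double_mvt] is symmetric in [d] and [e], so the two mixed derivatives
    share a value at points arbitrarily near [v]; their continuity at [v] concludes. *)
Lemma clairaut_real (phi phid phie phide phied : V -> R) O d e v :
  open O -> O v ->
  (forall w, O w -> is_derive (0 : R) 1 (fun s : R => phi (w + s%:C *: d)) (phid w)) ->
  (forall w, O w -> is_derive (0 : R) 1 (fun s : R => phi (w + s%:C *: e)) (phie w)) ->
  (forall w, O w -> is_derive (0 : R) 1 (fun s : R => phid (w + s%:C *: e)) (phide w)) ->
  (forall w, O w -> is_derive (0 : R) 1 (fun s : R => phie (w + s%:C *: d)) (phied w)) ->
  {for v, continuous (phide : V -> R^o)} -> {for v, continuous (phied : V -> R^o)} ->
  phide v = phied v.
Proof.
move=> oO Ov hd he hde hed cde ced.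
apply/eqP; rewrite -subr_eq0 -normr_le0; apply/ler_addgt0Pl => eps eps0.
rewrite addr0.
have eps2 : 0 < eps / 2 by rewrite divr_gt0.
have nA : nbhs v (O `&` ([set w | `|phide v - phide w| < eps / 2] `&`
    [set w | `|phied v - phied w| < eps / 2])).
  apply: filterI; first exact: open_nbhs_nbhs.
  by apply: filterI; [move/cvgrPdist_lt: cde; apply|move/cvgrPdist_lt: ced; apply].
have near (x y : V) : exists2 delta : R, 0 < delta &
    forall h s : R, `|h| < delta -> `|s| < delta ->
    (O `&` ([set w | `|phide v - phide w| < eps / 2] `&`
    [set w | `|phied v - phied w| < eps / 2])) (v + h%:C *: x + s%:C *: y).
  apply: (near_segment y (P := fun s : R => v + s%:C *: x)) nA.
    by rewrite scale0r addr0.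
  by apply: cvg_line.
have [d1 d10 H1] := near d e.
have [d2 d20 H2] := near e d.
(* Half of the smaller radius: parameters bounded by [h] in absolute value stay inside both
   neighbourhoods. *)
pose h := Num.min d1 d2 / 2.
have m0 : 0 < Num.min d1 d2 by rewrite lt_min d10.
have h0 : 0 < h by rewrite divr_gt0.
have hm : h < Num.min d1 d2 by rewrite /h ltr_pdivrMr// ltr_pMr// ltrDl.
move: (hm); rewrite lt_min => /andP[hd1 hd2].
have hh1 : `|h| < d1 by rewrite gtr0_norm.
have hh2 : `|h| < d2 by rewrite gtr0_norm.
have [s [t [sh th eq1]]] := @double_mvt phi phid phide O d e v h hd hde
  (fun s t sh th => (H1 s t (le_lt_trans sh hh1)
     (le_lt_trans th hh1)).1).
have [s' [t' [sh' th' eq2]]] := @double_mvt phi phie phied O e d v h he hed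
  (fun s t sh th => (H2 s t (le_lt_trans sh hh2)
     (le_lt_trans th hh2)).1).
have [_ [/= L1 _]] := H1 s t (le_lt_trans sh hh1)
     (le_lt_trans th hh1).
have [_ [_ /= L2]] := H2 s' t' (le_lt_trans sh' hh2)
     (le_lt_trans th' hh2).
have eq3 : phide (v + s%:C *: d + t%:C *: e) = phied (v + s'%:C *: e + t'%:C *: d).
  have hn0 : h != 0 by rewrite gt_eqF.
  apply: (mulfI hn0); apply: (mulfI hn0); rewrite -eq1 -eq2.
  by rewrite (addrAC v (h%:C *: d)); ring.
rewrite -(subrK (phide (v + s%:C *: d + t%:C *: e)) (phide v)) {2}eq3 -addrA.
apply: (le_trans (ler_normD _ _)); rewrite (splitr eps) lerD//; first exact: ltW.
by rewrite distrC; exact: ltW.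
Qed.

Lemma clairaut O d e v (f : V -> C) : open O -> O v -> Ck 2 O f ->
  ddir e (ddir d f) v = ddir d (ddir e f) v.
Proof.
move=> oO Ov Hf.
have Hd := CkS_ddir d Hf; have He := CkS_ddir e Hf.
have Hde := CkS_ddir e Hd; have Hed := CkS_ddir d He.
have D x w : O w -> is_cderive (along f x w) 0 (ddir x f w).
  by move=> Ow; exact: CkS_is_cderive Hf Ow.
have DD x y w : O w -> is_cderive (along (ddir x f) y w) 0 (ddir y (ddir x f) w).
  by move=> Ow; exact: CkS_is_cderive (CkS_ddir x Hf) Ow.
have Dr x w : O w -> is_derive (0 : R) 1 (fun s : R => re (f (w + s%:C *: x))) (re (ddir x f w)).
  by move=> /(D x)[].
have Di x w : O w -> is_derive (0 : R) 1 (fun s : R => im (f (w + s%:C *: x))) (im (ddir x f w)).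
  by move=> /(D x)[].
have DDr x y w : O w -> is_derive (0 : R) 1 (fun s : R => re (ddir x f (w + s%:C *: y)))
    (re (ddir y (ddir x f) w)).
  by move=> Ow; have [h _] := DD x y w Ow; exact: h.
have DDi x y w : O w -> is_derive (0 : R) 1 (fun s : R => im (ddir x f (w + s%:C *: y)))
    (im (ddir y (ddir x f) w)).
  by move=> Ow; have [_ h] := DD x y w Ow; exact: h.
apply: complex_ext.
- apply: (@clairaut_real (fun w => re (f w)) (fun w => re (ddir d f w))
    (fun w => re (ddir e f w)) (fun w => re (ddir e (ddir d f) w))
    (fun w => re (ddir d (ddir e f) w)) O d e v oO Ov
    (Dr d) (Dr e) (DDr d e) (DDr e d)).
  + by apply: cvg_Re; exact: Ck_continuous Hde Ov.
  + by apply: cvg_Re; exact: Ck_continuous Hed Ov.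
- apply: (@clairaut_real (fun w => im (f w)) (fun w => im (ddir d f w))
    (fun w => im (ddir e f w)) (fun w => im (ddir e (ddir d f) w))
    (fun w => im (ddir d (ddir e f) w)) O d e v oO Ov
    (Di d) (Di e) (DDi d e) (DDi e d)).
  + by apply: cvg_Im; exact: Ck_continuous Hde Ov.
  + by apply: cvg_Im; exact: Ck_continuous Hed Ov.
Qed.

End Clairaut.

(** * Germs of [Ck] functions and Wirtinger derivatives *)

Section CkAt.
Variable R : realType.
Local Notation C := R[i].
Variable V : normedModType C.
Implicit Types (f g : V -> C) (d z : V).

Definition Ck_at n z f := exists O : set V, [/\ open O, O z & Ck n O f].

Lemma smooth_Ck_at n z f : smooth_at z f -> Ck_at n z f.
Proof. by move=> [ O [ oO Oz H]]; exists O; split. Qed.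

Lemma Ck_at_continuous n z f : Ck_at n z f -> {for z, continuous (f : V -> C^o)}.
Proof. by move=> [ O [ oO Oz H]]; exact: Ck_continuous H Oz. Qed.

Lemma nbhs_openP z (A : set V) : nbhs z A -> exists O : set V, [/\ open O, O z & O `<=` A].
Proof. by rewrite nbhsE => -[B [oB Bz] BA]; exists B. Qed.

Lemma Ck_at_near n z f g : (\forall w \near z, f w = g w) -> Ck_at n z f -> Ck_at n z g.
Proof.
move=> /nbhs_openP[ O [ oO Oz fg]] [ O' [ oO' O'z H]].
exists (O `&` O'); split => //; first exact: openI.
apply: (@Ck_ext _ _ _ _ f); first exact: openI.
  by move=> w [/fg].
by apply: Ck_sub H => w [].
Qed.

Lemma near_Ck_at n z f : Ck_at n z f -> \forall w \near z, Ck_at n w f.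
Proof.
move=> [ O [ oO Oz H]]; have : nbhs z O by exact: open_nbhs_nbhs.
by apply: filterS => w Ow; exists O.
Qed.

Lemma near_smooth_at z f : smooth_at z f -> \forall w \near z, smooth_at w f.
Proof.
move=> [ O [ oO Oz H]]; have : nbhs z O by exact: open_nbhs_nbhs.
by apply: filterS => w Ow; exists O.
Qed.

Lemma Ck_at_op2 (op : (V -> C) -> (V -> C) -> V -> C) n z f g :
  (forall O f g, open O -> Ck n O f -> Ck n O g -> Ck n O (op f g)) ->
  Ck_at n z f -> Ck_at n z g -> Ck_at n z (op f g).
Proof.
move=> h [ O [ oO Oz Hf]] [ O' [ oO' O'z Hg]]; exists (O `&` O'); split => //.
  exact: openI.
by apply: h; [exact: openI|apply: Ck_sub Hf => w []|apply: Ck_sub Hg => w []].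
Qed.

Lemma smooth_at_op2 (op : (V -> C) -> (V -> C) -> V -> C) z f g :
  (forall n O f g, open O -> Ck n O f -> Ck n O g -> Ck n O (op f g)) ->
  smooth_at z f -> smooth_at z g -> smooth_at z (op f g).
Proof.
move=> h [ O [ oO Oz Hf]] [ O' [ oO' O'z Hg]]; exists (O `&` O'); split => //.
  exact: openI.
by move=> n; apply: h; [exact: openI|apply: Ck_sub (Hf n) => w []|
  apply: Ck_sub (Hg n) => w []].
Qed.

Lemma Ck_atD n z f g : Ck_at n z f -> Ck_at n z g -> Ck_at n z (fun w => f w + g w).
Proof. by apply: (@Ck_at_op2 (fun f g w => f w + g w)) => O f' g'; exact: CkD. Qed.
Lemma Ck_atM n z f g : Ck_at n z f -> Ck_at n z g -> Ck_at n z (fun w => f w * g w).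
Proof. by apply: (@Ck_at_op2 (fun f g w => f w * g w)) => O f' g'; exact: CkM. Qed.
Lemma Ck_at_cst n z (k : C) : Ck_at n z (fun=> k).
Proof. by exists setT; split => //; [exact: openT|exact: Ck_cst openT]. Qed.
Lemma Ck_atN n z f : Ck_at n z f -> Ck_at n z (fun w => - f w).
Proof. by move=> [ O [ oO Oz H]]; exists O; split => //; exact: CkN. Qed.
Lemma Ck_at_conj n z f : Ck_at n z f -> Ck_at n z (fun w => conjc (f w)).
Proof. by move=> [ O [ oO Oz H]]; exists O; split => //; exact: Ck_conj. Qed.
Lemma Ck_at_ddir n d z f : Ck_at n.+1 z f -> Ck_at n z (ddir d f).
Proof. by move=> [ O [ oO Oz H]]; exists O; split => //; exact: CkS_ddir. Qed.

Lemma smooth_atD z f g : smooth_at z f -> smooth_at z g -> smooth_at z (fun w => f w + g w).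
Proof. by apply: (@smooth_at_op2 (fun f g w => f w + g w)) => n O f' g'; exact: CkD. Qed.
Lemma smooth_atM z f g : smooth_at z f -> smooth_at z g -> smooth_at z (fun w => f w * g w).
Proof. by apply: (@smooth_at_op2 (fun f g w => f w * g w)) => n O f' g'; exact: CkM. Qed.
Lemma smooth_at_cst z (k : C) : smooth_at z (fun=> k).
Proof. by exists setT; split => // [|n]; [exact: openT|exact: Ck_cst openT]. Qed.
Lemma smooth_atN z f : smooth_at z f -> smooth_at z (fun w => - f w).
Proof. by move=> [ O [ oO Oz H]]; exists O; split => // n; exact: CkN. Qed.
Lemma smooth_at_conj z f : smooth_at z f -> smooth_at z (fun w => conjc (f w)).
Proof. by move=> [ O [ oO Oz H]]; exists O; split => // n; exact: Ck_conj. Qed.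
Lemma smooth_at_ddir d z f : smooth_at z f -> smooth_at z (ddir d f).
Proof. by move=> [ O [ oO Oz H]]; exists O; split => // n; exact: CkS_ddir. Qed.

Lemma near_neq0 z f : {for z, continuous (f : V -> C^o)} -> f z != 0 ->
  \forall w \near z, f w != 0.
Proof.
move=> cf fz0; have cf' : (f : V -> C^o) @ z --> (f z : C^o) by exact: cf.
exact: cvgr_neq0 cf' fz0.
Qed.

Lemma Ck_atV n z f : f z != 0 -> Ck_at n z f -> Ck_at n z (fun w => (f w)^-1).
Proof.
move=> fz0 Hf; have /nbhs_openP[ O [ oO Oz f0]] := near_neq0 (Ck_at_continuous Hf) fz0.
have [ O' [ oO' O'z H]] := Hf; exists (O `&` O'); split => //; first exact: openI.
apply: CkV; [exact: openI|by move=> w [/f0]|by apply: Ck_sub H => w []].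
Qed.

Lemma smooth_atV z f : f z != 0 -> smooth_at z f -> smooth_at z (fun w => (f w)^-1).
Proof.
move=> fz0 Hf; have /nbhs_openP[ O [ oO Oz f0]] :=
  near_neq0 (Ck_at_continuous (smooth_Ck_at 0 Hf)) fz0.
have [ O' [ oO' O'z H]] := Hf; exists (O `&` O'); split => //; first exact: openI.
by move=> n; apply: CkV; [exact: openI|move=> w [/f0]|apply: Ck_sub (H n) => w []].
Qed.

Lemma Ck_at_is_cderive d z f : Ck_at 1 z f -> is_cderive (along f d z) 0 (ddir d f z).
Proof. by move=> [ O [ oO Oz H]]; exact: CkS_is_cderive H Oz. Qed.

Lemma ddir_near d z f g : (\forall w \near z, f w = g w) -> Ck_at 1 z f ->
  ddir d f z = ddir d g z.
Proof.
move=> /nbhs_openP[ O [ oO Oz fg]] H; apply/esym.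
by apply: (ddir_ext oO Oz) => //; apply: is_cderive_diff (Ck_at_is_cderive d H).
Qed.

Lemma ddirD d z f g : Ck_at 1 z f -> Ck_at 1 z g ->
  ddir d (fun w => f w + g w) z = ddir d f z + ddir d g z.
Proof.
move=> Hf Hg; apply: along_cderive_congr.
exact: is_cderiveD (Ck_at_is_cderive d Hf) (Ck_at_is_cderive d Hg).
Qed.

Lemma ddirM d z f g : Ck_at 1 z f -> Ck_at 1 z g ->
  ddir d (fun w => f w * g w) z = ddir d f z * g z + f z * ddir d g z.
Proof.
move=> Hf Hg; apply: along_cderive_congr.
by have := is_cderiveM (Ck_at_is_cderive d Hf) (Ck_at_is_cderive d Hg); rewrite !along0.
Qed.

Lemma ddirN d z f : Ck_at 1 z f -> ddir d (fun w => - f w) z = - ddir d f z.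
Proof.
by move=> Hf; apply: along_cderive_congr; exact: is_cderiveN (Ck_at_is_cderive d Hf).
Qed.

Lemma ddir_conj d z f : Ck_at 1 z f ->
  ddir d (fun w => conjc (f w)) z = conjc (ddir d f z).
Proof.
by move=> Hf; apply: along_cderive_congr; exact: is_cderive_conj (Ck_at_is_cderive d Hf).
Qed.

Lemma ddir_cst d z (k : C) : ddir d (fun=> k) z = 0.
Proof. by apply: along_cderive_congr; exact: is_cderive_cst. Qed.

Lemma dhol_near d z f g : (\forall w \near z, f w = g w) -> Ck_at 1 z f ->
  dhol d f z = dhol d g z.
Proof. by move=> fg H; rewrite /dhol !(ddir_near _ fg H). Qed.
Lemma dbar_near d z f g : (\forall w \near z, f w = g w) -> Ck_at 1 z f ->
  dbar d f z = dbar d g z.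
Proof. by move=> fg H; rewrite /dbar !(ddir_near _ fg H). Qed.

Lemma dholD d z f g : Ck_at 1 z f -> Ck_at 1 z g ->
  dhol d (fun w => f w + g w) z = dhol d f z + dhol d g z.
Proof. by move=> Hf Hg; rewrite /dhol !ddirD//; ring. Qed.
Lemma dbarD d z f g : Ck_at 1 z f -> Ck_at 1 z g ->
  dbar d (fun w => f w + g w) z = dbar d f z + dbar d g z.
Proof. by move=> Hf Hg; rewrite /dbar !ddirD//; ring. Qed.
Lemma dholM d z f g : Ck_at 1 z f -> Ck_at 1 z g ->
  dhol d (fun w => f w * g w) z = dhol d f z * g z + f z * dhol d g z.
Proof. by move=> Hf Hg; rewrite /dhol !ddirM//; ring. Qed.
Lemma dbarM d z f g : Ck_at 1 z f -> Ck_at 1 z g ->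
  dbar d (fun w => f w * g w) z = dbar d f z * g z + f z * dbar d g z.
Proof. by move=> Hf Hg; rewrite /dbar !ddirM//; ring. Qed.
Lemma dholN d z f : Ck_at 1 z f -> dhol d (fun w => - f w) z = - dhol d f z.
Proof. by move=> Hf; rewrite /dhol !ddirN//; ring. Qed.
Lemma dbarN d z f : Ck_at 1 z f -> dbar d (fun w => - f w) z = - dbar d f z.
Proof. by move=> Hf; rewrite /dbar !ddirN//; ring. Qed.
Lemma dhol_cst d z (k : C) : dhol d (fun=> k) z = 0.
Proof. by rewrite /dhol !ddir_cst mulr0 subr0 mul0r. Qed.
Lemma dbar_cst d z (k : C) : dbar d (fun=> k) z = 0.
Proof. by rewrite /dbar !ddir_cst mulr0 addr0 mul0r. Qed.

Lemma conjc_half_sub (a b : C) :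
  conjc ((a - 'i * b) / 2) = (conjc a + 'i * conjc b) / 2.
Proof.
rewrite rmorphM rmorphB rmorphM fmorphV rmorph_nat /=.
have -> : 0 -i* 1 = - 'i%C :> C by apply: complex_ext; rewrite !reimE /= ?oppr0.
by rewrite mulNr opprK.
Qed.

Lemma dbar_conj d z f : Ck_at 1 z f ->
  dbar d (fun w => conjc (f w)) z = conjc (dhol d f z).
Proof. by move=> Hf; rewrite /dhol /dbar !ddir_conj// conjc_half_sub. Qed.

Lemma dhol_conj d z f : Ck_at 1 z f ->
  dhol d (fun w => conjc (f w)) z = conjc (dbar d f z).
Proof.
move=> Hf; have := dbar_conj d (Ck_at_conj Hf).
by under eq_fun do rewrite conjcK; move=> ->; rewrite conjcK.
Qed.

Lemma Ck_at_dbar n d z f : Ck_at n.+1 z f -> Ck_at n z (dbar d f).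
Proof.
move=> H; have Hx := Ck_at_ddir d H; have Hy := Ck_at_ddir ('i%C *: d) H.
exact: Ck_atM (Ck_atD Hx (Ck_atM (Ck_at_cst _ _ _) Hy)) (Ck_at_cst _ _ _).
Qed.
Lemma smooth_at_dhol d z f : smooth_at z f -> smooth_at z (dhol d f).
Proof.
move=> H; have Hx := smooth_at_ddir d H; have Hy := smooth_at_ddir ('i%C *: d) H.
exact: smooth_atM (smooth_atD Hx (smooth_atN (smooth_atM (smooth_at_cst _ _) Hy)))
  (smooth_at_cst _ _).
Qed.
Lemma smooth_at_dbar d z f : smooth_at z f -> smooth_at z (dbar d f).
Proof.
move=> H; have Hx := smooth_at_ddir d H; have Hy := smooth_at_ddir ('i%C *: d) H.
exact: smooth_atM (smooth_atD Hx (smooth_atM (smooth_at_cst _ _) Hy)) (smooth_at_cst _ _).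
Qed.

Lemma ddir_half (c : C) e z f g : Ck_at 1 z f -> Ck_at 1 z g ->
  ddir e (fun w => (f w + c * g w) / 2) z = (ddir e f z + c * ddir e g z) / 2.
Proof.
move=> Hf Hg; have Hcg := Ck_atM (Ck_at_cst 1 z c) Hg.
rewrite (ddirM e (Ck_atD Hf Hcg) (Ck_at_cst 1 z _)) ddir_cst mulr0 addr0.
by rewrite (ddirD e Hf Hcg) (ddirM e (Ck_at_cst 1 z c) Hg) ddir_cst mul0r add0r.
Qed.

Let half_swap (i P Q S T x1 x2 y1 y2 : C) :
  P = (x1 + i * x2) / 2 -> Q = (y1 + i * y2) / 2 ->
  S = (x1 + - i * x2) / 2 -> T = (y1 + - i * y2) / 2 -> y1 = x2 ->
  (P - i * Q) / 2 = (S + i * T) / 2.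
Proof. by move=> -> -> -> -> ->; ring. Qed.

(** Both sides expand into second derivatives along [d] and [i d], and differ only in the order of
    the mixed ones. *)
Lemma dhol_dbar d z f : Ck_at 2 z f -> dhol d (dbar d f) z = dbar d (dhol d f) z.
Proof.
move=> H; have [ O [ oO Oz HO]] := H.
have cl := clairaut d ('i%C *: d) oO Oz HO.
have Hx := Ck_at_ddir d H; have Hy := Ck_at_ddir ('i%C *: d) H.
have e1 e : ddir e (dbar d f) z =
    (ddir e (ddir d f) z + 'i%C * ddir e (ddir ('i%C *: d) f) z) / 2.
  exact: ddir_half.
have e2 e : ddir e (dhol d f) z =
    (ddir e (ddir d f) z + - 'i%C * ddir e (ddir ('i%C *: d) f) z) / 2.
  have -> : dhol d f = fun w => (ddir d f w + - 'i%C * ddir ('i%C *: d) f w) / 2.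
    by apply/funext => w; rewrite mulNr.
  exact: ddir_half.
exact: (half_swap (e1 d) (e1 ('i%C *: d)) (e2 d) (e2 ('i%C *: d)) cl).
Qed.

End CkAt.

(** * Change of variables in the plane *)

Section AffineMeasure.
Variable R : realType.
Local Notation mu := (@lebesgue_measure R).

Local Notation aff a b := ((fun x : R => a%R * x + b%R)%R : R -> measurableTypeR R).

Lemma measurable_affine (a b : R) :
  measurable_fun [set: R] (aff a b).
Proof.
apply: measurable_funD => //; apply: measurable_funM => //.
Qed.

(** By uniqueness of Lebesgue measure it is enough to compare the rescaled image measure on
    half-open intervals. *)
Lemma lebesgue_measure_affine (a b : R) (A : set R) : a != 0 -> measurable A ->
  (`|a|%:E * pushforward mu (aff a b) A = mu A)%E.
Proof.
move=> a0 mA; have mf := measurable_affine a b.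
have na0 : 0 <= `|a| by [].
pose m : {measure set (measurableTypeR R) -> \bar R} :=
  measure_function_pushforward__canonical__measure_function_Measure mu mf.
transitivity (mscale (NngNum na0) m A); first by [].
apply/esym/lebesgue_measure_unique => //= _ [[x y]] _ <-.
rewrite -[RHS]/(`|a|%:E * mu (aff a b @^-1` `]x, y]))%E.
have [agt0|alt0|aeq0] := ltgtP 0 a; last by rewrite -aeq0 eqxx in a0.
- have -> : aff a b @^-1` `]x, y] =
      `](x - b) / a, (y - b) / a]%classic.
    apply/seteqP; split => z; rewrite /= !in_itv /= ltr_pdivrMr// ler_pdivlMr//
      ltrBlDr lerBrDr [z * a]mulrC //.
  rewrite !lebesgue_measure_itv /= !lte_fin ltr_pM2r ?invr_gt0// ltrD2r.
  case: ifPn => xy; last by rewrite mule0.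
  by rewrite -!EFinD -EFinM gtr0_norm//; congr EFin; field; exact: a0.
(* For [a < 0] the preimage is closed at the other end, which does not change its length. *)
- have -> : aff a b @^-1` `]x, y] =
      `[(y - b) / a, (x - b) / a[%classic.
    apply/seteqP; split => z; rewrite /= !in_itv /= ltr_ndivlMr// ler_ndivrMr//
      ltrBlDr lerBrDr [z * a]mulrC andbC //.
  rewrite !lebesgue_measure_itv /= !lte_fin ltr_nM2r ?invr_lt0// ltrD2r.
  case: ifPn => xy; last by rewrite mule0.
  by rewrite -!EFinD -EFinM ltr0_norm//; congr EFin; field; exact: a0.
Qed.

Lemma ge0_integral_affine (a b : R) (F : R -> \bar R) : a != 0 ->
  measurable_fun setT F -> (forall x, 0 <= F x)%E ->
  (\int[mu]_x F x = \int[mu]_x (F (a * x + b)%R * `|a|%:E))%E.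
Proof.
move=> a0 mF F0; have mf := measurable_affine a b.
have na0 : 0 <= `|a| by [].
rewrite ge0_integralZr//; last exact: measurableT_comp mf.
rewrite muleC.
pose m : {measure set (measurableTypeR R) -> \bar R} :=
  measure_function_pushforward__canonical__measure_function_Measure mu mf.
transitivity (\int[mscale (NngNum na0) m]_x F x)%E.
  by apply: eq_measure_integral => A mA _ /=; rewrite -(lebesgue_measure_affine b a0).
rewrite ge0_integral_mscale//; congr (_ * _)%E.
by rewrite ge0_integral_pushforward// preimage_setT.
Qed.

End AffineMeasure.

(** * Changes of variables built from fibrewise affine maps of the plane *)

Section PlaneChange.
Variable R : realType.
Local Notation mu := (@lebesgue_measure R).
Local Notation mu2 := (mu \x mu)%E.

(** The transformation formula itself is the definition, for non-negative functions on the whole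
    plane, because in this form it passes directly to composites. *)
Definition change_of_var (phi : R * R -> R * R) (J : R * R -> R) : Prop :=
  [/\ measurable_fun setT phi, measurable_fun setT J, forall p, 0 <= J p &
    forall F : R * R -> \bar R, measurable_fun setT F -> (forall p, 0 <= F p)%E ->
      (\int[mu2]_p F p = \int[mu2]_p (F (phi p) * (J p)%:E))%E].

Lemma change_of_var_comp phi J psi K :
  change_of_var phi J -> change_of_var psi K ->
  change_of_var (phi \o psi) (fun p => J (psi p) * K p).
Proof.
move=> [mp mJ J0 hp] [mq mK K0 hq].
have mJq : measurable_fun setT (fun p => J (psi p)) by exact: measurableT_comp mJ mq.
split => //.
- exact: measurableT_comp mp mq.
- exact: measurable_funM.
- by move=> p; exact: mulr_ge0.
- move=> F mF F0; rewrite hp// hq.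
  + by apply: eq_integral => p _ /=; rewrite EFinM muleA.
  + apply: emeasurable_funM; first exact: measurableT_comp mF mp.
    exact/measurable_EFinP.
  + by move=> p; rewrite mule_ge0// lee_fin.
Qed.

(** Tonelli: for fixed [y] the map is affine in the first coordinate, and the inner integral is
    transformed by [ge0_integral_affine]. *)
Lemma change_of_var_horizontal (a b : R -> R) :
  measurable_fun setT a -> measurable_fun setT b -> (forall y, a y != 0) ->
  change_of_var (fun p => (a p.2 * p.1 + b p.2, p.2)) (fun p => `|a p.2|).
Proof.
move=> ma mb a0.
have mphi : measurable_fun setT (fun p : R * R => (a p.2 * p.1 + b p.2, p.2)).
  apply: measurable_fun_pair => //.
  apply: measurable_funD; last exact: measurableT_comp.
  by apply: measurable_funM => //; exact: measurableT_comp.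
have mJ : measurable_fun setT (fun p : R * R => `|a p.2|).
  by apply: measurableT_comp => //; exact: measurableT_comp.
split => // F mF F0.
have mG : measurable_fun setT (fun p => F (a p.2 * p.1 + b p.2, p.2)%R * `|a p.2|%:E)%E.
  apply: emeasurable_funM; first exact: measurableT_comp mF mphi.
  exact/measurable_EFinP.
rewrite !fubini_tonelli2//; last by move=> p; rewrite mule_ge0// lee_fin.
apply: eq_integral => y _; rewrite /fubini_G /=.
rewrite (@ge0_integral_affine _ (a y) (b y) (fun x => F (x, y)))//.
exact: measurableT_comp mF (pair2_measurable y).
Qed.

Lemma change_of_var_swap : change_of_var (fun p => (p.2, p.1)) (fun=> 1).
Proof.
have mphi : measurable_fun setT (fun p : R * R => (p.2, p.1)).
  exact: measurable_fun_pair.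
split => // F mF F0.
have mG : measurable_fun setT (fun p => F (p.2, p.1)).
  exact: measurableT_comp mF mphi.
under [RHS]eq_integral do rewrite mule1.
by rewrite fubini_tonelli1// fubini_tonelli2.
Qed.

Lemma change_of_var_vertical (a b : R -> R) :
  measurable_fun setT a -> measurable_fun setT b -> (forall y, a y != 0) ->
  change_of_var (fun p => (p.1, a p.1 * p.2 + b p.1)) (fun p => `|a p.1|).
Proof.
move=> ma mb a0.
have := change_of_var_comp change_of_var_swap
  (change_of_var_comp (change_of_var_horizontal ma mb a0) change_of_var_swap).
congr change_of_var; apply/funext => p /=; by rewrite mul1r mulr1.
Qed.

Lemma null_horizontal_line (y : R) (phi psi : R * R -> \bar R) :
  measurable_fun setT phi -> measurable_fun setT psi ->
  (forall p, 0 <= phi p)%E -> (forall p, 0 <= psi p)%E ->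
  (forall p, p.2 != y -> phi p = psi p) ->
  (\int[mu2]_p phi p = \int[mu2]_p psi p)%E.
Proof.
move=> mp mq p0 q0 pq; rewrite !fubini_tonelli2//.
apply: ge0_ae_eq_integral => //.
- exact: measurable_fun_fubini_tonelli_G.
- exact: measurable_fun_fubini_tonelli_G.
- by move=> x _; exact: integral_ge0.
- by move=> x _; exact: integral_ge0.
- exists [set y]; split => //; first exact: lebesgue_measure_set1.
  move=> z /= h; apply/eqP/negPn/negP => zy; apply: h => _.
  by apply: eq_integral => x _; rewrite pq.
Qed.

Lemma null_vertical_line (x : R) (phi psi : R * R -> \bar R) :
  measurable_fun setT phi -> measurable_fun setT psi ->
  (forall p, 0 <= phi p)%E -> (forall p, 0 <= psi p)%E ->
  (forall p, p.1 != x -> phi p = psi p) ->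
  (\int[mu2]_p phi p = \int[mu2]_p psi p)%E.
Proof.
move=> mp mq p0 q0 pq.
have [_ _ _ h] := change_of_var_swap; rewrite h// [RHS]h//.
have ms : measurable_fun setT (fun p : R * R => (p.2, p.1)).
  exact: measurable_fun_pair.
apply: (@null_horizontal_line x) => [||p|p|p px].
- under eq_fun do rewrite mule1; exact: measurableT_comp mp ms.
- under eq_fun do rewrite mule1; exact: measurableT_comp mq ms.
- by rewrite mule1.
- by rewrite mule1.
- by rewrite pq.
Qed.

(** Lets a factorization into fibrewise affine maps that is valid only where no coordinate vanishes
    determine the formula on the whole plane. *)
Lemma change_of_var_off_axes (phi psi : R * R -> R * R) (J K : R * R -> R) :
  measurable_fun setT psi -> measurable_fun setT K -> (forall p, 0 <= K p) ->
  (forall p, p.1 != 0 -> p.2 != 0 -> phi p = psi p /\ J p = K p) ->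
  change_of_var phi J -> change_of_var psi K.
Proof.
move=> mq mK K0 e [mp mJ J0 h]; split => // F mF F0.
have mm phi' J' : measurable_fun setT phi' -> measurable_fun setT J' ->
    measurable_fun setT (fun p : R * R => F (phi' p) * (J' p)%:E)%E.
  move=> mp' mJ'; apply: emeasurable_funM; first exact: measurableT_comp mF mp'.
  exact/measurable_EFinP.
have mx : measurable_fun setT (fun p : R * R => p.1 == 0).
  by apply: measurable_fun_eqr.
rewrite h//.
(* Interpolates between the two integrands: it differs from one of them only on the vertical axis
   and from the other only on the horizontal axis, and both axes are null. *)
pose G (p : R * R) := if p.1 == 0 then (F (psi p) * (K p)%:E)%E
  else (F (phi p) * (J p)%:E)%E.
have mG : measurable_fun setT G.
  by apply: measurable_fun_ifT => //; exact: mm.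
have G0 p : (0 <= G p)%E by rewrite /G; case: ifP => _; rewrite mule_ge0// lee_fin.
rewrite (@null_vertical_line 0 _ G) => //.
- apply: (@null_horizontal_line 0) => //; first exact: mm.
    by move=> p; rewrite mule_ge0// lee_fin.
  move=> p p2; rewrite /G; case: eqP => // /eqP p1.
  by have [-> ->] := e p p1 p2.
- exact: mm.
- by move=> p; rewrite mule_ge0// lee_fin.
- by move=> p /negbTE p1; rewrite /G p1.
Qed.

End PlaneChange.

(** * Similarities and inversion of the complex plane *)

Section ComplexChange.
Variable R : realType.
Local Notation C := R[i].
Local Notation re := (@complex.Re R).
Local Notation im := (@complex.Im R).
Local Notation mu := (@lebesgue_measure R).
Local Notation mu2 := (mu \x mu)%E.

Definition cplx (p : R * R) : C := p.1 +i* p.2.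
Definition pair_of (z : C) : R * R := (re z, im z).
Definition sqnorm (z : C) : R := re z ^+ 2 + im z ^+ 2.

Lemma pair_ofK z : cplx (pair_of z) = z. Proof. by case: z. Qed.

Lemma sqnorm_eq0 z : (sqnorm z == 0) = (z == 0).
Proof. exact: re2im2_eq0. Qed.
Lemma sqnorm_ge0 z : 0 <= sqnorm z.
Proof. by rewrite addr_ge0// sqr_ge0. Qed.
Lemma sqnorm_gt0 z : z != 0 -> 0 < sqnorm z.
Proof. by move=> z0; rewrite lt_neqAle sqnorm_ge0 eq_sym sqnorm_eq0 z0. Qed.
Lemma sqnormM z w : sqnorm (z * w) = sqnorm z * sqnorm w.
Proof. rewrite /sqnorm !reimE; ring. Qed.
Lemma sqnormE z : (sqnorm z)%:C = z * conjc z.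
Proof. by rewrite /sqnorm add_Re2_Im2 sqr_normc. Qed.
Lemma sqnormV z : sqnorm z^-1 = (sqnorm z)^-1.
Proof. by apply: complexI; rewrite fmorphV /= !sqnormE invfM conjc_inv. Qed.
Lemma sqnorm0 : sqnorm 0 = 0.
Proof. by apply/eqP; rewrite sqnorm_eq0. Qed.
Lemma sqnorm1 : sqnorm 1 = 1.
Proof. by rewrite /sqnorm /= expr1n expr0n addr0. Qed.
Lemma sqnormN z : sqnorm (- z) = sqnorm z.
Proof. by rewrite /sqnorm !reimE !sqrrN. Qed.

Definition cchange (phi : C -> C) (J : C -> R) : Prop :=
  change_of_var (fun p => pair_of (phi (cplx p))) (fun p => J (cplx p)).

Lemma cchange_ext phi J psi K : phi =1 psi -> J =1 K -> cchange phi J -> cchange psi K.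
Proof. by move=> /funext -> /funext ->. Qed.

Lemma cchange_comp phi J psi K : cchange phi J -> cchange psi K ->
  cchange (phi \o psi) (fun z => J (psi z) * K z).
Proof.
move=> h1 h2; have := change_of_var_comp h1 h2; rewrite /cchange.
by congr change_of_var; apply/funext => p /=; rewrite pair_ofK.
Qed.

Lemma cchange_trans (c : C) : cchange (fun z => z + c) (fun=> 1).
Proof.
have := @change_of_var_comp _ _ _ _ _
  (@change_of_var_horizontal R (fun=> 1) (fun=> re c) (measurable_cst _) (measurable_cst _)
    (fun=> oner_neq0 _))
  (@change_of_var_vertical R (fun=> 1) (fun=> im c) (measurable_cst _) (measurable_cst _)
    (fun=> oner_neq0 _)).
congr change_of_var; apply/funext => p /=; last by rewrite normr1 mulr1.
by rewrite /pair_of !reimE /cplx /= !mul1r.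
Qed.

(** Triangular factorization of the real matrix of multiplication by [u]: a horizontal map followed
    by a vertical one, with pivot [re u]. *)
Let cchange_mul_re (u : C) : re u != 0 -> cchange (fun z => u * z) (fun=> sqnorm u).
Proof.
move=> u0.
have m1 : measurable_fun setT (fun y : R => - im u * y).
  by apply: measurable_funM.
have m2 : measurable_fun setT (fun y : R => im u / re u * y).
  by apply: measurable_funM.
have s0 : (re u ^+ 2 + im u ^+ 2) / re u != 0.
  rewrite mulf_neq0 ?invr_neq0// re2im2_eq0; apply: contraNneq u0 => ->.
  by rewrite eqxx.
have := @change_of_var_comp _ _ _ _ _
  (@change_of_var_vertical R (fun=> (re u ^+ 2 + im u ^+ 2) / re u)
    (fun x => im u / re u * x) (measurable_cst _) m2 (fun=> s0))
  (@change_of_var_horizontal R (fun=> re u) (fun y => - im u * y) (measurable_cst _) m1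
    (fun=> u0)).
congr change_of_var; apply/funext => p /=.
- rewrite /pair_of !reimE /cplx /=; congr pair; first by ring.
  by field; exact: u0.
- by rewrite -normrM divfK// ger0_norm// sqnorm_ge0.
Qed.

Lemma cchange_mul (u : C) : u != 0 -> cchange (fun z => u * z) (fun=> sqnorm u).
Proof.
move=> u0; have [r0|r0] := eqVneq (re u) 0; last exact: cchange_mul_re.
(* Since [(1 + i) ^ 2 = 2 i], an imaginary [u] is a product of two numbers with non-zero real
   part. *)
have h1 : re (1 +i* 1 : C) != 0 by rewrite /= oner_neq0.
have i0 : im u != 0.
  by apply: contraNneq u0 => i0; rewrite eq_complex r0 i0 !eqxx.
have h2 : re ((im u / 2) +i* (im u / 2) : C) != 0.
  by rewrite /= mulf_neq0// invr_neq0// pnatr_eq0.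
have := cchange_comp (cchange_mul_re h1) (cchange_mul_re h2).
have e : (1 +i* 1) * ((im u / 2) +i* (im u / 2)) = u :> C.
  apply: complex_ext; [rewrite ReM|rewrite ImM]; cbn [complex.Re complex.Im].
    by rewrite r0 subrr.
  by field.
by apply: cchange_ext => z /=; rewrite ?mulrA ?e// -sqnormM e.
Qed.

(** Real powers of [|x|] are measurable, and [x / |x| ^ 2] is the inverse of [x], at [0] as well. *)
Lemma measurable_inv : measurable_fun [set: R] (@GRing.inv R).
Proof.
have -> : @GRing.inv R = fun x => x * (`|x| `^ (-1) * `|x| `^ (-1)).
  apply/funext => x; rewrite !powR_inv1// -invfM -normrM ger0_norm ?sqr_ge0 -?expr2//.
  have [->|x0] := eqVneq x 0; first by rewrite invr0 mul0r.
  by field.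
apply: measurable_funM => //.
have mp : measurable_fun setT (fun x : R => `|x| `^ (-1)).
  by apply: measurableT_comp (measurable_powR _) _.
exact: measurable_funM.
Qed.

(** Keeps the scaling factors of the fibrewise maps non-zero, and alters them only where their
    argument vanishes. *)
Let nz (x : R) := if x == 0 then 1 else x.
Let nz0 x : nz x != 0.
Proof. by rewrite /nz; have [_|//] := eqVneq x 0; exact: oner_neq0. Qed.
Let nzE x : x != 0 -> nz x = x.
Proof. by rewrite /nz; case: eqP. Qed.
Let measurable_nz : measurable_fun setT nz.
Proof.
apply: measurable_fun_ifT => //.
exact: (@measurable_fun_eqr _ _ R setT id (cst 0)).
Qed.
Let measurable_nzV : measurable_fun setT (fun x => (nz x)^-1).
Proof. exact: measurableT_comp measurable_inv measurable_nz. Qed.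

Lemma measurable_plane_inv : measurable_fun setT (fun p => pair_of (cplx p)^-1).
Proof.
have m2 : measurable_fun setT (fun p : R * R => (p.1 ^+ 2 + p.2 ^+ 2)^-1).
  apply: (measurableT_comp measurable_inv).
  by apply: measurable_funD; apply: measurable_funX.
apply: measurable_fun_pair => /=; first exact: measurable_funM.
by apply: measurable_funN; exact: measurable_funM.
Qed.

(** Off the axes, and up to a swap and signs, inversion is the composition of
    [(x, y) -> (x / y, y)], [(t, y) -> (t, w)] with [w = y (1 + t ^ 2)],
    [(t, w) -> (t w, w) -> (t w, 1 / w) -> (t, 1 / w)] and [(t, 1 / w) -> (t / w, 1 / w)]. *)
Lemma cchange_inv : cchange (fun z => z^-1) (fun z => (sqnorm z ^+ 2)^-1).
Proof.
have c0 : measurable_fun [set: R] (fun=> (0 : R)) by [].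
have nzV0 x : (nz x)^-1 != 0 by rewrite invr_neq0.
have mt : measurable_fun setT (fun x : R => 1 + x ^+ 2).
  by apply: measurable_funD => //; exact: measurable_funX.
have t0 (x : R) : 1 + x ^+ 2 != 0.
  by rewrite gt_eqF// (@lt_le_trans _ _ 1)// lerDl sqr_ge0.
have mN : measurable_fun setT (fun x => - nz x) by exact: measurableT_comp.
have nzN0 x : - nz x != 0 by rewrite oppr_eq0.
have cN1 : measurable_fun [set: R] (fun=> (-1 : R)) by [].
have N10 : -1 != 0 :> R by rewrite oppr_eq0 oner_neq0.
have h := change_of_var_comp (change_of_var_vertical measurable_nz c0 nz0)
  (change_of_var_comp (change_of_var_vertical mt c0 t0)
    (change_of_var_horizontal measurable_nzV c0 nzV0)).
have {}h := change_of_var_comp (change_of_var_vertical measurable_nz c0 nz0)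
  (change_of_var_comp (change_of_var_horizontal measurable_nzV c0 nzV0) h).
have {}h := change_of_var_comp (change_of_var_horizontal mN c0 nzN0)
  (change_of_var_comp (change_of_var_vertical cN1 c0 (fun=> N10))
    (change_of_var_comp (@change_of_var_swap R) h)).
apply: change_of_var_off_axes h.
- exact: measurable_plane_inv.
- apply: (measurableT_comp measurable_inv); apply: measurable_funX.
  have m2 : measurable_fun setT (fun p : R * R => p.1 ^+ 2 + p.2 ^+ 2).
    by apply: measurable_funD; apply: measurable_funX.
  exact: m2.
- by move=> p; rewrite invr_ge0 sqr_ge0.
- case=> x y /= x0 y0; rewrite !addr0 (nzE y0).
  set t := y^-1 * x; have tn0 : t != 0 by rewrite mulf_neq0// invr_neq0.
  set w := (1 + t ^+ 2) * y; have wn0 : w != 0 by rewrite mulf_neq0.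
  rewrite (nzE tn0); set s := t * w; have sn0 : s != 0 by rewrite mulf_neq0.
  rewrite (nzE sn0); set q := s^-1 * t; have qn0 : q != 0 by rewrite mulf_neq0// invr_neq0.
  have qN0 : -1 * q != 0 by rewrite mulf_neq0.
  rewrite (nzE qn0) (nzE qN0).
  have n0 : x ^+ 2 + y ^+ 2 != 0.
    by rewrite gt_eqF// ltr_wpDl ?sqr_ge0// lt_neqAle eq_sym sqrf_eq0 y0 sqr_ge0.
  have wE : w = (x ^+ 2 + y ^+ 2) / y by rewrite /w /t; field; exact: y0.
  have qE : q = y / (x ^+ 2 + y ^+ 2).
    by rewrite /q /s wE; field; rewrite n0 y0.
  have sE : s = x * (x ^+ 2 + y ^+ 2) / y ^+ 2.
    rewrite /s wE /t; field; exact: y0.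
  split.
    by rewrite /pair_of /= qE sE; congr pair; field; rewrite ?n0 ?y0.
  rewrite mul1r -!normrM sE qE /t /sqnorm /=.
  have p0 : 0 <= (x ^+ 2 + y ^+ 2) ^- 2 by rewrite invr_ge0 sqr_ge0.
  rewrite -[RHS]ger0_norm// -normrN; congr `|_|.
  by field; rewrite x0 y0 n0.
Qed.

End ComplexChange.

(** * Moebius transformations and their Jacobian *)

Section Moebius.
Variable R : realType.
Local Notation C := R[i].
Local Notation re := (@complex.Re R).
Local Notation im := (@complex.Im R).
Local Notation Mx := 'M[C]_2.

Definition mnum (m : Mx) (z : C) : C := m 0 0 * z + m 0 1.
Definition mden (m : Mx) (z : C) : C := m 1 0 * z + m 1 1.
Definition mdet (m : Mx) : C := m 0 0 * m 1 1 - m 0 1 * m 1 0.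
(** Numerator and denominator of the inverse transformation. *)
Definition inum (m : Mx) (l : C) : C := m 1 1 * l - m 0 1.
Definition iden (m : Mx) (l : C) : C := m 0 0 - m 1 0 * l.

Lemma det_mdet (m : Mx) : \det m = mdet m.
Proof.
rewrite (expand_det_row _ 0) !big_ord_recl big_ord0 addr0 /cofactor !det_mx11 !mxE.
rewrite /= expr0 expr1 mul1r mulN1r mulrN /mdet.
by congr (_ * m _ _ - m _ _ * m _ _); apply/val_inj.
Qed.

Lemma unitmx_mdet (m : Mx) : m \in unitmx -> mdet m != 0.
Proof. by rewrite unitmxE unitfE det_mdet. Qed.

Lemma sqnorm_lt1 (z : C) : (`|z| < 1) = (sqnorm z < 1).
Proof.
rewrite -(@ltr_pXn2r _ 2) ?nnegrE//.
by rewrite expr1n -add_Re2_Im2 -[1]/((1 : R)%:C) ltcR.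
Qed.

Lemma sqnorm_le1 (z : C) : (`|z| <= 1) = (sqnorm z <= 1).
Proof.
rewrite -(@ler_pXn2r _ 2) ?nnegrE//.
by rewrite expr1n -add_Re2_Im2 -[1]/((1 : R)%:C) lecR.
Qed.

Section Unit.
Variables (m : Mx) (um : m \in unitmx).
Let det0 := unitmx_mdet um.

Lemma mobius_Some z : mden m z != 0 -> mobius m z = Some (mnum m z / mden m z).
Proof. by move=> d0; rewrite /mobius -/(mden m z) (negbTE d0). Qed.

Lemma mobius_None z : mden m z = 0 -> mobius m z = None.
Proof. by move=> d0; rewrite /mobius -/(mden m z) d0 eqxx. Qed.

Lemma inum_mobius z : mden m z != 0 -> inum m (mnum m z / mden m z) = mdet m * z / mden m z.
Proof. move=> d0; rewrite /inum /mnum /mdet; move: d0; rewrite /mden => d0; field; exact: d0. Qed.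

Lemma iden_mobius z : mden m z != 0 -> iden m (mnum m z / mden m z) = mdet m / mden m z.
Proof. move=> d0; rewrite /iden /mnum /mdet; move: d0; rewrite /mden => d0; field; exact: d0. Qed.

Lemma mden_inv l : iden m l != 0 -> mden m (inum m l / iden m l) = mdet m / iden m l.
Proof. move=> d0; rewrite /inum /mden /mdet; move: d0; rewrite /iden => d0; field; exact: d0. Qed.

Lemma mnum_inv l : iden m l != 0 -> mnum m (inum m l / iden m l) = mdet m * l / iden m l.
Proof. move=> d0; rewrite /inum /mnum /mdet; move: d0; rewrite /iden => d0; field; exact: d0. Qed.

Lemma mobius_inv l : iden m l != 0 -> mobius m (inum m l / iden m l) = Some l.
Proof.
move=> d0; rewrite mobius_Some mden_inv// ?mulf_neq0 ?invr_neq0// mnum_inv//.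
by congr Some; field; rewrite d0 det0.
Qed.

Lemma iden_neq0 l z : mobius m z = Some l -> iden m l != 0.
Proof.
have [d0|d0] := eqVneq (mden m z) 0; first by rewrite mobius_None.
by rewrite mobius_Some// => -[<-]; rewrite iden_mobius// mulf_neq0// invr_neq0.
Qed.

Lemma mobius_SomeE l z : mobius m z = Some l -> z = inum m l / iden m l.
Proof.
have [d0|d0] := eqVneq (mden m z) 0; first by rewrite mobius_None.
rewrite mobius_Some// => -[<-]; rewrite iden_mobius// inum_mobius//.
by field; rewrite d0 det0.
Qed.

(** Comparing the moduli of numerator and denominator avoids the quotient, so the criterion also
    covers the image of infinity, where [iden] vanishes. *)
Lemma odisc_Some l : odisc m (Some l) <-> sqnorm (inum m l) < sqnorm (iden m l).
Proof.
split=> [[z /= z1 e]|h].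
  have d0 := iden_neq0 e.
  move: z1; rewrite (mobius_SomeE e) sqnorm_lt1 sqnormM sqnormV.
  by rewrite ltr_pdivrMr ?mul1r// sqnorm_gt0.
have d0 : iden m l != 0.
  by apply: contraTneq h => ->; rewrite sqnorm0 -leNgt sqnorm_ge0.
exists (inum m l / iden m l); last exact: mobius_inv.
by rewrite /= sqnorm_lt1 sqnormM sqnormV ltr_pdivrMr ?mul1r// sqnorm_gt0.
Qed.

Lemma iden_inum_neq0 l : iden m l = 0 -> inum m l != 0.
Proof.
move=> h; apply: contraNneq det0 => h'.
have -> : mdet m = m 1 1 * iden m l + m 1 0 * inum m l.
  by rewrite /mdet /inum /iden; ring.
by rewrite h h' !mulr0 addr0.
Qed.

Lemma cdet0 z : mden m z = 0 -> m 1 0 != 0.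
Proof.
move=> h; apply: contraNneq det0 => c0.
by move: h; rewrite /mden /mdet c0 mul0r add0r => ->; rewrite !mulr0 subr0.
Qed.

Lemma mden_eq0 z : m 1 0 != 0 -> mden m z = 0 -> z = - m 1 1 / m 1 0.
Proof.
move=> c0 /eqP; rewrite /mden addr_eq0 => /eqP h.
by rewrite -h mulrC mulKf.
Qed.

(** Infinity is the image of the pole [- m 1 1 / m 1 0], when there is one. *)
Lemma odisc_None : odisc m None <-> sqnorm (m 1 1) < sqnorm (m 1 0).
Proof.
split=> [[z /= z1 e]|h].
  have d0 : mden m z = 0.
    by apply/eqP; apply: contraPT e => d0; rewrite mobius_Some.
  have c0 := cdet0 d0; move: z1; rewrite (mden_eq0 c0 d0) sqnorm_lt1 mulNr sqnormN.
  by rewrite sqnormM sqnormV ltr_pdivrMr ?mul1r// sqnorm_gt0.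
have c0 : m 1 0 != 0.
  by apply: contraTneq h => ->; rewrite sqnorm0 -leNgt sqnorm_ge0.
exists (- m 1 1 / m 1 0).
  by rewrite /= sqnorm_lt1 mulNr sqnormN sqnormM sqnormV ltr_pdivrMr ?mul1r// sqnorm_gt0.
by apply: mobius_None; rewrite /mden mulrC divfK// addNr.
Qed.

(** An affine map if [m 1 0 = 0]; otherwise a translation, the inversion, a similarity and a
    translation. The map [phi] has values in [C], whereas [mobius] is [None] at the pole; there
    [phi] has the value given by the convention for the inverse of [0]. *)
Lemma cchange_mobius : exists phi : C -> C,
  cchange phi (fun z => sqnorm (mdet m) / sqnorm (mden m z) ^+ 2) /\
  forall z, mden m z != 0 -> phi z = mnum m z / mden m z.
Proof.
have [c0|c0] := eqVneq (m 1 0) 0.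
  have dE : mdet m = m 0 0 * m 1 1 by rewrite /mdet c0 mulr0 subr0.
  have := det0; rewrite dE mulf_eq0 negb_or => /andP[a0 d0].
  have ad0 : m 0 0 / m 1 1 != 0 by rewrite mulf_neq0// invr_neq0.
  exists (fun z => m 0 0 / m 1 1 * z + m 0 1 / m 1 1); split.
    have := cchange_comp (cchange_trans (m 0 1 / m 1 1)) (cchange_mul ad0).
    apply: cchange_ext => z; first by [].
    rewrite mul1r /mden c0 mul0r add0r.
    rewrite !sqnormM sqnormV; have := sqnorm_gt0 d0 => n0.
    by field; rewrite gt_eqF.
  move=> z; rewrite /mden /mnum c0 mul0r add0r => _; field; exact: d0.
have b0 : - (mdet m) / m 1 0 ^+ 2 != 0.
  by rewrite mulf_neq0 ?invr_neq0 ?oppr_eq0 ?expf_neq0.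
exists (fun z => - (mdet m) / m 1 0 ^+ 2 * (z + m 1 1 / m 1 0)^-1 + m 0 0 / m 1 0); split.
  have := cchange_comp (cchange_trans (m 0 0 / m 1 0)) (cchange_comp (cchange_mul b0)
    (cchange_comp (@cchange_inv R) (cchange_trans (m 1 1 / m 1 0)))).
  apply: cchange_ext => z; first by [].
  rewrite mul1r mulr1 mulNr sqnormN sqnormM sqnormV expr2 !sqnormM.
  have -> : z + m 1 1 / m 1 0 = mden m z / m 1 0 by rewrite /mden; field; exact: c0.
  rewrite sqnormM sqnormV; have := sqnorm_gt0 c0 => n0.
  have [->|mz0] := eqVneq (mden m z) 0; first by rewrite sqnorm0 mul0r expr0n /= !invr0 !mulr0.
  have mz := sqnorm_gt0 mz0.
  by field; rewrite !gt_eqF.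
move=> z mz0.
have -> : z + m 1 1 / m 1 0 = mden m z / m 1 0 by rewrite /mden; field; exact: c0.
rewrite invf_div.
have -> : mnum m z = (m 0 0 * mden m z - mdet m) / m 1 0.
  by rewrite /mnum /mden /mdet; field; exact: c0.
by field; rewrite c0 mz0.
Qed.

End Unit.
End Moebius.

(** * Measurability in the plane and integrals over discs *)

Section PlaneMeasurable.
Variable R : realType.
Local Notation C := R[i].
Local Notation re := (@complex.Re R).
Local Notation im := (@complex.Im R).
Local Notation mu := (@lebesgue_measure R).
Local Notation mu2 := (mu \x mu)%E.

(** An open set is the union of the rational squares it contains; these are countably many and
    measurable for the product structure. *)
Lemma open_plane_measurable (A : set (R * R)) :
  open (A : set (R^o * R^o)) -> measurable A.
Proof.
move=> oA.
pose F (i : rat * rat * rat) : set (R * R) :=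
  `]ratr i.1.1 - ratr i.2, ratr i.1.1 + ratr i.2[ `*`
  `]ratr i.1.2 - ratr i.2, ratr i.1.2 + ratr i.2[.
pose G i := if `[< F i `<=` A >] then F i else set0.
suff -> : A = \bigcup_i G i.
  apply: countable_bigcupT_measurable => // i; rewrite /G.
  by case: ifP => // _; apply: measurableX; exact: measurable_itv.
apply/seteqP; split => [[x y] Axy|p [i _]]; last first.
  by rewrite /G; case: ifPn => [/asboolP + Fp|//]; apply.
have /nbhs_ballP[e e0 he] : nbhs ((x, y) : R^o * R^o) A by exact: open_nbhs_nbhs.
have e4 : 0 < e / 4 by rewrite divr_gt0.
(* With half-width between [e / 4] and [e / 2] and centre within [e / 4] of the point, in each
   coordinate, the square contains the point and stays in the ball of radius [e]. *)
have e2 : e / 4 < e / 2 by rewrite ltr_pM2l// ltf_pV2 ?posrE// ltr_nat.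
have [r /[!in_itv] /= /andP[r1 r2]] := rat_in_itvoo e2.
have xr : x - e / 4 < x + e / 4 by lra.
have yr : y - e / 4 < y + e / 4 by lra.
have [qx /[!in_itv] /= /andP[qx1 qx2]] := rat_in_itvoo xr.
have [qy /[!in_itv] /= /andP[qy1 qy2]] := rat_in_itvoo yr.
exists (qx, qy, r) => //; rewrite /G; case: ifPn => [_|/asboolP []].
  by split; rewrite /= in_itv /=; apply/andP; split; lra.
move=> [x' y'] [/=]; rewrite !in_itv /= => /andP[x1 x2] /andP[y1 y2].
apply: he; split; rewrite /ball /= ltr_norml; apply/andP; split; lra.
Qed.

Lemma cvg_cplx (p : R^o * R^o) : (fun p : R^o * R^o => cplx p : C^o) @ p --> (cplx p : C^o).
Proof. by apply: cvg_ReIm; [exact: cvg_fst|exact: cvg_snd]. Qed.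

Lemma measurable_plane_open (O : set C^o) : open O -> measurable [set p : R * R | O (cplx p)].
Proof.
move=> oO; apply: open_plane_measurable; rewrite openE => p /= Op.
by apply: (@cvg_cplx p); exact: open_nbhs_nbhs.
Qed.

(** Continuity holds in the whole plane at each point of [A]; hence on [A] the preimage of an open
    interval coincides with its interior, which is an open set. *)
Lemma measurable_plane_continuous_on (A : set (R * R)) (k : C -> R) : measurable A ->
  (forall p, A p -> {for (cplx p : C^o), continuous (k : C^o -> R^o)}) ->
  measurable_fun A (fun p => k (cplx p)).
Proof.
move=> mA ck _; apply: (measurability _ (RGenOpens.measurableE R)) => //.
move=> _ [_ [a [b ->] <-]].
suff -> : A `&` (fun p => k (cplx p)) @^-1` `]a, b[ =
    A `&` [set p | interior (k @^-1` `]a, b[ : set C^o) (cplx p)].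
  by apply: measurableI => //; exact: (measurable_plane_open (@open_interior _ _)).
apply/seteqP; split => p /= [Ap kp]; split => //; last first.
  exact: (@interior_subset C^o (k @^-1` `]a, b[) (cplx p) kp).
by apply: (ck p Ap); apply: open_nbhs_nbhs; split => //; exact: interval_open.
Qed.

Lemma measurable_plane_continuous (O : set C^o) (k : C -> R) : open O ->
  (forall z : C^o, O z -> {for z, continuous (k : C^o -> R^o)}) ->
  measurable_fun [set p : R * R | O (cplx p)] (fun p => k (cplx p)).
Proof.
move=> oO ck; apply: measurable_plane_continuous_on => [|p]; last exact: ck.
exact: measurable_plane_open.
Qed.

Lemma measurable_plane_sqnorm (f : C -> C) (a b : C) : f =1 (fun l => a * l + b) ->
  measurable_fun setT (fun p => sqnorm (f (cplx p))).
Proof.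
move=> /funext ->; have mr : measurable_fun setT (fun p : R * R => re a * p.1 - im a * p.2 + re b).
  by apply: measurable_funD => //; apply: measurable_funB; apply: measurable_funM.
have mi : measurable_fun setT (fun p : R * R => re a * p.2 + im a * p.1 + im b).
  by apply: measurable_funD => //; apply: measurable_funD; apply: measurable_funM.
have := measurable_funD (measurable_funX 2 mr) (measurable_funX 2 mi).
by congr measurable_fun; apply/funext => p; rewrite /sqnorm !reimE.
Qed.

Lemma measurable_sqnorm_inum (m : 'M[C]_2) :
  measurable_fun setT (fun p => sqnorm (inum m (cplx p))).
Proof. by apply: (@measurable_plane_sqnorm _ (m 1 1) (- m 0 1)). Qed.

Lemma measurable_sqnorm_iden (m : 'M[C]_2) :
  measurable_fun setT (fun p => sqnorm (iden m (cplx p))).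
Proof.
by apply: (@measurable_plane_sqnorm _ (- m 1 0) (m 0 0)) => l; rewrite /iden addrC mulNr.
Qed.

Definition odisc_plane (m : 'M[C]_2) : set (R * R) := [set p | odisc m (Some (cplx p))].

Lemma measurable_odisc_plane m : m \in unitmx -> measurable (odisc_plane m).
Proof.
move=> um.
have h : measurable (setT `&` (fun p => sqnorm (inum m (cplx p)) < sqnorm (iden m (cplx p)))
    @^-1` [set true]).
  exact: (measurable_fun_ltr (measurable_sqnorm_inum m) (measurable_sqnorm_iden m)).
rewrite setTI in h.
suff -> : odisc_plane m = (fun p => sqnorm (inum m (cplx p)) < sqnorm (iden m (cplx p)))
  @^-1` [set true] by [].
by apply/seteqP; split => p /=; rewrite /odisc_plane /= odisc_Some.
Qed.

Definition unit_disc : set (R * R) := [set p | sqnorm (cplx p) < 1].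

Lemma measurable_unit_disc : measurable unit_disc.
Proof.
have e : id =1 (fun l : C => 1 * l + 0) by move=> l; rewrite mul1r addr0.
have h := measurable_plane_sqnorm e.
have h' : measurable (setT `&` (fun p : R * R => sqnorm (cplx p) < 1) @^-1` [set true]).
  have c1 : measurable_fun [set: R * R] (fun=> (1 : R)) by [].
  exact: (measurable_fun_ltr h c1).
by rewrite setTI in h'.
Qed.

(** A non-negative Jacobian commutes with positive and negative parts, so the formula for
    non-negative functions applies to each of them. *)
Lemma Rintegral_change phi J (k : R * R -> R) : change_of_var phi J ->
  measurable_fun setT k ->
  \int[mu2]_p k p = \int[mu2]_p (k (phi p) * J p).
Proof.
move=> [mp mJ J0 h] mk; rewrite /Rintegral; congr fine.
rewrite integralE [RHS]integralE; congr (_ - _)%E.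
- rewrite h//; first last.
    by apply: measurable_funepos; exact/measurable_EFinP.
  apply: eq_integral => p _; rewrite !funeposE /= -EFin_max -EFinM -EFin_max.
  by rewrite maxr_pMl// mul0r.
- rewrite h//; first last.
    by apply: measurable_funeneg; exact/measurable_EFinP.
  apply: eq_integral => p _; rewrite !funenegE /= -EFin_max -EFinM -EFin_max.
  by rewrite maxr_pMl// mul0r mulNr.
Qed.

Lemma Rintegral_off_line (x : R) (f g : R * R -> R) :
  measurable_fun setT f -> measurable_fun setT g ->
  (forall p, p.1 != x -> f p = g p) -> \int[mu2]_p f p = \int[mu2]_p g p.
Proof.
move=> mf mg fg; rewrite /Rintegral; congr fine.
have mf' := (measurable_EFinP _ _).2 mf; have mg' := (measurable_EFinP _ _).2 mg.
rewrite integralE [RHS]integralE; congr (_ - _)%E.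
- apply: (@null_vertical_line _ x) => //; [exact: measurable_funepos..|].
  by move=> p px; rewrite !funeposE /= fg.
- apply: (@null_vertical_line _ x) => //; [exact: measurable_funeneg..|].
  by move=> p px; rewrite !funenegE /= fg.
Qed.

Lemma patch_asbool (A : set (R * R)) (f : R * R -> R) p :
  (f \_ A) p = if `[< A p >] then f p else 0.
Proof.
have [h|h] := pselect (A p); rewrite patchE; first by rewrite mem_set// asboolT.
by rewrite memNset// asboolF.
Qed.

(** The relation between [k1] and [k] is imposed off the pole only, which leaves [k1] free to be
    continuous there. *)
Lemma Rintegral_odisc (m : 'M[C]_2) (k k1 : C -> R) : m \in unitmx ->
  measurable_fun (odisc_plane m) (fun p => k (cplx p)) ->
  measurable_fun unit_disc (fun p => k1 (cplx p)) ->
  (forall z, sqnorm z < 1 -> mden m z != 0 ->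
    k1 z = k (mnum m z / mden m z) * (sqnorm (mdet m) / sqnorm (mden m z) ^+ 2)) ->
  \int[mu2]_(p in odisc_plane m) k (cplx p) = \int[mu2]_(p in unit_disc) k1 (cplx p).
Proof.
move=> um mk mk1 kk1; have [phi [cphi phiE]] := cchange_mobius um.
have mA := measurable_odisc_plane um.
have mK := (measurable_restrictT _ mA).1 mk.
have mK1 := (measurable_restrictT _ measurable_unit_disc).1 mk1.
rewrite Rintegral_mkcond [RHS]Rintegral_mkcond.
rewrite (Rintegral_change cphi)//.
have [mphi mJ _ _] := cphi.
have e p : mden m (cplx p) != 0 ->
    ((fun p => k (cplx p)) \_ (odisc_plane m)) (pair_of (phi (cplx p))) *
      (sqnorm (mdet m) / sqnorm (mden m (cplx p)) ^+ 2) =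
    ((fun p => k1 (cplx p)) \_ unit_disc) p.
  move=> d0.
  rewrite !patch_asbool.
  rewrite phiE//.
  have -> : `[< odisc_plane m (pair_of (mnum m (cplx p) / mden m (cplx p))) >] =
      `[< unit_disc p >].
    apply: asbool_equiv_eq; rewrite /odisc_plane /= pair_ofK odisc_Some// inum_mobius// iden_mobius//.
    rewrite !sqnormM sqnormV ltr_pM2r ?invr_gt0 ?sqnorm_gt0//.
    by rewrite gtr_pMr ?sqnorm_gt0// unitmx_mdet.
  by case: asboolP => [h|]; rewrite ?mul0r// kk1// pair_ofK.
have mL : measurable_fun setT (fun p => ((fun p => k (cplx p)) \_ (odisc_plane m))
    (pair_of (phi (cplx p))) * (sqnorm (mdet m) / sqnorm (mden m (cplx p)) ^+ 2)).
  by apply: measurable_funM => //; exact: measurableT_comp mK mphi.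
(* This vertical line is null and contains the pole, if there is one. *)
apply: (@Rintegral_off_line (re (- m 1 1 / m 1 0))) => // p px; apply: e.
apply: contraNneq px => d0.
have c0 := cdet0 um d0.
by rewrite -(mden_eq0 c0 d0).
Qed.

End PlaneMeasurable.
Arguments unit_disc {R}.

(** * Green's theorem on discs of the sphere *)

Section Segments.
Variable R : realType.
Local Notation mu := (@lebesgue_measure R).
Implicit Types (k f g : R -> R) (a b c : R).

Lemma within_continuous a b k : {in `[a, b], continuous (k : R^o -> R^o)} ->
  {within `[a, b], continuous k}.
Proof. by move=> ck; apply: continuous_in_subspaceT => x; rewrite inE => /ck. Qed.

Lemma within_continuousT a b k : continuous (k : R^o -> R^o) ->
  {within `[a, b], continuous k}.
Proof. by move=> ck; exact: continuous_subspaceT. Qed.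

Lemma integrable_segment a b k : {within `[a, b], continuous k} ->
  mu.-integrable `[a, b] (EFin \o k).
Proof. by move=> ck; apply: continuous_compact_integrable => //; exact: segment_compact. Qed.

Lemma Rintegral_segment_cat a b c k : a <= c -> c <= b -> {within `[a, b], continuous k} ->
  \int[mu]_(x in `[a, b]) k x = \int[mu]_(x in `[a, c]) k x + \int[mu]_(x in `[c, b]) k x.
Proof.
move=> ac cb /integrable_segment ik.
have := @Rintegral_itvB _ k (BLeft a) (BRight b) c ik.
rewrite !bnd_simp => /(_ ac cb) /eqP; rewrite subr_eq => /eqP ->.
rewrite addrC; congr (_ + _); apply: Rintegral_itv_obnd_cbnd.
apply: integrableS ik => //; apply: subset_itvr; rewrite bnd_simp//.
Qed.

Lemma Rintegral_segment_shift a b c k : a <= b ->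
  {within `[a + c, b + c], continuous k} ->
  \int[mu]_(x in `[a + c, b + c]) k x = \int[mu]_(x in `[a, b]) k (x + c).
Proof.
move=> ab ck; rewrite /Rintegral; congr fine.
have dF (x : R) : is_derive x 1 (fun x : R => x + c) (1 : R).
  apply: (is_derive_eq (is_deriveD (is_derive_id x 1) (is_derive_cst c x 1))).
  by rewrite addr0.
have DF : derive1 (fun x : R => x + c) = cst 1.
  by apply/funext => x; rewrite derive1E; case: (dF x).
have cF : continuous (fun x : R => x + c).
  by move=> x; apply: cvgD; [exact: cvg_id|exact: cvg_cst].
rewrite (@integration_by_substitution_increasing _ (fun x => x + c) k a b ab)//.
- by apply: eq_integral => x _ /=; rewrite !fctE DF mulr1.
- by move=> x y _ _ xy; rewrite ltrD2r.
- by rewrite DF => ? _; exact: cvg_cst.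
- by rewrite DF; exact: is_cvg_cst.
- by rewrite DF; exact: is_cvg_cst.
- split; first by move=> x _; case: (dF x).
  + exact: cvg_at_right_filter (cF a).
  + exact: cvg_at_left_filter (cF b).
Qed.

Lemma Rintegral_segment_opp a b k : a <= b -> {within `[- b, - a], continuous k} ->
  \int[mu]_(x in `[- b, - a]) k x = \int[mu]_(x in `[a, b]) k (- x).
Proof.
by move=> ab ck; rewrite /Rintegral integration_by_substitution_oppr.
Qed.

(** Parametrizes the heights of the horizontal chords of the unit disc by the angles of their right
    ends. *)
Lemma Rintegral_segment_sin k : {in `[(-1 : R), 1], continuous (k : R^o -> R^o)} ->
  \int[mu]_(y in `[(-1 : R), 1]) k y =
  \int[mu]_(s in `[- (pi / 2), pi / 2]) (k (sin s) * cos s).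
Proof.
move=> ck; rewrite /Rintegral; congr fine.
have p2 : - (pi / 2) <= pi / 2 :> R.
  by rewrite ge0_cp// divr_ge0// pi_ge0.
have DF : derive1 (@sin R) = @cos R.
  by apply/funext => x; rewrite derive1E; case: (is_derive_sin x).
have := @integration_by_substitution_increasing _ (@sin R) k _ _ p2.
rewrite sinN sin_pihalf => -> //.
- by apply: eq_integral => x _ /=; rewrite !fctE DF.
- by move=> x y xi yi xy; rewrite ltr_sin.
- by rewrite DF => x _; exact: continuous_cos.
- rewrite DF; apply/cvg_ex; exists (cos (- (pi / 2))).
  exact: cvg_at_right_filter (@continuous_cos R _).
- rewrite DF; apply/cvg_ex; exists (cos (pi / 2)).
  exact: cvg_at_left_filter (@continuous_cos R _).
- split; first by move=> x _; exact: derivable_sin.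
  + exact: cvg_at_right_filter (@continuous_sin R _).
  + exact: cvg_at_left_filter (@continuous_sin R _).
- exact: within_continuous.
Qed.

Lemma Rintegral_period (k : R -> R) a : - (2 * pi) <= a -> a <= 0 ->
  continuous (k : R^o -> R^o) -> (forall s, k (s + 2 * pi) = k s) ->
  \int[mu]_(s in `[a, a + 2 * pi]) k s = \int[mu]_(s in `[0, 2 * pi]) k s.
Proof.
move=> a1 a0 ck pk.
have h1 : 0 <= a + 2 * pi by rewrite -subr_ge0 opprK addrC in a1 *; lra.
rewrite (@Rintegral_segment_cat a (a + 2 * pi) 0)//; last exact: within_continuousT.
rewrite [RHS](@Rintegral_segment_cat 0 (2 * pi) (a + 2 * pi))//; last 2 first.
- lra.
- exact: within_continuousT.
rewrite [RHS]addrC; congr (_ + _).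
have := @Rintegral_segment_shift a 0 (2 * pi) k a0 (@within_continuousT _ _ _ ck).
by rewrite add0r => ->; apply: eq_Rintegral => s _; rewrite pk.
Qed.

(** Separates the right half of the circle, at angle [s], from the left half, at angle [s + pi]. *)
Lemma Rintegral_half_turn (k : R -> R) :
  continuous (k : R^o -> R^o) -> (forall s, k (s + 2 * pi) = k s) ->
  \int[mu]_(s in `[0, 2 * pi]) k s =
  \int[mu]_(s in `[- (pi / 2), pi / 2]) k s +
  \int[mu]_(s in `[- (pi / 2), pi / 2]) k (s + pi).
Proof.
move=> ck pk; have pi0 := pi_gt0 R.
rewrite -(@Rintegral_period k (- (pi / 2)))//; [|lra|lra].
rewrite (@Rintegral_segment_cat _ _ (pi / 2)); [|lra|lra|exact: within_continuousT].
congr (_ + _).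
have -> : - (pi / 2) + 2 * pi = pi / 2 + pi :> R by lra.
have {1}-> : pi / 2 = - (pi / 2) + pi :> R by lra.
by apply: Rintegral_segment_shift; [lra|exact: within_continuousT].
Qed.

(** The reflection [s -> pi / 2 - s] exchanges [cos] and [sin], and will carry the horizontal case
    of Green's formula to the vertical one. *)
Lemma Rintegral_reflect (k : R -> R) :
  continuous (k : R^o -> R^o) -> (forall s, k (s + 2 * pi) = k s) ->
  \int[mu]_(s in `[0, 2 * pi]) k (pi / 2 - s) = \int[mu]_(s in `[0, 2 * pi]) k s.
Proof.
move=> ck pk; have pi0 := pi_gt0 R.
have ck' c : continuous ((fun s => k (s + c)) : R^o -> R^o).
  move=> s; apply: continuous_comp; last exact: ck.
  by apply: cvgD; [exact: cvg_id|exact: cvg_cst].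
have -> : \int[mu]_(s in `[0, 2 * pi]) k (pi / 2 - s) =
    \int[mu]_(s in `[0, 2 * pi]) (fun s => k (s + pi / 2)) (- s).
  by apply: eq_Rintegral => s _; rewrite addrC.
rewrite -(@Rintegral_segment_opp _ _ (fun s => k (s + pi / 2))); [|lra|exact: within_continuousT].
rewrite -(@Rintegral_segment_shift _ _ (pi / 2) k); [|lra|exact: within_continuousT].
rewrite -(@Rintegral_period k (- (2 * pi) + pi / 2))//; [|lra|lra].
by have -> : - (2 * pi) + pi / 2 + 2 * pi = - 0 + pi / 2 :> R by lra.
Qed.

End Segments.

(** * Green's formula on the unit disc, one coordinate at a time *)

Section DiscGreen.
Variable R : realType.
Local Notation C := R[i].
Local Notation re := (@complex.Re R).
Local Notation im := (@complex.Im R).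
Local Notation mu := (@lebesgue_measure R).
Local Notation mu2 := (mu \x mu)%E.

Definition cis (s : R) : C := cos s +i* sin s.

Lemma sqnorm_cis s : sqnorm (cis s) = 1.
Proof. by rewrite /sqnorm /= cos2Dsin2. Qed.

Lemma cis_continuous : continuous (cis : R^o -> C^o).
Proof. by move=> s; apply: cvg_ReIm; [exact: continuous_cos|exact: continuous_sin]. Qed.

Lemma cisD2pi s : cis (s + 2 * pi) = cis s.
Proof.
have e : s + 2 * pi = s + pi *+ 2 by rewrite mulr2n; ring.
by rewrite /cis e cosD2pi sinD2pi.
Qed.

Lemma continuous_sqnorm : continuous (@sqnorm R : C^o -> R^o).
Proof.
move=> z.
have cr : (fun w : C^o => re w : R^o) @ z --> (re z : R^o) by apply: (@cvg_Re _ _ (nbhs (z : C^o)) _ id); exact: cvg_id.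
have ci : (fun w : C^o => im w : R^o) @ z --> (im z : R^o) by apply: (@cvg_Im _ _ (nbhs (z : C^o)) _ id); exact: cvg_id.
exact: (cvgD (cvgM cr cr) (cvgM ci ci)).
Qed.

Lemma open_unit_disc : open [set z : C^o | sqnorm z < 1].
Proof.
by apply: (@open_comp _ _ (@sqnorm R : C^o -> R^o) [set x : R^o | x < 1]) => [z _|]; 
  [exact: continuous_sqnorm|exact: open_lt].
Qed.

(** [B] will be the trace of a closed subset of the sphere, or the set of singular points of a
    form. *)
Lemma compact_closed_disc (B : set C^o) : closed B ->
  compact [set p : R^o * R^o | B (cplx p) /\ sqnorm (cplx p) <= 1].
Proof.
move=> cB; pose S : set R^o := [set` `[(-1 : R), 1]].
have cS : compact S by exact: segment_compact.
apply: (@subclosed_compact (R^o * R^o)%type _ (S `*` S)).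
- apply: closedI.
    by apply: (@closed_comp _ _ (fun p : R^o * R^o => cplx p : C^o) B) => // p _; exact: cvg_cplx.
  apply: (@closed_comp _ _ (fun p : R^o * R^o => sqnorm (cplx p)) [set x : R^o | x <= 1]).
    move=> p _; apply: (@continuous_comp _ _ _ (fun p : R^o * R^o => cplx p : C^o) (@sqnorm R)).
      exact: cvg_cplx.
    exact: continuous_sqnorm.
  exact: closed_le.
- exact: compact_setX.
- move=> [x y]; rewrite /sqnorm /= => -[_ h]; split; rewrite /S /= in_itv /= -ler_norml.
  + by rewrite -(@ler_pXn2r _ 2) ?nnegrE// expr1n real_normK ?num_real//; nra.
  + by rewrite -(@ler_pXn2r _ 2) ?nnegrE// expr1n real_normK ?num_real//; nra.
Qed.

Lemma closed_disc_bounded (B : set C^o) (k : C -> R) : closed B ->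
  (forall z : C^o, B z -> sqnorm z <= 1 -> {for z, continuous (k : C^o -> R^o)}) ->
  exists M : R, forall z, B z -> sqnorm z <= 1 -> `|k z| <= M.
Proof.
move=> cB ck; pose K := [set p : R^o * R^o | B (cplx p) /\ sqnorm (cplx p) <= 1].
have ckK : {within K, continuous (fun p : R^o * R^o => k (cplx p) : R^o)}.
  apply: continuous_in_subspaceT => p; rewrite inE => -[Bp p1].
  apply: (@continuous_comp _ _ _ (fun p : R^o * R^o => cplx p : C^o) (k : C^o -> R^o)).
    exact: cvg_cplx.
  exact: ck.
have /compact_bounded[M [_ hM]] := continuous_compact ckK (compact_closed_disc cB).
exists (M + 1) => z Bz z1; apply: (hM (M + 1)); first by rewrite ltrDl.
by exists (pair_of z); rewrite /K /= pair_ofK.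
Qed.

Lemma plane_closed_disc_bounded (k : C -> R) :
  (forall z, sqnorm z <= 1 -> {for z, continuous (k : C^o -> R^o)}) ->
  exists M : R, forall z, sqnorm z <= 1 -> `|k z| <= M.
Proof.
move=> ck; have [M hM] := closed_disc_bounded (@closedT C^o) (fun z _ => ck z).
by exists M => z; exact: hM.
Qed.

Lemma unit_disc_finite_measure : (mu2 (@unit_disc R) < +oo)%E.
Proof.
apply: (@le_lt_trans _ _ (mu2 (`[(-1 : R), 1]%classic `*` `[(-1 : R), 1]%classic))).
  apply: le_measure; rewrite ?inE.
  - exact: measurable_unit_disc.
  - by apply: measurableX; exact: measurable_itv.
  - move=> [x y]; rewrite /unit_disc /sqnorm /= => h; split; rewrite /= in_itv /= -ler_norml.
    + by rewrite -(@ler_pXn2r _ 2) ?nnegrE// expr1n real_normK ?num_real//; nra.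
    + by rewrite -(@ler_pXn2r _ 2) ?nnegrE// expr1n real_normK ?num_real//; nra.
rewrite product_measure1E/=; [|exact: measurable_itv..].
have -> : mu [set` `[(-1 : R), 1]] = 2%:E.
  by rewrite lebesgue_measure_itv /= lte_fin ifT -?EFinB; [congr EFin; ring|lra].
by rewrite -EFinM ltry.
Qed.

Section Horizontal.
Variables h hx : C -> R.
Hypothesis dh : forall x y : R, x ^+ 2 + y ^+ 2 <= 1 ->
  is_derive x 1 (fun t : R => h (t +i* y)) (hx (x +i* y)).
Hypothesis ch : forall z, sqnorm z <= 1 -> {for z, continuous (h : C^o -> R^o)}.
Hypothesis chx : forall z, sqnorm z <= 1 -> {for z, continuous (hx : C^o -> R^o)}.

Let rad (y : R) := Num.sqrt (1 - y ^+ 2).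
Let P (y : R) := h (rad y +i* y).
Let N (y : R) := h (- rad y +i* y).

Let radE y : `|y| <= 1 -> rad y ^+ 2 = 1 - y ^+ 2.
Proof.
move=> y1; rewrite sqr_sqrtr// subr_ge0 -real_normK ?num_real//.
by rewrite expr_le1.
Qed.

Let integrable_hx : mu2.-integrable unit_disc (EFin \o (fun p => hx (cplx p))).
Proof.
apply: measurable_bounded_integrable.
- exact: measurable_unit_disc.
- exact: unit_disc_finite_measure.
- apply: (measurable_plane_continuous open_unit_disc) => z /= z1.
  by apply: chx; exact: ltW.
- have [M hM] := plane_closed_disc_bounded chx.
  exists M; split; first exact: num_real.
  by move=> M' MM' p /= p1; apply: le_trans (ltW MM'); apply: hM; exact: ltW.
Qed.

Let continuous_line (k : C -> R) (x y : R) : {for x +i* y, continuous (k : C^o -> R^o)} ->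
  {for x, continuous ((fun t => k (t +i* y)) : R^o -> R^o)}.
Proof.
move=> ck; apply: (@continuous_comp _ _ _ ((fun t => t +i* y) : R^o -> C^o) (k : C^o -> R^o)).
  by apply: cvg_ReIm => /=; [exact: cvg_id|exact: cvg_cst].
exact: ck.
Qed.

(** The fundamental theorem of calculus on the chord at height [y]; for [y] outside [[-1, 1]] the
    chord is empty. *)
Let inner y : (\int[mu]_x (((fun p => (hx (cplx p))%:E) \_ unit_disc) (x, y)) =
  (((fun y => P y - N y) \_ `[(-1 : R), 1]) y)%:E)%E.
Proof.
rewrite patchE; case: ifPn => [|yn]; last first.
  apply: integral0_eq => x _; rewrite patchE; case: ifPn => // /set_mem /= h1.
  case/negP: yn; rewrite inE /= in_itv /= -ler_norml.
  rewrite -(@ler_pXn2r _ 2) ?nnegrE// expr1n real_normK ?num_real//.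
  by move: h1; rewrite /unit_disc /sqnorm /=; nra.
rewrite inE /= in_itv /= -ler_norml => y1.
have r2 := radE y1.
have r0 : 0 <= rad y by exact: sqrtr_ge0.
have discE x : (x, y) \in unit_disc = (x \in `]- rad y, rad y[%classic).
  have e : (x ^+ 2 + y ^+ 2 < 1) = (x \in `]- rad y, rad y[).
    rewrite in_itv /= -ltr_norml.
    by rewrite -[in RHS](@ltr_pXn2r _ 2) ?nnegrE// real_normK ?num_real// r2 ltrBrDr.
  by apply/idP/idP => /set_mem; rewrite /unit_disc /sqnorm /= ?e => h0; apply/mem_set;
    rewrite /unit_disc /sqnorm /= ?e.
pose S : set R := [set` `]- rad y, rad y[].
transitivity (\int[mu]_(x in S) (hx (x +i* y))%:E)%E; rewrite /S.
  by rewrite [RHS]integral_mkcond; apply: eq_integral => x _; rewrite !patchE discE.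
have in_disc x : x \in `[- rad y, rad y] -> x ^+ 2 + y ^+ 2 <= 1.
  rewrite in_itv /= -ler_norml => xr.
  have : `|x| ^+ 2 <= rad y ^+ 2 by rewrite ler_pXn2r ?nnegrE.
  by rewrite real_normK ?num_real// r2; lra.
have ch1 : {within `[- rad y, rad y], continuous (fun x => hx (x +i* y))}.
  apply: within_continuous => x /in_disc xr.
  by apply: continuous_line; apply: chx.
have mh : measurable_fun `]- rad y, rad y[ (fun x => (hx (x +i* y))%:E).
  apply/measurable_EFinP; have := integrable_segment ch1.
  move=> /measurable_int /measurable_EFinP; apply: measurable_funS => //.
  exact: subset_itv_oo_cc.
rewrite -(@integral_itv_bndoo _ _ _ _ true false mh).
(* At the top and bottom of the disc the chord is a point, while the fundamental theorem is stated
   for a proper interval. *)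
have [r00|r00] := eqVneq (rad y) 0.
  by rewrite /P /N r00 oppr0 subrr set_itv1 integral_set1.
have rr : - rad y < rad y by rewrite gtrN// lt_neqAle eq_sym r00.
rewrite (continuous_FTC2 rr ch1 (F := fun x => h (x +i* y))) ?EFinB//.
- split.
  + move=> x /subset_itv_oo_cc /in_disc /dh; by case.
  + apply: cvg_at_right_filter; apply: continuous_line; apply: ch.
    by rewrite /sqnorm /= sqrrN r2 subrK.
  + apply: cvg_at_left_filter; apply: continuous_line; apply: ch.
    by rewrite /sqnorm /= r2 subrK.
- move=> x /subset_itv_oo_cc /in_disc /dh [_ <-].
  by rewrite derive1E.
Qed.

(** Fubini leaves the differences of [h] between the ends of the chords; the substitution
    [y = sin s] turns them into integrals over the two half circles. *)
Lemma green_horizontal : \int[mu2]_(p in unit_disc) hx (cplx p) =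
  \int[mu]_(s in `[0, 2 * pi]) (h (cis s) * cos s).
Proof.
have cc (g : R^o -> C^o) y : {for y, continuous g} -> sqnorm (g y) <= 1 ->
    {for y, continuous ((fun y => h (g y)) : R^o -> R^o)}.
  move=> cg g1; apply: (@continuous_comp _ _ _ g (h : C^o -> R^o)) => //; exact: ch.
have crad : continuous (rad : R^o -> R^o).
  move=> y; apply: (@continuous_comp _ _ _ (fun y : R^o => 1 - y ^+ 2 : R^o) Num.sqrt).
    by apply: cvgB; [exact: cvg_cst|exact: exprn_continuous].
  exact: sqrt_continuous.
have y1 y : y \in `[(-1 : R), 1] -> `|y| <= 1 by rewrite in_itv /= -ler_norml.
have cP : {in `[(-1 : R), 1], continuous (P : R^o -> R^o)}.
  move=> y /y1 yy; apply: (cc (fun y => rad y +i* y)).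
    by apply: cvg_ReIm => /=; [exact: crad|exact: cvg_id].
  by rewrite /sqnorm /= radE// subrK.
have cN : {in `[(-1 : R), 1], continuous (N : R^o -> R^o)}.
  move=> y /y1 yy; apply: (cc (fun y => - rad y +i* y)).
    by apply: cvg_ReIm => /=; [apply: cvgN; exact: crad|exact: cvg_id].
  by rewrite /sqnorm /= sqrrN radE// subrK.
have e1 : \int[mu2]_(p in unit_disc) hx (cplx p) =
    \int[mu]_(y in `[(-1 : R), 1]) (P y - N y).
  rewrite [RHS]Rintegral_mkcond /Rintegral; congr fine.
  rewrite [LHS]integral_mkcond.
  have := integrable_hx; rewrite integrable_mkcond; last exact: measurable_unit_disc.
  move=> ii.
  rewrite -(integral21_prod_meas1 ii); apply: eq_integral => y _.
  exact: inner.
have iP := integrable_segment (within_continuous cP).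
have iN := integrable_segment (within_continuous cN).
rewrite e1 RintegralB//.
have cN' : {in `[(-1 : R), 1], continuous ((fun y => N (- y)) : R^o -> R^o)}.
  move=> y yy; apply: (@continuous_comp _ _ _ (fun y : R^o => - y : R^o) (N : R^o -> R^o)).
    exact: opp_continuous.
  by apply: cN; move: yy; rewrite !in_itv /= lerN2 lerNl andbC.
(* The left end at angle [s + pi] has height [- sin s], whence the reflection of [y]. *)
have -> : \int[mu]_(y in `[(-1 : R), 1]) N y = \int[mu]_(y in `[(-1 : R), 1]) N (- y).
  have l1 : -1 <= 1 :> R by lra.
  have := @Rintegral_segment_opp R (-1) 1 N l1; rewrite opprK; apply.
  exact: within_continuous.
rewrite !Rintegral_segment_sin//.
pose k s := h (cis s) * cos s.
have ck : continuous (k : R^o -> R^o).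
  move=> s; apply: cvgM; last exact: continuous_cos.
  by apply: cc; [exact: cis_continuous|rewrite sqnorm_cis].
rewrite (@Rintegral_half_turn _ k)//; last first.
  by move=> s; rewrite /k cisD2pi; congr (_ * _); have := cisD2pi s; case.
have cosE (s : R) : s \in `[- (pi / 2), pi / 2] -> rad (sin s) = cos s.
  rewrite in_itv /= => si; rewrite /rad -cos2sin2 sqrtr_sqr ger0_norm//.
  exact: cos_ge0_pihalf.
congr (_ + _); first by apply: eq_Rintegral => s; rewrite inE /= => si; rewrite /k /P cosE.
have ckpi : continuous ((fun s => N (- sin s) * cos s) : R^o -> R^o).
  move=> s; apply: cvgM; last exact: continuous_cos.
  apply: (@continuous_comp _ _ _ (@sin R) (fun y : R^o => N (- y) : R^o)).
    exact: continuous_sin.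
  by apply: cN'; rewrite in_itv /= sin_geN1 sin_le1.
rewrite -mulN1r -RintegralZl//; last first.
  by apply: integrable_segment; exact: within_continuousT.
apply: eq_Rintegral => s; rewrite inE /= => si.
rewrite mulN1r -mulrN /k /N /cis; have := @cosDpi R s; have := @sinDpi R s => -> ->.
have : rad (- sin s) = cos s by rewrite -(cosE s si) /rad sqrrN.
by move=> ->.
Qed.

End Horizontal.
End DiscGreen.

Section RealIntegrable.
Context d (T : measurableType d) (R : realType) (mu : {measure set T -> \bar R}).
Variables (D : set T) (f g : T -> R).
Hypothesis mD : measurable D.

Lemma integrable_addR : mu.-integrable D (EFin \o f) -> mu.-integrable D (EFin \o g) ->
  mu.-integrable D (EFin \o (fun x => f x + g x)).
Proof. by move=> hf hg; have := integrableD mD hf hg; apply: eq_integrable. Qed.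

Lemma integrable_subR : mu.-integrable D (EFin \o f) -> mu.-integrable D (EFin \o g) ->
  mu.-integrable D (EFin \o (fun x => f x - g x)).
Proof. by move=> hf hg; have := integrableB mD hf hg; apply: eq_integrable. Qed.

End RealIntegrable.

(** * The complex form of Green's formula on the unit disc *)

Section DiscGreenComplex.
Variable R : realType.
Local Notation C := R[i].
Local Notation re := (@complex.Re R).
Local Notation im := (@complex.Im R).
Local Notation mu := (@lebesgue_measure R).
Local Notation mu2 := (mu \x mu)%E.

Definition cint2 (A : set (R * R)) (f : C -> C) : C :=
  (\int[mu2]_(p in A) re (f (cplx p))) +i* (\int[mu2]_(p in A) im (f (cplx p))).

Definition cint1 (f : R -> C) : C :=
  (\int[mu]_(s in `[0%R, 2 * pi]) re (f s)) +i* (\int[mu]_(s in `[0%R, 2 * pi]) im (f s)).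

Lemma integrable_unit_disc (k : C -> R) :
  (forall z, sqnorm z <= 1 -> {for z, continuous (k : C^o -> R^o)}) ->
  mu2.-integrable unit_disc (EFin \o (fun p => k (cplx p))).
Proof.
move=> ck; apply: measurable_bounded_integrable.
- exact: measurable_unit_disc.
- exact: unit_disc_finite_measure.
- apply: (measurable_plane_continuous (@open_unit_disc R)) => z /= z1.
  by apply: ck; exact: ltW.
- have [M hM] := plane_closed_disc_bounded ck.
  exists M; split; first exact: num_real.
  by move=> M' MM' p /= p1; apply: le_trans (ltW MM'); apply: hM; exact: ltW.
Qed.

(** Exchanging the two coordinates reduces this to [green_horizontal]. *)
Lemma green_vertical (h hy : C -> R) :
  (forall x y : R, x ^+ 2 + y ^+ 2 <= 1 ->
    is_derive y 1 (fun t : R => h (x +i* t)) (hy (x +i* y))) ->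
  (forall z, sqnorm z <= 1 -> {for z, continuous (h : C^o -> R^o)}) ->
  (forall z, sqnorm z <= 1 -> {for z, continuous (hy : C^o -> R^o)}) ->
  \int[mu2]_(p in unit_disc) hy (cplx p) =
  \int[mu]_(s in `[0, 2 * pi]) (h (cis s) * sin s).
Proof.
move=> dh ch chy.
pose sw (z : C) : C := im z +i* re z.
have csw z : {for z, continuous (sw : C^o -> C^o)}.
  have h1 : (fun w : C^o => im w : R^o) @ (z : C^o) --> (im z : R^o).
    by apply: (@cvg_Im _ _ (nbhs (z : C^o)) _ id); exact: cvg_id.
  have h2 : (fun w : C^o => re w : R^o) @ (z : C^o) --> (re z : R^o).
    by apply: (@cvg_Re _ _ (nbhs (z : C^o)) _ id); exact: cvg_id.
  exact: (@cvg_ReIm _ _ (nbhs (z : C^o)) _ sw (sw z) h1 h2).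
have nsw z : sqnorm (sw z) = sqnorm z by rewrite /sqnorm /= addrC.
have csw' (k : C -> R) : (forall z, sqnorm z <= 1 -> {for z, continuous (k : C^o -> R^o)}) ->
    forall z, sqnorm z <= 1 -> {for z, continuous ((k \o sw) : C^o -> R^o)}.
  move=> ck z z1; apply: (@continuous_comp _ _ _ (sw : C^o -> C^o) (k : C^o -> R^o)).
    exact: csw.
  by apply: ck; rewrite nsw.
have dsw (x y : R) : x ^+ 2 + y ^+ 2 <= 1 ->
    is_derive x 1 (fun t : R => (h \o sw) (t +i* y)) ((hy \o sw) (x +i* y)).
  by rewrite addrC => xy; exact: (dh y x xy).
have := @green_horizontal _ (h \o sw) (hy \o sw) dsw (csw' _ ch) (csw' _ chy).
have -> : \int[mu2]_(p in unit_disc) (hy \o sw) (cplx p) =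
    \int[mu2]_(p in unit_disc) hy (cplx p).
  rewrite Rintegral_mkcond [RHS]Rintegral_mkcond.
  have mk : measurable_fun setT ((fun p => hy (cplx p)) \_ unit_disc).
    apply/(measurable_restrictT _ (@measurable_unit_disc R)).
    have := measurable_int _ (integrable_unit_disc chy).
    by move=> /measurable_EFinP.
  rewrite (Rintegral_change (@change_of_var_swap R) mk); apply: eq_Rintegral => p _.
  rewrite mulr1 !patch_asbool.
  by congr (if _ then _ else _); apply: asbool_equiv_eq; rewrite /unit_disc /= /sqnorm /= addrC.
move=> ->.
pose k s := h (cis s) * sin s.
have ck : continuous (k : R^o -> R^o).
  move=> s; apply: cvgM; last exact: continuous_sin.
  apply: (@continuous_comp _ _ _ (@cis R : R^o -> C^o) (h : C^o -> R^o)).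
    exact: cis_continuous.
  by apply: ch; rewrite sqnorm_cis.
rewrite -(@Rintegral_reflect _ k)//; last first.
  by move=> s; rewrite /k cisD2pi; congr (_ * _); have := cisD2pi s; case.
apply: eq_Rintegral => s _; rewrite /k /= /cis.
by rewrite sinB cosB sin_pihalf cos_pihalf !mul1r !mul0r add0r subr0.
Qed.

Let re_half (a b : C) : re ((a + 'i%C * b) / 2) = 2^-1 * (re a - im b).
Proof.
have -> : (2 : C)^-1 = (2^-1)%:C by rewrite fmorphV rmorph_nat.
by rewrite mulrC ReM ReC ImC mul0r subr0 ReD ReM /= mul0r mul1r sub0r.
Qed.

Let im_half (a b : C) : im ((a + 'i%C * b) / 2) = 2^-1 * (im a + re b).
Proof.
have -> : (2 : C)^-1 = (2^-1)%:C by rewrite fmorphV rmorph_nat.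
by rewrite mulrC ImM ReC ImC mul0r addr0 ImD ImM /= mul0r mul1r add0r.
Qed.

Let re_icis (a : C) s : re (a * ('i%C * cis s)) = -1 * (im a * cos s + re a * sin s).
Proof. by rewrite ReM ImM ReM /=; ring. Qed.

Let im_icis (a : C) s : im (a * ('i%C * cis s)) = re a * cos s - im a * sin s.
Proof. by rewrite ImM ImM ReM /=; ring. Qed.

Let two_i_half (a b : R) : 2 * 'i%C * ((2^-1 * a) +i* (2^-1 * b)) = - b +i* a.
Proof.
have -> : (2 : C) = 2%:C by rewrite rmorph_nat.
by apply: complex_ext; rewrite !(ReM, ImM) /=; field.
Qed.

(** The horizontal and vertical formulas are combined for both parts of [G], as [dbar] is half of
    the derivative along [1] plus [i] times that along [i]; [i cis s] is the velocity of the
    boundary circle. *)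
Lemma green_disc (G : C -> C) : (forall z, sqnorm z <= 1 -> Ck_at 1 (z : C^o) G) ->
  2 * 'i%C * cint2 unit_disc (dbar (1 : C^o) G) = cint1 (fun s => G (cis s) * ('i%C * cis s)).
Proof.
move=> HG.
pose Gx := ddir (1 : C^o) G; pose Gy := ddir ('i%C *: (1 : C^o)) G.
have cG z : sqnorm z <= 1 -> {for z, continuous (G : C^o -> C^o)}.
  by move=> /HG /Ck_at_continuous.
have cGx z : sqnorm z <= 1 -> {for z, continuous (Gx : C^o -> C^o)}.
  by move=> /HG /(Ck_at_ddir (1 : C^o)) /Ck_at_continuous.
have cGy z : sqnorm z <= 1 -> {for z, continuous (Gy : C^o -> C^o)}.
  by move=> /HG /(Ck_at_ddir ('i%C *: (1 : C^o))) /Ck_at_continuous.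
have cr (k : C -> C) : (forall z, sqnorm z <= 1 -> {for z, continuous (k : C^o -> C^o)}) ->
    forall z, sqnorm z <= 1 -> {for z, continuous ((re \o k) : C^o -> R^o)}.
  by move=> ck z z1; exact: (@cvg_Re _ _ (nbhs (z : C^o)) _ k (k z) (ck z z1)).
have ci (k : C -> C) : (forall z, sqnorm z <= 1 -> {for z, continuous (k : C^o -> C^o)}) ->
    forall z, sqnorm z <= 1 -> {for z, continuous ((im \o k) : C^o -> R^o)}.
  by move=> ck z z1; exact: (@cvg_Im _ _ (nbhs (z : C^o)) _ k (k z) (ck z z1)).
have dx (x y : R) : x ^+ 2 + y ^+ 2 <= 1 -> is_cderive (fun t => G (t +i* y)) x (Gx (x +i* y)).
  move=> xy; have h := Ck_at_is_cderive (1 : C^o) (HG (x +i* y) xy).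
  have := @is_cderive_along_shift R C^o G (1 : C^o) (0 +i* y) x (Gx (x +i* y)).
  have e (t : R) : (0 +i* y : C^o) + t%:C *: (1 : C^o) = t +i* y.
    transitivity ((0 +i* y) + t%:C * 1 : C); first by [].
    by apply: complex_ext; rewrite mulr1 ?ReD ?ImD ?ReC ?ImC ?add0r ?addr0.
  rewrite e => /(_ h); congr (is_cderive _ _ _); apply/funext => t.
  by rewrite /along e.
have dy (x y : R) : x ^+ 2 + y ^+ 2 <= 1 -> is_cderive (fun t => G (x +i* t)) y (Gy (x +i* y)).
  move=> xy; have h := Ck_at_is_cderive ('i%C *: (1 : C^o)) (HG (x +i* y) xy).
  have := @is_cderive_along_shift R C^o G ('i%C *: (1 : C^o)) (x +i* 0) y (Gy (x +i* y)).
  have e (t : R) : (x +i* 0 : C^o) + t%:C *: ('i%C *: (1 : C^o)) = x +i* t.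
    transitivity ((x +i* 0) + t%:C * ('i%C * 1) : C); first by [].
    by apply: complex_ext; rewrite mulr1 ?ReD ?ImD ?ReM ?ImM ?ReC ?ImC /= ?(mul0r, mulr0, mulr1, add0r, addr0, subr0).
  rewrite e => /(_ h); congr (is_cderive _ _ _); apply/funext => t.
  by rewrite /along e.
have h1 := @green_horizontal _ (re \o G) (re \o Gx) (fun x y xy => (dx x y xy).1) (cr _ cG) (cr _ cGx).
have h2 := @green_horizontal _ (im \o G) (im \o Gx) (fun x y xy => (dx x y xy).2) (ci _ cG) (ci _ cGx).
have v1 := @green_vertical (re \o G) (re \o Gy) (fun x y xy => (dy x y xy).1) (cr _ cG) (cr _ cGy).
have v2 := @green_vertical (im \o G) (im \o Gy) (fun x y xy => (dy x y xy).2) (ci _ cG) (ci _ cGy).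
have i1 := integrable_unit_disc (cr _ cGx).
have i2 := integrable_unit_disc (ci _ cGx).
have j1 := integrable_unit_disc (cr _ cGy).
have j2 := integrable_unit_disc (ci _ cGy).
have cc (f : C -> R) : (forall z, sqnorm z <= 1 -> {for z, continuous (f : C^o -> R^o)}) ->
    continuous ((fun s => f (cis s)) : R^o -> R^o).
  move=> cf s; apply: (@continuous_comp _ _ _ (@cis R : R^o -> C^o) (f : C^o -> R^o)).
    exact: cis_continuous.
  by apply: cf; rewrite sqnorm_cis.
have int1 (f : C -> R) (t : R -> R) :
    (forall z, sqnorm z <= 1 -> {for z, continuous (f : C^o -> R^o)}) ->
    continuous (t : R^o -> R^o) ->
    mu.-integrable `[0, 2 * pi] (EFin \o (fun s => f (cis s) * t s)).
  move=> cf ct; apply: integrable_segment; apply: within_continuousT => s.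
  by apply: cvgM; [exact: cc|exact: ct].
pose gr s := re (G (cis s)); pose gi s := im (G (cis s)).
have rc := int1 _ _ (cr _ cG) (@continuous_cos R).
have rs := int1 _ _ (cr _ cG) (@continuous_sin R).
have ic := int1 _ _ (ci _ cG) (@continuous_cos R).
have is_ := int1 _ _ (ci _ cG) (@continuous_sin R).
have reE p : re (dbar (1 : C^o) G (cplx p)) =
    2^-1 * (re (Gx (cplx p)) - im (Gy (cplx p))).
  by apply: re_half.
have imE p : im (dbar (1 : C^o) G (cplx p)) =
    2^-1 * (im (Gx (cplx p)) + re (Gy (cplx p))).
  by apply: im_half.
have mD := @measurable_unit_disc R.
have A1 : \int[mu2]_(p in unit_disc) re (dbar (1 : C^o) G (cplx p)) =
    2^-1 * (\int[mu]_(s in `[0, 2 * pi]) (gr s * cos s) -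
      \int[mu]_(s in `[0, 2 * pi]) (gi s * sin s)).
  rewrite -h1 -v2 -RintegralB// -RintegralZl//; last exact: integrable_subR.
  by apply: eq_Rintegral => p _; rewrite reE.
have A2 : \int[mu2]_(p in unit_disc) im (dbar (1 : C^o) G (cplx p)) =
    2^-1 * (\int[mu]_(s in `[0, 2 * pi]) (gi s * cos s) +
      \int[mu]_(s in `[0, 2 * pi]) (gr s * sin s)).
  rewrite -h2 -v1 -RintegralD// -RintegralZl//; last exact: integrable_addR.
  by apply: eq_Rintegral => p _; rewrite imE.
have B1 : \int[mu]_(s in `[0%R, 2 * pi]) re (G (cis s) * ('i%C * cis s)) =
    - (\int[mu]_(s in `[0, 2 * pi]) (gi s * cos s) +
      \int[mu]_(s in `[0, 2 * pi]) (gr s * sin s)).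
  rewrite -RintegralD// -mulN1r -RintegralZl//; last exact: integrable_addR.
  by apply: eq_Rintegral => s _; rewrite re_icis.
have B2 : \int[mu]_(s in `[0%R, 2 * pi]) im (G (cis s) * ('i%C * cis s)) =
    \int[mu]_(s in `[0, 2 * pi]) (gr s * cos s) -
      \int[mu]_(s in `[0, 2 * pi]) (gi s * sin s).
  rewrite -RintegralB//; by apply: eq_Rintegral => s _; rewrite im_icis.
rewrite /cint2 /cint1 A1 A2 B1 B2; exact: two_i_half.
Qed.

End DiscGreenComplex.

(** * The chain rule for Wirtinger derivatives *)

Section CompAt.
Variable R : realType.
Local Notation C := R[i].
Local Notation re := (@complex.Re R).
Local Notation im := (@complex.Im R).
Variable W : normedModType C.

Lemma open_comp_nbhs (O : set W) (p : W -> C) (A : set C^o) : open O -> open A ->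
  (forall z, O z -> {for z, continuous (p : W -> C^o)}) ->
  open (O `&` p @^-1` A).
Proof.
move=> oO oA cp; rewrite openE => z [Oz Apz].
have h : nbhs z (p @^-1` A) by apply: (cp z Oz); exact: open_nbhs_nbhs.
by apply: filterI => //; exact: open_nbhs_nbhs.
Qed.

Lemma Ck_at_comp1 n (f : C^o -> C) (p : W -> C) z : Ck_at n (p z : C^o) f -> Ck_at n z p ->
  Ck_at n z (fun w => f (p w)).
Proof.
move=> [A [ oA Az Hf]] [ O [ oO Oz Hp]].
have oB : open (O `&` p @^-1` A).
  by apply: open_comp_nbhs => // w Ow; exact: Ck_continuous Hp Ow.
exists (O `&` p @^-1` A); split => //.
apply: (@Ck_comp1 _ _ n f p A (O `&` p @^-1` A)) => //; first by move=> w [].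
by apply: Ck_sub Hp => w [].
Qed.

Lemma smooth_at_comp2 (f : C^o * C^o -> C) (p q : W -> C) :
  (forall w, smooth_at w f) -> (forall z, smooth_at z p) -> (forall z, smooth_at z q) ->
  forall z, smooth_at z (fun w => f (p w, q w)).
Proof.
move=> Hf Hp Hq z.
have [A [ oA Az HfA]] := Hf (p z, q z).
have [ O [ oO Oz HpO]] := Hp z; have [ O' [ oO' Oz' HqO]] := Hq z.
pose B := (O `&` O') `&` (fun w => (p w, q w)) @^-1` A.
have oB : open B.
  rewrite openE => w [[Ow O'w] Aw].
  have h : nbhs w ((fun w => (p w, q w)) @^-1` A).
    have c : (fun w => (p w : C^o, q w : C^o)) @ w --> (p w : C^o, q w : C^o).
      have cp : (p : W -> C^o) @ w --> (p w : C^o) by exact: Ck_continuous (HpO 0) Ow.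
      have cq : (q : W -> C^o) @ w --> (q w : C^o) by exact: Ck_continuous (HqO 0) O'w.
      exact: cvg_pair cp cq.
    by apply: (c A); apply: open_nbhs_nbhs; split.
  by apply: filterI => //; apply: filterI; exact: open_nbhs_nbhs.
exists B; split => // n.
apply: (@Ck_comp2 _ _ n f p q A B) => //; first by move=> w [].
- by apply: Ck_sub (HpO n) => w [[]].
- by apply: Ck_sub (HqO n) => w [[]].
Qed.

Lemma ddir_comp1 (f : C^o -> C) (p : W -> C) d z : Ck_at 1 (p z : C^o) f -> Ck_at 1 z p ->
  ddir d (fun w => f (p w)) z =
  (re (ddir d p z))%:C * ddir (1 : C^o) f (p z) +
  (im (ddir d p z))%:C * ddir ('i%C *: (1 : C^o)) f (p z).
Proof.
move=> [A [ oA Az Hf]] [ O [ oO Oz Hp]].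
have oB : open (O `&` p @^-1` A).
  by apply: open_comp_nbhs => // w Ow; exact: Ck_continuous Hp Ow.
have pB w : (O `&` p @^-1` A) w -> A (p w) by case.
have Hp' : Ck 1 (O `&` p @^-1` A) p by apply: Ck_sub Hp => w [].
have Bz : (O `&` p @^-1` A) z by [].
have -> : 'i%C *: (1 : C^o) = 'i%C :> C^o by exact: mulr1.
exact: along_cderive_congr (is_cderive_comp1 d oA oB pB Hf Hp' Bz).
Qed.

Let comp_alg (i p q a b x y u v : C) : i * i = -1 -> (p + i * q) / 2 = 0 -> p = a + i * b ->
  q = u + i * v -> u = - b -> v = a ->
  ((a * x + b * y) + i * (u * x + v * y)) / 2 = (a - i * b) * ((x + i * y) / 2) /\
  ((a * x + b * y) - i * (u * x + v * y)) / 2 = ((p - i * q) / 2) * ((x - i * y) / 2).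
Proof.
move=> ii _ -> -> -> ->; split.
  have -> : (a - i * b) * ((x + i * y) / 2) =
    (a * x - (i * i) * (b * y) + i * (a * y - b * x)) / 2 by field.
  by rewrite ii; field.
have -> : (a + i * b - i * (- b + i * a)) / 2 * ((x - i * y) / 2) =
   ((a - i * i * a + 2 * (i * b)) * (x - i * y)) / 4 by field.
rewrite ii.
have -> : (a - -1 * a + 2 * (i * b)) * (x - i * y) =
   2 * (a * x - i * a * y + i * b * x - (i * i) * b * y) by ring.
by rewrite ii; field.
Qed.

(** When [p] satisfies the Cauchy-Riemann equation in the direction [d], the real chain rule splits
    into multiplication by [dhol d p z] and by its conjugate. *)
Lemma dholbar_comp1 (f : C^o -> C) (p : W -> C) d z :
  Ck_at 1 (p z : C^o) f -> Ck_at 1 z p -> dbar d p z = 0 ->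
  dbar d (fun w => f (p w)) z = conjc (dhol d p z) * dbar (1 : C^o) f (p z) /\
  dhol d (fun w => f (p w)) z = dhol d p z * dhol (1 : C^o) f (p z).
Proof.
move=> Hf Hp; rewrite /dhol /dbar !(ddir_comp1 _ Hf Hp).
move: (ddir d p z) (ddir ('i%C *: d) p z) (ddir (1 : C^o) f (p z))
  (ddir ('i%C *: (1 : C^o)) f (p z)) => P Q x y PQ.
have ii : 'i%C * 'i%C = -1 :> C by rewrite -expr2 sqr_i.
(* The Cauchy-Riemann equation for [p], solved for the derivative along [i d]. *)
have QE : Q = 'i%C * P.
  have : P + 'i%C * Q = 0.
    by apply: (mulIf (x := 2^-1)); rewrite ?mul0r// invr_neq0// pnatr_eq0.
  move=> h; have : 'i%C * (P + 'i%C * Q) = 0 by rewrite h mulr0.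
  rewrite mulrDr mulrA ii mulN1r => /eqP; rewrite subr_eq0 => /eqP <-; exact.
have u : re Q = - im P by rewrite QE ReM /= mul0r mul1r sub0r.
have v : im Q = re P by rewrite QE ImM /= mul0r mul1r add0r.
have [e1 e2] := @comp_alg 'i%C P Q (re P)%:C (im P)%:C x y (re Q)%:C (im Q)%:C
  ii PQ (complexE P) (complexE Q) (ltac:(by rewrite u rmorphN)) (ltac:(by rewrite v)).
split; last exact: e2.
rewrite e1; congr (_ * _).
have -> : P - 'i%C * Q = 2 * P.
  by rewrite QE mulrA ii; ring.
have -> : 2 * P / 2 = P by field.
have Ri : re 'i%C = 0 by []. have Ii : im 'i%C = 1 by [].
by rewrite [in RHS](complexE P); apply: complex_ext;
  rewrite !(Re_conjc, Im_conjc, ReD, ImD, ReN, ImN, ReM, ImM) Ri Ii ReC ImC; ring.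
Qed.

Lemma dbar_comp1 (f : C^o -> C) (p : W -> C) d z :
  Ck_at 1 (p z : C^o) f -> Ck_at 1 z p -> dbar d p z = 0 ->
  dbar d (fun w => f (p w)) z = conjc (dhol d p z) * dbar (1 : C^o) f (p z).
Proof. by move=> Hf Hp /(dholbar_comp1 Hf Hp)[]. Qed.

Lemma dhol_comp1 (f : C^o -> C) (p : W -> C) d z :
  Ck_at 1 (p z : C^o) f -> Ck_at 1 z p -> dbar d p z = 0 ->
  dhol d (fun w => f (p w)) z = dhol d p z * dhol (1 : C^o) f (p z).
Proof. by move=> Hf Hp /(dholbar_comp1 Hf Hp)[]. Qed.

Lemma ddirV d z (f : W -> C) : f z != 0 -> Ck_at 1 z f ->
  ddir d (fun w => (f w)^-1) z = - (ddir d f z / f z ^+ 2).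
Proof.
move=> f0 Hf; apply: along_cderive_congr.
by have := @is_cderiveV _ _ _ _ _ (Ck_at_is_cderive d Hf); rewrite !along0; apply.
Qed.

Lemma dholV d z (f : W -> C) : f z != 0 -> Ck_at 1 z f ->
  dhol d (fun w => (f w)^-1) z = - (dhol d f z / f z ^+ 2).
Proof. by move=> f0 Hf; rewrite /dhol !ddirV//; ring. Qed.

Lemma dbarV d z (f : W -> C) : f z != 0 -> Ck_at 1 z f ->
  dbar d (fun w => (f w)^-1) z = - (dbar d f z / f z ^+ 2).
Proof. by move=> f0 Hf; rewrite /dbar !ddirV//; ring. Qed.

End CompAt.

(** * Wirtinger derivatives of affine maps and of the inversion *)

Section Identity.
Variable R : realType.
Local Notation C := R[i].

Lemma is_cderive_line (d z : C) (s : R) : is_cderive (fun s : R => z + s%:C * d) s d.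
Proof.
have h := is_cderive_real (is_derive_id s (1 : R)).
have := is_cderiveD (is_cderive_cst z s) (is_cderiveM h (is_cderive_cst d s)).
by rewrite mulr0 addr0 add0r mul1r.
Qed.

Lemma ddir_id (d z : C^o) : ddir d (fun w : C^o => w : C) z = d.
Proof. by apply: along_cderive_congr; exact: is_cderive_line. Qed.

Lemma smooth_at_id (z : C^o) : smooth_at z (fun w : C^o => w : C).
Proof.
exists setT; split => //; first exact: openT.
case=> [|n]; first by split => // w _; exact: cvg_id.
split; first by move=> w _; exact: cvg_id.
move=> d; split; first by move=> w _; exact: is_cderive_diff (is_cderive_line d w 0).
by apply: (Ck_ext openT _ (Ck_cst n (d : C) openT)) => w _; rewrite ddir_id.
Qed.

Lemma dhol_id (z : C^o) : dhol (1 : C^o) (fun w : C^o => w : C) z = 1.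
Proof.
rewrite /dhol !ddir_id.
have -> : 'i%C * ('i%C *: (1 : C^o)) = -1 :> C.
  by rewrite [_ *: _]mulr1 -expr2 sqr_i.
by have -> : (1 - -1) / 2 = 1 :> C by field.
Qed.

Lemma dbar_id (z : C^o) : dbar (1 : C^o) (fun w : C^o => w : C) z = 0.
Proof.
rewrite /dbar !ddir_id.
have -> : 'i%C * ('i%C *: (1 : C^o)) = -1 :> C.
  by rewrite [_ *: _]mulr1 -expr2 sqr_i.
by rewrite subrr mul0r.
Qed.

Section Affine.
Variables (a b : C).
Let f (w : C^o) : C := a * w + b.

Lemma smooth_at_affine (z : C^o) : smooth_at z f.
Proof.
apply: smooth_atD (smooth_at_cst _ _).
by apply: smooth_atM (smooth_at_cst _ _) _; exact: smooth_at_id.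
Qed.

Lemma dhol_affine (z : C^o) : dhol (1 : C^o) f z = a.
Proof.
have H1 := smooth_Ck_at 1 (smooth_at_id z).
have Ha := Ck_at_cst 1 z a.
rewrite (dholD _ (Ck_atM Ha H1) (Ck_at_cst 1 z b)) (dholM _ Ha H1).
by rewrite !dhol_cst mul0r add0r addr0 dhol_id mulr1.
Qed.

Lemma dbar_affine (z : C^o) : dbar (1 : C^o) f z = 0.
Proof.
have H1 := smooth_Ck_at 1 (smooth_at_id z).
have Ha := Ck_at_cst 1 z a.
rewrite (dbarD _ (Ck_atM Ha H1) (Ck_at_cst 1 z b)) (dbarM _ Ha H1).
by rewrite !dbar_cst mul0r add0r addr0 dbar_id mulr0.
Qed.

End Affine.

Lemma smooth_at_inv (z : C^o) : z != 0 -> smooth_at z (fun w : C^o => w^-1 : C).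
Proof. by move=> z0; apply: smooth_atV => //; exact: smooth_at_id. Qed.

Lemma dhol_inv (z : C^o) : z != 0 -> dhol (1 : C^o) (fun w : C^o => w^-1 : C) z = - z ^- 2.
Proof.
move=> z0; rewrite (dholV _ z0 (smooth_Ck_at 1 (smooth_at_id z))) dhol_id.
by rewrite mul1r.
Qed.

Lemma dbar_inv (z : C^o) : z != 0 -> dbar (1 : C^o) (fun w : C^o => w^-1 : C) z = 0.
Proof.
move=> z0; rewrite (dbarV _ z0 (smooth_Ck_at 1 (smooth_at_id z))) dbar_id.
by rewrite mul0r oppr0.
Qed.

End Identity.

(** * Exceptional angles on the unit circle *)

Section CircleNull.
Variable R : realType.
Local Notation C := R[i].
Local Notation re := (@complex.Re R).
Local Notation im := (@complex.Im R).
Local Notation mu := (@lebesgue_measure R).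

(** The cosine is injective on [[0, pi]] and symmetric under [s -> 2 pi - s]. Applied to the real
    part of the pole, this discards the angle at which a boundary circle passes through infinity. *)
Lemma cos_eq_two_points (x : R) : exists s1 s2 : R, forall s, s \in `[0, 2 * pi] ->
  cos s = x -> s = s1 \/ s = s2.
Proof.
have pi0 := pi_gt0 R.
have [s1 h1] : exists s1 : R, forall s, s \in `[0, pi] -> cos s = x -> s = s1.
  have [[s1 [i1 e1]]|n] := pselect (exists s1, s1 \in `[0, pi] /\ cos s1 = x); last first.
    by exists 0 => s si e; case: n; exists s.
  by exists s1 => s si e; apply: cos_inj => //; rewrite e.
exists s1, (2 * pi - s1) => s; rewrite in_itv /= => /andP[s0 s2] e.
have [sp|sp] := leP s pi; first by left; apply: h1 => //; rewrite in_itv /= s0.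
right; suff : 2 * pi - s = s1 by lra.
apply: h1; first by rewrite in_itv /=; apply/andP; split; lra.
rewrite -e -cosN opprB.
have -> : s - 2 * pi = s - pi *+ 2 by rewrite mulr2n; ring.
by rewrite -[in RHS](subrK (pi *+ 2) s) cosD2pi.
Qed.

Lemma Rintegral_off_two_points (D : set R) (f g : R -> R) (s1 s2 : R) : measurable D ->
  measurable_fun D g -> (forall s, D s -> s != s1 -> s != s2 -> f s = g s) ->
  \int[mu]_(s in D) f s = \int[mu]_(s in D) g s.
Proof.
move=> mD mg fg.
have mh := (measurable_restrictT _ mD).1 mg.
rewrite Rintegral_mkcond [RHS]Rintegral_mkcond; set h := g \_ D in mh *.
have e : f \_ D = fun s => if s == s1 then (f \_ D) s1 else
    if s == s2 then (f \_ D) s2 else h s.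
  apply/funext => s; have [->//|n1] := eqVneq s s1; have [->//|n2] := eqVneq s s2.
  rewrite /h !patchE; case: ifPn => // /set_mem Ds; exact: fg.
have me (c : R) : measurable_fun setT (fun s : R => s == c).
  exact: (@measurable_fun_eqr _ _ R setT id (cst c)).
rewrite /Rintegral; congr fine; apply: ae_eq_integral => //.
- apply/measurable_EFinP; rewrite e; apply: measurable_fun_ifT => //; first exact: me.
  by apply: measurable_fun_ifT => //; exact: me.
- exact/measurable_EFinP.
exists ([set s1] `|` [set s2]); split.
- by apply: measurableU; exact: measurable_set1.
- apply: null_set_setU; [exact: measurable_set1..| |]; exact: lebesgue_measure_set1.
- move=> s /= hs; have [->|n1] := eqVneq s s1; first by left.
  have [->|n2] := eqVneq s s2; first by right.
  by case: hs => _; rewrite e (negbTE n1) (negbTE n2).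
Qed.

Lemma cint1_off (m : 'M[C]_2) (f g : R -> C) : m \in unitmx ->
  measurable_fun `[0, 2 * pi] (fun s => re (g s)) ->
  measurable_fun `[0, 2 * pi] (fun s => im (g s)) ->
  (forall s, mden m (cis s) != 0 -> f s = g s) -> cint1 f = cint1 g.
Proof.
move=> um mr mi fg.
have [s1 [s2 h]] := cos_eq_two_points (re (- m 1 1 / m 1 0)).
have d0 s : `[0, 2 * pi]%classic s -> s != s1 -> s != s2 -> f s = g s.
  move=> si n1 n2; apply: fg; apply/negP => /eqP d0.
  have := mden_eq0 (cdet0 um d0) d0 => e.
  have := h s si; rewrite -e => /(_ erefl) [] e'.
    by rewrite e' eqxx in n1.
  by rewrite e' eqxx in n2.
by rewrite /cint1; congr (_ +i* _); apply: (@Rintegral_off_two_points _ _ _ s1 s2) => //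
  s si n1 n2; rewrite d0.
Qed.

End CircleNull.

(** * Green's formula on discs of the sphere *)

Section MoebiusGreen.
Variable R : realType.
Local Notation C := R[i].
Local Notation re := (@complex.Re R).
Local Notation im := (@complex.Im R).
Local Notation mu := (@lebesgue_measure R).

(** A (1,0)-form [F d lambda] of class C^1: as [d lambda = - z ^ -2 d z] for [z = 1 / lambda], its
    coefficient at infinity is [F1]. *)
Definition form10_near (S : set (CP1 R)) (F : C -> C) : Prop :=
  (forall l : C^o, S (Some l) -> Ck_at 1 l (F : C^o -> C)) /\
  (S None -> exists F1 : C^o -> C, Ck_at 1 0 F1 /\
     \forall z \near (0 : C^o), z != 0 -> F z^-1 = - (z ^+ 2 * F1 z)).

Lemma is_cderive_cis (s : R) : is_cderive (@cis R) s ('i%C * cis s).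
Proof.
have e : 'i%C * cis s = (- sin s) +i* cos s.
  by apply: complex_ext; rewrite ?ReM ?ImM /=; ring.
by rewrite e; split; [exact: is_derive_cos|exact: is_derive_sin].
Qed.

Section Fixed.
Variable m : 'M[C]_2.
Hypothesis um : m \in unitmx.
Let det0 := unitmx_mdet um.

Lemma smooth_at_mnum (z : C^o) : smooth_at z (mnum m : C^o -> C).
Proof. exact: smooth_at_affine. Qed.
Lemma smooth_at_mden (z : C^o) : smooth_at z (mden m : C^o -> C).
Proof. exact: smooth_at_affine. Qed.

Lemma mnum_neq0 z : mden m z = 0 -> mnum m z != 0.
Proof.
move=> h; apply: contraNneq det0 => h'.
have -> : mdet m = m 0 0 * mden m z - m 1 0 * mnum m z.
  by rewrite /mdet /mden /mnum; ring.
by rewrite h h' !mulr0 subr0.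
Qed.

Lemma near_mden (z : C^o) : mden m z != 0 -> \forall w \near z, mden m w != 0.
Proof.
by move=> h; apply: near_neq0 => //; exact: (Ck_at_continuous (smooth_Ck_at 0 (smooth_at_mden z))).
Qed.

Lemma near_mnum (z : C^o) : mnum m z != 0 -> \forall w \near z, mnum m w != 0.
Proof.
by move=> h; apply: near_neq0 => //; exact: (Ck_at_continuous (smooth_Ck_at 0 (smooth_at_mnum z))).
Qed.

Let phi (z : C^o) : C := mnum m z / mden m z.

Lemma smooth_at_phi (z : C^o) : mden m z != 0 -> smooth_at z phi.
Proof.
move=> h; apply: smooth_atM; first exact: smooth_at_mnum.
by apply: smooth_atV => //; exact: smooth_at_mden.
Qed.

Lemma dbar_phi (z : C^o) : mden m z != 0 -> dbar (1 : C^o) phi z = 0.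
Proof.
move=> h; have Hn := smooth_Ck_at 1 (smooth_at_mnum z).
have Hd := smooth_Ck_at 1 (smooth_at_mden z).
rewrite (dbarM _ Hn (Ck_atV h Hd)) (dbarV _ h Hd).
rewrite (dbar_affine (m 0 0) (m 0 1)) (dbar_affine (m 1 0) (m 1 1)).
by rewrite !mul0r oppr0 mulr0 addr0.
Qed.

Lemma dhol_phi (z : C^o) : mden m z != 0 ->
  dhol (1 : C^o) phi z = mdet m / mden m z ^+ 2.
Proof.
move=> h; have Hn := smooth_Ck_at 1 (smooth_at_mnum z).
have Hd := smooth_Ck_at 1 (smooth_at_mden z).
rewrite (dholM _ Hn (Ck_atV h Hd)) (dholV _ h Hd).
rewrite (dhol_affine (m 0 0) (m 0 1)) (dhol_affine (m 1 0) (m 1 1)).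
rewrite /mdet /mnum; move: h; rewrite /mden => h; field; exact: h.
Qed.

Lemma curve_deriv_circle s : mden m (cis s) != 0 ->
  curve_deriv (fun s => odflt 0 (mobius m (cis s))) s =
  mdet m / mden m (cis s) ^+ 2 * ('i%C * cis s).
Proof.
move=> h; apply: is_cderive_deriv.
have hc := is_cderive_cis s.
have aff a b : is_cderive (fun s => a * cis s + b) s (a * ('i%C * cis s)).
  have := is_cderiveD (is_cderiveM (is_cderive_cst a s) hc) (is_cderive_cst b s).
  by rewrite mul0r add0r addr0.
have hn : is_cderive (fun s => mnum m (cis s)) s (m 0 0 * ('i%C * cis s)) := aff _ _.
have hd : is_cderive (fun s => mden m (cis s)) s (m 1 0 * ('i%C * cis s)) := aff _ _.
have hV := is_cderiveM hn (is_cderiveV h hd).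
apply: is_cderive_near (is_cderive_eq hV _); last first.
  rewrite /mdet /mnum; move: h; rewrite /mden; move: (cis s) => c h; field; exact: h.
have h' := near_mden h.
have cc : (@cis R : R^o -> C^o) @ s --> (cis s : C^o) by exact: cis_continuous.
have hn' : \forall w \near s, mden m (cis w) != 0 by exact: (cc _ h').
by apply: filterS hn' => w /= dw; rewrite mobius_Some.
Qed.

Lemma open_odisc_Some : open [set l : C^o | odisc m (Some l)].
Proof.
have -> : [set l : C^o | odisc m (Some l)] =
    (fun l : C^o => sqnorm (inum m l) - sqnorm (iden m l) : R^o) @^-1` [set x : R^o | x < 0].
  by apply/seteqP; split => l /=; rewrite odisc_Some// subr_lt0.
apply: open_comp; last exact: open_lt.
move=> l _; have ci : (inum m : C^o -> C^o) @ l --> (inum m l : C^o).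
  exact: (Ck_at_continuous (smooth_Ck_at 0 (smooth_at_affine (m 1 1) (- m 0 1) l))).
have cd : (iden m : C^o -> C^o) @ l --> (iden m l : C^o).
  have e : iden m = fun l => - m 1 0 * l + m 0 0 by apply/funext => x; rewrite /iden addrC mulNr.
  rewrite e.
  exact: (Ck_at_continuous (smooth_Ck_at 0 (smooth_at_affine (- m 1 0) (m 0 0) l))).
have n1 := cvg_comp _ _ ci (@continuous_sqnorm R (inum m l)).
have n2 := cvg_comp _ _ cd (@continuous_sqnorm R (iden m l)).
exact: cvgB n1 n2.
Qed.

Let sqnorm_ratio (a d : C) :
  (sqnorm a / sqnorm d ^+ 2)%:C = conjc (a / d ^+ 2) * (a / (d * d)).
Proof. by rewrite -(expr2 d) [RHS]mulrC -sqnormE sqnormM sqnormV [d ^+ 2]expr2 sqnormM -expr2. Qed.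

Let re_mulr_real (x : C) (r : R) : re (x * r%:C) = re x * r.
Proof. by rewrite ReM ReC ImC mulr0 subr0. Qed.

Let im_mulr_real (x : C) (r : R) : im (x * r%:C) = im x * r.
Proof. by rewrite ImM ReC ImC mulr0 add0r. Qed.

Section Form.
Variable F : C -> C.
Hypothesis HF : form10_near (cdisc m) F.

Lemma cdisc_phi z : sqnorm z <= 1 -> mden m z != 0 -> cdisc m (Some (phi z)).
Proof. by move=> z1 h; exists z; rewrite /= ?sqnorm_le1// mobius_Some. Qed.

(** At the pole of the transformation, lambda is replaced by its inverse [mden m / mnum m]; the
    double zero in the transition law of [F] cancels the double pole of the derivative. *)
Lemma pullback_form : exists G : C -> C,
  (forall z, sqnorm z <= 1 -> Ck_at 1 (z : C^o) (G : C^o -> C)) /\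
  (forall z, mden m z != 0 -> G z = F (phi z) * (mdet m / mden m z ^+ 2)).
Proof.
(* If the disc misses infinity, there is no pole in the closed unit disc and any [F1] will do. *)
have [F1 HF1] : exists F1 : C^o -> C, forall z, sqnorm z <= 1 -> mden m z = 0 ->
    Ck_at 1 0 F1 /\ \forall z \near (0 : C^o), z != 0 -> F z^-1 = - (z ^+ 2 * F1 z).
  have [n|n] := pselect (cdisc m None).
    by have [_ /(_ n)[F1 h]] := HF; exists F1.
  exists (fun=> 0) => z z1 d0; case: n; exists z; rewrite /= ?sqnorm_le1//.
  exact: mobius_None.
exists (fun z => if mden m z == 0 then - (F1 0 * (mdet m / mnum m z ^+ 2))
  else F (phi z) * (mdet m / mden m z ^+ 2)); split; last first.
  by move=> z /negbTE ->.
move=> z z1; have Hn := smooth_Ck_at 1 (smooth_at_mnum z).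
have Hd := smooth_Ck_at 1 (smooth_at_mden z).
have [d0|d0] := eqVneq (mden m z) 0; last first.
  apply: (@Ck_at_near _ _ _ _ (fun w => F (phi w) * (mdet m / mden m w ^+ 2))).
    by apply: filterS (near_mden d0) => w /negbTE ->.
  apply: Ck_atM.
    apply: Ck_at_comp1; first exact: HF.1 (cdisc_phi z1 d0).
    exact: smooth_Ck_at (smooth_at_phi d0).
  apply: Ck_atM; first exact: Ck_at_cst.
  by apply: Ck_atV; [rewrite expf_neq0|exact: Ck_atM].
have n0 := mnum_neq0 d0.
have [HF1z nF1] := HF1 z z1 d0.
pose w (z : C^o) : C := mden m z / mnum m z.
have Hw : Ck_at 1 (z : C^o) w by exact: (Ck_atM Hd (Ck_atV n0 Hn)).
have w0 : w z = 0 by rewrite /w d0 mul0r.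
apply: (@Ck_at_near _ _ _ _ (fun x => - (F1 (w x) * (mdet m / mnum m x ^+ 2)))).
  have nw : \forall x \near (z : C^o), w x != 0 -> F (w x)^-1 = - (w x ^+ 2 * F1 (w x)).
    have cw : (w : C^o -> C^o) @ (z : C^o) --> (w z : C^o) by exact: Ck_at_continuous Hw.
    by rewrite w0 in cw; exact: cw _ nF1.
  apply: filterS2 nw (near_mnum n0) => x hx nx.
  case: eqP => [dx|/eqP dx]; first by rewrite /w dx mul0r.
  have wx0 : w x != 0 by rewrite mulf_neq0// invr_neq0.
  have -> : phi x = (w x)^-1 by rewrite /w invf_div.
  rewrite hx// /w; field; rewrite dx; exact: nx.
have HF1w : Ck_at 1 (w z : C^o) F1 :=
  eq_ind_r (fun x : C^o => Ck_at 1 x F1) HF1z w0.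
have n20 : mnum m z * mnum m z != 0 by rewrite mulf_neq0.
exact: (Ck_atN (Ck_atM (Ck_at_comp1 HF1w Hw)
  (Ck_atM (Ck_at_cst 1 (z : C^o) (mdet m)) (Ck_atV n20 (Ck_atM Hn Hn))))).
Qed.

(** The [dbar] of the pull-back [G] is that of [F] at [phi z] times the squared modulus of the
    derivative of [phi], and this factor is the Jacobian of [cchange_mobius]; so [green_disc] for
    [G] is the formula for [F]. The integrand [ig] is left free at the angle where the circle meets
    infinity. *)
Lemma green_mobius (ig : R -> C) :
  (forall s, mden m (cis s) != 0 -> ig s = F (odflt 0 (mobius m (cis s))) *
    curve_deriv (fun s => odflt 0 (mobius m (cis s))) s) ->
  2 * 'i%C * cint2 (odisc_plane m) (dbar (1 : C^o) (F : C^o -> C)) = cint1 ig.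
Proof.
move=> igE; have [G [HG GE]] := pullback_form.
have cG z : sqnorm z <= 1 -> {for z, continuous (G : C^o -> C^o)}.
  by move=> /HG /Ck_at_continuous.
transitivity (cint1 (fun s => G (cis s) * ('i%C * cis s))); last first.
  have ck : continuous ((fun s => G (cis s) * ('i%C * cis s)) : R^o -> C^o).
    move=> s; apply: cvgM.
      apply: (@continuous_comp _ _ _ (@cis R : R^o -> C^o) (G : C^o -> C^o)).
        exact: cis_continuous.
      by apply: cG; rewrite sqnorm_cis.
    by apply: cvgM; [exact: cvg_cst|exact: cis_continuous].
  apply/esym; apply: (cint1_off um).
  - apply: (@measurable_funS _ _ _ _ setT) => //; apply: continuous_measurable_fun => s.
    exact: (@cvg_Re _ _ (nbhs (s : R^o)) _ _ _ (ck s)).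
  - apply: (@measurable_funS _ _ _ _ setT) => //; apply: continuous_measurable_fun => s.
    exact: (@cvg_Im _ _ (nbhs (s : R^o)) _ _ _ (ck s)).
  move=> s d0; rewrite igE// GE// mobius_Some//= curve_deriv_circle//.
  by rewrite mulrA.
pose dF : C -> C := dbar (1 : C^o) (F : C^o -> C).
pose dG : C -> C := dbar (1 : C^o) (G : C^o -> C).
suff e : cint2 (odisc_plane m) dF = cint2 unit_disc dG.
  exact: (etrans (f_equal (fun x => 2 * 'i%C * x) e) (green_disc HG)).
have dGE z : sqnorm z < 1 -> mden m z != 0 ->
    dG z = dF (phi z) * (sqnorm (mdet m) / sqnorm (mden m z) ^+ 2)%:C.
  move=> z1 d0.
  have HFz : Ck_at 1 (phi z : C^o) (F : C^o -> C) by apply: HF.1; apply: cdisc_phi => //; exact: ltW.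
  have Hp := smooth_Ck_at 1 (smooth_at_phi d0).
  have Hd := smooth_Ck_at 1 (smooth_at_mden z).
  have d20 : mden m z ^+ 2 != 0 by rewrite expf_neq0.
  have HFp : Ck_at 1 (z : C^o) (fun w => F (phi w)) by exact: Ck_at_comp1.
  have Hd2 : Ck_at 1 (z : C^o) (fun w => mden m w * mden m w) by exact: Ck_atM.
  have HdV := Ck_atV d20 Hd2.
  have HM := Ck_atM (Ck_at_cst 1 (z : C^o) (mdet m)) HdV.
  have -> : dG z = dbar (1 : C^o) (fun w : C^o => F (phi w) * (mdet m / (mden m w * mden m w))) z.
    apply: dbar_near; last exact: HG (ltW z1).
    by apply: filterS (near_mden d0) => w dw; rewrite GE.
  rewrite (dbarM _ HFp HM) (dbarM _ (Ck_at_cst 1 _ _) HdV) dbar_cst mul0r add0r.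
  have -> : dbar (1 : C^o) (fun w : C^o => (mden m w * mden m w)^-1) z = 0.
    rewrite (dbarV _ d20 Hd2) (dbarM _ Hd Hd) (dbar_affine (m 1 0) (m 1 1)).
    by rewrite mulr0 mul0r addr0 mul0r oppr0.
  rewrite !mulr0 addr0 (dbar_comp1 HFz Hp (dbar_phi d0)) (dhol_phi d0) -/dF.
  rewrite [conjc _ * _]mulrC -mulrA; congr (_ * _).
  exact/esym/sqnorm_ratio.
have cdF l : odisc m (Some l) -> {for l, continuous (dF : C^o -> C^o)}.
  move=> h; have hc : cdisc m (Some l) by case: h => z z1 e; exists z => //=; exact: ltW.
  exact: (Ck_at_continuous (Ck_at_dbar (1 : C^o) (HF.1 l hc))).
have cdG z : sqnorm z < 1 -> {for z, continuous (dG : C^o -> C^o)}.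
  move=> z1; have h := HG z (ltW z1).
  exact: (Ck_at_continuous (Ck_at_dbar (1 : C^o) h)).
have mF (f : C -> R) : (forall z, odisc m (Some z) ->
      {for z, continuous ((fun z => f (dF z)) : C^o -> R^o)}) ->
    measurable_fun (odisc_plane m) (fun p => f (dF (cplx p))).
  move=> h; exact: (measurable_plane_continuous (k := fun z => f (dF z)) open_odisc_Some h).
have mG (f : C -> R) : (forall z, sqnorm z < 1 ->
      {for z, continuous ((fun z => f (dG z)) : C^o -> R^o)}) ->
    measurable_fun unit_disc (fun p => f (dG (cplx p))).
  move=> h; exact: (measurable_plane_continuous (k := fun z => f (dG z)) (@open_unit_disc R) h).
have mFr := mF re (fun z oz => @cvg_Re _ _ (nbhs (z : C^o)) (nbhs_filter (z : C^o)) _ _ (cdF z oz)).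
have mFi := mF im (fun z oz => @cvg_Im _ _ (nbhs (z : C^o)) (nbhs_filter (z : C^o)) _ _ (cdF z oz)).
have mGr := mG re (fun z oz => @cvg_Re _ _ (nbhs (z : C^o)) (nbhs_filter (z : C^o)) _ _ (cdG z oz)).
have mGi := mG im (fun z oz => @cvg_Im _ _ (nbhs (z : C^o)) (nbhs_filter (z : C^o)) _ _ (cdG z oz)).
have er := Rintegral_odisc (k := fun z => re (dF z)) (k1 := fun z => re (dG z)) um mFr mGr.
have ei := Rintegral_odisc (k := fun z => im (dF z)) (k1 := fun z => im (dG z)) um mFi mGi.
have dr z : sqnorm z < 1 -> mden m z != 0 ->
    re (dG z) = re (dF (phi z)) * (sqnorm (mdet m) / sqnorm (mden m z) ^+ 2).
  by move=> z1 d0; exact: (etrans (f_equal re (dGE z z1 d0)) (re_mulr_real _ _)).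
have di z : sqnorm z < 1 -> mden m z != 0 ->
    im (dG z) = im (dF (phi z)) * (sqnorm (mdet m) / sqnorm (mden m z) ^+ 2).
  by move=> z1 d0; exact: (etrans (f_equal im (dGE z z1 d0)) (im_mulr_real _ _)).
exact: (f_equal2 (fun a b => a +i* b) (er dr) (ei di)).
Qed.

End Form.
End Fixed.
End MoebiusGreen.

(** * Stokes' theorem on the complement of discs *)

Section SphereIntegral.
Variable R : realType.
Local Notation C := R[i].
Local Notation re := (@complex.Re R).
Local Notation im := (@complex.Im R).
Local Notation mu := (@lebesgue_measure R).
Local Notation mu2 := (mu \x mu)%E.

Definition unit_circle : set (R * R) := [set p | sqnorm (cplx p) = 1].

Lemma measurable_unit_circle : measurable unit_circle.
Proof.
have e : id =1 (fun l : C => 1 * l + 0) by move=> l; rewrite mul1r addr0.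
have := measurable_plane_sqnorm e => /(_ measurableT [set 1]).
by rewrite setTI; apply; exact: measurable_set1.
Qed.

Lemma unit_circle_null : mu2 unit_circle = 0%E.
Proof.
rewrite /= /product_measure1 (eq_integral (fun=> 0%E)) ?integral0// => x _.
apply: countable_lebesgue_measure0.
apply: finite_set_countable.
apply: (@sub_finite_set _ _ [set Num.sqrt (1 - x ^+ 2); - Num.sqrt (1 - x ^+ 2)]); last exact: finite_set2.
move=> y; rewrite /xsection /= inE /unit_circle /sqnorm /= => h.
have e : y ^+ 2 = 1 - x ^+ 2 by rewrite -h addrC addKr.
rewrite -e sqrtr_sqr; have [y0|y0] := leP 0 y; first by left; rewrite ger0_norm.
by right; rewrite ltr0_norm// opprK.
Qed.

(** The pulled-back density is bounded on the unit disc, which has finite measure; the bound is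
    asked for off the pole only. *)
Lemma integrable_odisc (m : 'M[C]_2) (k : C -> R) (M : R) : m \in unitmx -> 0 <= M ->
  measurable_fun (odisc_plane m) (fun p => k (cplx p)) ->
  (forall z, sqnorm z < 1 -> mden m z != 0 ->
    `|k (mnum m z / mden m z)| * (sqnorm (mdet m) / sqnorm (mden m z) ^+ 2) <= M) ->
  mu2.-integrable (odisc_plane m) (EFin \o (fun p => k (cplx p))).
Proof.
move=> um M0 mk kM; have [phi [[mphi mJ J0 hphi] phiE]] := cchange_mobius um.
have mA := measurable_odisc_plane um.
have mK := (measurable_restrictT _ mA).1 mk.
apply/integrableP; split; first exact/measurable_EFinP.
pose K := (fun p => k (cplx p)) \_ (odisc_plane m).
rewrite integral_mkcond [X in (X < _)%E](_ : _ = \int[mu2]_p (`|K p|)%:E)%E; last first.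
  apply: eq_integral => p _; rewrite /K !patchE; case: ifP => // _.
  by rewrite normr0.
pose J p := sqnorm (mdet m) / sqnorm (mden m (cplx p)) ^+ 2.
have mKa : measurable_fun setT (fun p => (`|K p|)%:E).
  by apply/measurable_EFinP; exact: measurableT_comp.
rewrite hphi//.
pose psi p : \bar R := (`|K (pair_of (phi (cplx p)))| * J p)%:E.
pose B p : \bar R := (M * (\1_(@unit_disc R) p : R))%:E.
have mpsi : measurable_fun setT psi.
  apply/measurable_EFinP; apply: measurable_funM.
    have mKn : measurable_fun setT (fun p => `|K p|) by exact: measurableT_comp.
    exact: (measurableT_comp mKn mphi).
  exact: mJ.
have mB : measurable_fun setT B.
  apply/measurable_EFinP; apply: measurable_funM => //.
  by apply: measurable_indic; exact: measurable_unit_disc.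
have B0 p : (0 <= B p)%E by rewrite lee_fin mulr_ge0.
have psi0 p : (0 <= psi p)%E by rewrite lee_fin mulr_ge0// J0.
(* The bound may fail on the vertical line through the pole; the maximum with [B] dominates
   everywhere and is equal to [B] off that line. *)
apply: (@le_lt_trans _ _ (\int[mu2]_p maxe (psi p) (B p))%E).
  apply: ge0_le_integral => //.
  - by move=> p _; rewrite -EFinM; exact: psi0.
  - exact: measurable_maxe.
  - by move=> p _; rewrite -EFinM le_max lexx.
rewrite (@null_vertical_line _ (re (- m 1 1 / m 1 0)) _ B)//; first last.
- move=> p px; have d0 : mden m (cplx p) != 0.
    by apply: contraNneq px => d0; rewrite -(mden_eq0 (cdet0 um d0) d0).
  apply/max_idPr; rewrite lee_fin /K patch_asbool phiE//.
  have [h|h] := pselect (unit_disc p).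
    rewrite indicE mem_set// mulr1; case: asboolP => _; last by rewrite normr0 mul0r.
    by rewrite pair_ofK kM.
  rewrite indicE memNset// mulr0; case: asboolP => [h'|]; last by rewrite normr0 mul0r.
  case: h; move: h'; rewrite /odisc_plane /= pair_ofK odisc_Some// inum_mobius// iden_mobius//.
  rewrite !sqnormM sqnormV ltr_pM2r ?invr_gt0 ?sqnorm_gt0//.
  by rewrite gtr_pMr ?sqnorm_gt0// unitmx_mdet.
- by move=> p; rewrite le_max B0 orbT.
- exact: measurable_maxe.
under eq_integral do rewrite /B EFinM.
rewrite ge0_integralZl//; first last.
  apply/measurable_EFinP; apply: measurable_indic; exact: measurable_unit_disc.
rewrite integral_indic//; last exact: measurable_unit_disc.
rewrite setIT; apply: lte_mul_pinfty => //.
exact: unit_disc_finite_measure.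
Qed.

End SphereIntegral.

(** * Integration on the sphere as two discs and a circle *)

Section SphereTotal.
Variable R : realType.
Local Notation C := R[i].
Local Notation re := (@complex.Re R).
Local Notation im := (@complex.Im R).
Local Notation mu := (@lebesgue_measure R).
Local Notation mu2 := (mu \x mu)%E.

(** The inversion [z -> 1 / z]; its open disc is the exterior of the unit circle, infinity
    included. *)
Definition swapmx : 'M[C]_2 := \matrix_(i, j) (i != j)%:R.

Lemma mden_swap z : mden swapmx z = z.
Proof. by rewrite /mden !mxE /= mul1r addr0. Qed.
Lemma mnum_swap z : mnum swapmx z = 1.
Proof. by rewrite /mnum !mxE /= mul0r add0r. Qed.
Lemma mdet_swap : mdet swapmx = -1.
Proof. by rewrite /mdet !mxE /= mul0r mul1r sub0r. Qed.
Lemma unitmx_swap : swapmx \in unitmx.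
Proof. by rewrite unitmxE unitfE det_mdet mdet_swap oppr_eq0 oner_eq0. Qed.

Definition outer_disc := odisc_plane swapmx.

Lemma outer_discE p : outer_disc p <-> 1 < sqnorm (cplx p).
Proof.
rewrite /outer_disc /odisc_plane /= (odisc_Some unitmx_swap) /inum /iden !mxE /=.
by rewrite mul0r mul1r !sub0r !sqnormN sqnorm1.
Qed.

Lemma measurable_outer_disc : measurable outer_disc.
Proof. exact: (measurable_odisc_plane unitmx_swap). Qed.

Lemma two_discs_cover : (@unit_disc R `|` outer_disc) `|` @unit_circle R = setT.
Proof.
apply/seteqP; split => // p _; have [h|h|h] := ltgtP (sqnorm (cplx p)) 1.
- by left; left.
- by left; right; apply/outer_discE.
- by right.
Qed.

Lemma two_discs_disjoint : [disjoint @unit_disc R & outer_disc].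
Proof.
apply/disj_set2P; apply/seteqP; split => // p [h /outer_discE h'].
by have := lt_trans h h'; rewrite ltxx.
Qed.

Lemma two_discs_circle_disjoint : [disjoint @unit_disc R `|` outer_disc & @unit_circle R].
Proof.
apply/disj_set2P; apply/seteqP; split => // p [[h|/outer_discE h]]; rewrite /unit_circle /=;
  by move=> e; move: h; rewrite /unit_disc /= e ltxx.
Qed.

Lemma integrable_two_discs (f : R * R -> R) : measurable_fun setT f ->
  mu2.-integrable unit_disc (EFin \o f) -> mu2.-integrable outer_disc (EFin \o f) ->
  mu2.-integrable setT (EFin \o f).
Proof.
move=> mf /integrableP[_ i1] /integrableP[_ i2]; apply/integrableP; split.
  exact/measurable_EFinP.
have mn : measurable_fun setT (fun p => `|(EFin \o f) p|%E).
  by apply: measurableT_comp => //; exact/measurable_EFinP.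
rewrite -two_discs_cover ge0_integral_setU//; first last.
- exact: two_discs_circle_disjoint.
- by rewrite two_discs_cover.
- exact: measurable_unit_circle.
- by apply: measurableU; [exact: measurable_unit_disc|exact: measurable_outer_disc].
rewrite [X in (_ + X)%E]null_set_integral ?adde0; first last.
- exact: unit_circle_null.
- exact: (measurable_funS measurableT).
- exact: measurable_unit_circle.
rewrite ge0_integral_setU//; first last.
- exact: two_discs_disjoint.
- exact: (measurable_funS measurableT).
- exact: measurable_outer_disc.
- exact: measurable_unit_disc.
exact: lte_add_pinfty.
Qed.

Lemma Rintegral_two_discs (f : R * R -> R) : mu2.-integrable setT (EFin \o f) ->
  \int[mu2]_p f p = \int[mu2]_(p in unit_disc) f p + \int[mu2]_(p in outer_disc) f p.
Proof.
move=> fi; have mU : measurable (@unit_disc R `|` outer_disc).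
  by apply: measurableU; [exact: measurable_unit_disc|exact: measurable_outer_disc].
rewrite -[in LHS]two_discs_cover Rintegral_setU//; first last.
- exact: two_discs_circle_disjoint.
- by rewrite two_discs_cover.
- exact: measurable_unit_circle.
rewrite [X in _ + X](_ : _ = 0) ?addr0; last first.
  rewrite /Rintegral null_set_integral//.
  - exact: measurable_unit_circle.
  - by apply: (measurable_funS measurableT) => //; case/integrableP: fi.
  - exact: unit_circle_null.
apply: Rintegral_setU.
- exact: measurable_unit_disc.
- exact: measurable_outer_disc.
- by apply: integrableS fi => //.
- exact: two_discs_disjoint.
Qed.

Definition closed_sphere (S : set (CP1 R)) : Prop :=
  forall k, closed [set z : C^o | S (chart k z)].

Definition sphere_plane (S : set (CP1 R)) : set (R * R) := [set p | S (Some (cplx p))].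

(** The density [k] of a 2-form on the lambda-plane which is continuous on the
    sphere: the factor is the Jacobian of inversion. *)
Definition density_near (S : set (CP1 R)) (k : C -> R) : Prop :=
  (forall l : C^o, S (Some l) -> {for l, continuous (k : C^o -> R^o)}) /\
  (S None -> exists k1 : C -> R, {for (0 : C^o), continuous (k1 : C^o -> R^o)} /\
     \forall z \near (0 : C^o), z != 0 -> k z^-1 = sqnorm z ^+ 2 * k1 z).

Lemma measurable_sphere_plane S : closed_sphere S -> measurable (sphere_plane S).
Proof.
move=> /(_ false) cS; rewrite -[sphere_plane S]setCK; apply: measurableC.
exact: (measurable_plane_open (closed_openC cS)).
Qed.

Lemma continuous_near_eq (f g : C -> R) (z : C^o) : (\forall w \near z, f w = g w) ->
  {for z, continuous (f : C^o -> R^o)} -> {for z, continuous (g : C^o -> R^o)}.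
Proof.
move=> e cf; have cf' : (f : C^o -> R^o) @ z --> (f z : R^o) by exact: cf.
suff : (g : C^o -> R^o) @ z --> (g z : R^o) by [].
rewrite -(nbhs_singleton e); apply: cvg_trans cf'.
by apply: (@near_eq_cvg _ _ (nbhs z)); apply: filterS e => w ->.
Qed.

(** [k'] is the density in the coordinate [1 / lambda], with its removable singularity at [0] filled
    in. *)
Lemma density_inversion_continuous S k : density_near S k ->
  exists k' : C -> R, (forall z, z != 0 -> k' z = k z^-1 / sqnorm z ^+ 2) /\
  forall z : C^o, S (chart true z) -> {for z, continuous (k' : C^o -> R^o)}.
Proof.
move=> [ck kN].
have [k1 hk1] : exists k1 : C -> R, S None -> {for (0 : C^o), continuous (k1 : C^o -> R^o)} /\
     \forall z \near (0 : C^o), z != 0 -> k z^-1 = sqnorm z ^+ 2 * k1 z.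
  have [/kN[k1 h]|n] := pselect (S None); first by exists k1.
  by exists (fun=> 0) => /n.
exists (fun z => if z == 0 then k1 0 else k z^-1 / sqnorm z ^+ 2); split.
  by move=> z /negbTE ->.
move=> z; rewrite /chart; case: eqVneq => [->|z0] Sz.
  have [c1 e1] := hk1 Sz.
  have e : \forall w \near (0 : C^o),
      k1 w = if w == 0 then k1 0 else k w^-1 / sqnorm w ^+ 2.
    apply: filterS e1 => w; case: eqVneq => [->//|w0 ->//].
    by rewrite mulrAC divff ?mul1r// expf_neq0// sqnorm_eq0.
  exact: continuous_near_eq e c1.
have e : \forall w \near (z : C^o),
    k w^-1 / sqnorm w ^+ 2 = if w == 0 then k1 0 else k w^-1 / sqnorm w ^+ 2.
  have : \forall w \near (z : C^o), w != 0 by exact: (near_neq0 (V := C^o) (f := id) cvg_id).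
  by apply: filterS => w /negbTE ->.
have cV : {for z, continuous (fun w : C^o => w^-1 : C^o)} by exact: (inv_continuous z0).
have cK : {for z^-1 : C^o, continuous (k : C^o -> R^o)} by exact: ck.
have ckV := continuous_comp cV cK.
have n0 : sqnorm z ^+ 2 != 0 :> R^o by rewrite expf_neq0// sqnorm_eq0.
have cs := @continuous_sqnorm R z.
have c1 := cvgM ckV (cvgV n0 (cvgM cs cs)).
have c2 : {for z, continuous (fun w : C^o => k w^-1 / sqnorm w ^+ 2 : R^o)} by exact: c1.
exact: (continuous_near_eq e c2).
Qed.

(** By compactness [k] is bounded on the part of [S] in the unit disc, and so is its expression in
    the coordinate [1 / lambda] on the part outside, which is the bound [integrable_odisc] asks
    for. *)
Lemma integrable_sphere S k : closed_sphere S -> density_near S k ->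
  mu2.-integrable (sphere_plane S) (EFin \o (fun p => k (cplx p))).
Proof.
move=> cS dk; have mP := measurable_sphere_plane cS.
(* Extended by zero, the density lives on the whole plane and the two discs can be treated one at a
   time. *)
pose kS l := if `[< S (Some l) >] then k l else 0.
have mk : measurable_fun (sphere_plane S) (fun p => k (cplx p)).
  by apply: measurable_plane_continuous_on => // p; exact: dk.1.
have mkS : measurable_fun setT (fun p => kS (cplx p)).
  have := (measurable_restrictT _ mP).1 mk.
  by apply: eq_measurable_fun => p _; rewrite patch_asbool.
suff i : mu2.-integrable setT (EFin \o (fun p => kS (cplx p))).
  have : mu2.-integrable (sphere_plane S) (EFin \o (fun p => kS (cplx p))).
    by apply: integrableS i => //.
  move=> /integrableP[_ il]; apply/integrableP; split; first exact/measurable_EFinP.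
  apply: le_lt_trans il; rewrite le_eqVlt; apply/orP; left; apply/eqP.
  by apply: eq_integral => p; rewrite inE => Pp; rewrite /kS /= asboolT.
apply: integrable_two_discs => //.
  have [M hM] := closed_disc_bounded (cS false) (fun z Sz _ => dk.1 z Sz).
  apply: measurable_bounded_integrable.
  - exact: measurable_unit_disc.
  - exact: unit_disc_finite_measure.
  - exact: (measurable_funS measurableT).
  exists `|M|; split; first exact: num_real.
  move=> M' MM' p /= p1; rewrite /kS; case: asboolP => [h|_].
    by apply: le_trans (hM _ h (ltW p1)) _; apply: le_trans (ler_norm M) (ltW MM').
  by rewrite normr0; apply: le_trans (ltW MM').
have [k' [k'E ck']] := density_inversion_continuous dk.
have [M hM] := closed_disc_bounded (cS true) (fun z Sz _ => ck' z Sz).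
apply: (@integrable_odisc _ _ _ `|M|) => //; first exact: unitmx_swap.
  exact: (measurable_funS measurableT).
move=> z z1; rewrite mden_swap mnum_swap mdet_swap sqnormN sqnorm1 !div1r => z0.
rewrite /kS; case: asboolP => [h|_]; last by rewrite normr0 mul0r.
apply: le_trans (ler_norm M); rewrite -[X in _ * X]ger0_norm -?normrM -?k'E//.
  by apply: hM; [rewrite /= (negbTE z0)|exact: ltW].
by rewrite invr_ge0 sqr_ge0.
Qed.

End SphereTotal.

(** * Two-forms on the sphere and the total integral of [dbar] *)

Section Forms.
Variable R : realType.
Local Notation C := R[i].
Local Notation re := (@complex.Re R).
Local Notation im := (@complex.Im R).
Local Notation mu := (@lebesgue_measure R).
Local Notation mu2 := (mu \x mu)%E.

(** Turns an identity on a punctured neighbourhood of infinity into identities on full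
    neighbourhoods of its points, where they may be differentiated. *)
Lemma near_inversion (T : Type) (F G : C -> T) :
  (\forall z \near (0 : C^o), z != 0 -> F z^-1 = G z) ->
  \forall z \near (0 : C^o), z != 0 -> \forall l \near (z^-1 : C^o), F l = G l^-1.
Proof.
move=> /nbhs_openP[ O [ oO O0 h]].
have : nbhs (0 : C^o) O by exact: open_nbhs_nbhs.
apply: filterS => z Oz z0.
have zV0 : z^-1 != 0 by rewrite invr_neq0.
have h1 : \forall l \near (z^-1 : C^o), l != 0 by exact: (near_neq0 (V := C^o) (f := id) cvg_id).
have h2 : \forall l \near (z^-1 : C^o), O l^-1.
  have cV : {for z^-1 : C^o, continuous (fun w : C^o => w^-1 : C^o)} by exact: (inv_continuous zV0).
  by apply: cV; rewrite invrK; exact: open_nbhs_nbhs.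
apply: filterS2 h1 h2 => l l0 Ol; rewrite -{1}[l]invrK; apply: h => //.
by rewrite invr_neq0.
Qed.

(** Coefficient of a continuous 2-form: [zeta = 1 / lambda] gives the factor
    [|zeta| ^ 4]. *)
Definition form11_near (S : set (CP1 R)) (T : C -> C) : Prop :=
  (forall l : C^o, S (Some l) -> {for l, continuous (T : C^o -> C^o)}) /\
  (S None -> exists T1 : C -> C, {for (0 : C^o), continuous (T1 : C^o -> C^o)} /\
     \forall z \near (0 : C^o), z != 0 -> T z^-1 = (sqnorm z ^+ 2)%:C * T1 z).

Lemma continuous_re (f : C -> C) (z : C^o) : {for z, continuous (f : C^o -> C^o)} ->
  {for z, continuous ((fun w => re (f w)) : C^o -> R^o)}.
Proof. by move=> h; exact: (@cvg_Re _ _ (nbhs (z : C^o)) (nbhs_filter (z : C^o)) _ _ h). Qed.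
Lemma continuous_im (f : C -> C) (z : C^o) : {for z, continuous (f : C^o -> C^o)} ->
  {for z, continuous ((fun w => im (f w)) : C^o -> R^o)}.
Proof. by move=> h; exact: (@cvg_Im _ _ (nbhs (z : C^o)) (nbhs_filter (z : C^o)) _ _ h). Qed.

Lemma form11_re S T : form11_near S T -> density_near S (fun z => re (T z)).
Proof.
move=> [h1 h2]; split=> [l /h1|/h2[T1 [c1 e]]]; first exact: continuous_re.
exists (fun z => re (T1 z)); split; first exact: continuous_re.
by apply: filterS e => z e z0; rewrite e// ReM /= mul0r subr0.
Qed.

Lemma form11_im S T : form11_near S T -> density_near S (fun z => im (T z)).
Proof.
move=> [h1 h2]; split=> [l /h1|/h2[T1 [c1 e]]]; first exact: continuous_im.
exists (fun z => im (T1 z)); split; first exact: continuous_im.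
by apply: filterS e => z e z0; rewrite e// ImM /= mul0r addr0.
Qed.

Lemma form11_nearD S T1 T2 : form11_near S T1 -> form11_near S T2 ->
  form11_near S (fun z => T1 z + T2 z).
Proof.
move=> [h1 h2] [k1 k2]; split=> [l Sl|SN]; first exact: (cvgD (h1 l Sl) (k1 l Sl)).
have [A [cA eA]] := h2 SN; have [B [cB eB]] := k2 SN.
exists (fun z => A z + B z); split; first exact: (cvgD cA cB).
by apply: filterS2 eA eB => z a b z0; rewrite a// b// mulrDr.
Qed.

Lemma cint2D S T1 T2 : closed_sphere S -> form11_near S T1 -> form11_near S T2 ->
  cint2 (sphere_plane S) (fun z => T1 z + T2 z) =
  cint2 (sphere_plane S) T1 + cint2 (sphere_plane S) T2.
Proof.
move=> cS h1 h2; have mP := measurable_sphere_plane cS.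
have D k1 k2 : density_near S k1 -> density_near S k2 ->
    \int[mu2]_(p in sphere_plane S) (k1 (cplx p) + k2 (cplx p)) =
    \int[mu2]_(p in sphere_plane S) k1 (cplx p) + \int[mu2]_(p in sphere_plane S) k2 (cplx p).
  move=> d1 d2; apply: RintegralD; [exact: mP|exact: integrable_sphere cS d1|].
  exact: integrable_sphere cS d2.
apply: complex_ext; rewrite /cint2 ?ReD ?ImD /=.
  rewrite -(D _ _ (form11_re h1) (form11_re h2)).
  by apply: eq_Rintegral => p _; rewrite ReD.
rewrite -(D _ _ (form11_im h1) (form11_im h2)).
by apply: eq_Rintegral => p _; rewrite ImD.
Qed.

Lemma form10_dbar S (F : C -> C) : form10_near S F ->
  form11_near S (dbar (1 : C^o) (F : C^o -> C)).
Proof.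
move=> [h1 h2]; split=> [l Sl|SN]; first exact: (Ck_at_continuous (Ck_at_dbar (1 : C^o) (h1 l Sl))).
have [F1 [c1 /near_inversion e]] := h2 SN.
exists (dbar (1 : C^o) F1); split; first exact: (Ck_at_continuous (Ck_at_dbar (1 : C^o) c1)).
apply: filterS2 (near_Ck_at c1) e => z Hz ez z0; have {}ez := ez z0.
have zV0 : z^-1 != 0 by rewrite invr_neq0.
have Hi := smooth_Ck_at 1 (smooth_at_inv zV0).
have Hz' : Ck_at 1 ((z^-1)^-1 : C^o) F1 by rewrite invrK.
have Hc := Ck_at_comp1 Hz' Hi.
have Hii := Ck_atM Hi Hi.
have Hic := Ck_atM Hii Hc.
have -> : dbar (1 : C^o) (F : C^o -> C) z^-1 =
    dbar (1 : C^o) (fun l : C^o => - (l^-1 * l^-1 * F1 l^-1)) z^-1.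
  apply/esym; apply: dbar_near; last exact: (Ck_atN Hic).
  by apply: filterS ez => l ->; rewrite -expr2.
rewrite (dbarN _ Hic) (dbarM _ Hii Hc) (dbarM _ Hi Hi) (dbar_inv zV0).
rewrite (dbar_comp1 Hz' Hi (dbar_inv zV0)) (dhol_inv zV0) invrK.
rewrite mulr0 mul0r addr0 mul0r add0r.
move: (dbar _ _ _) => d; rewrite -exprVn invrK.
have -> : (sqnorm z ^+ 2)%:C = (z * conjc z) ^+ 2 by rewrite rmorphXn /= sqnormE.
have -> : conjc (- z ^+ 2) = - conjc z ^+ 2 by rewrite rmorphN rmorphXn.
by ring.
Qed.

(** Green's formula on the two hemispheres: the boundary of the outer one is run through as
    [1 / cis s = cis (- s)], so the two circle integrals cancel. *)
Lemma sphere_total (F : C -> C) : form10_near setT F ->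
  cint2 setT (dbar (1 : C^o) (F : C^o -> C)) = 0.
Proof.
move=> HF; have cT : closed_sphere (setT : set (CP1 R)) by move=> k; exact: closedT.
have HD := form10_dbar HF.
have ir := integrable_sphere cT (form11_re HD); have ii := integrable_sphere cT (form11_im HD).
have er := Rintegral_two_discs ir; have ei := Rintegral_two_discs ii.
have -> : cint2 setT (dbar (1 : C^o) (F : C^o -> C)) =
    cint2 unit_disc (dbar (1 : C^o) (F : C^o -> C)) + cint2 (@outer_disc R) (dbar (1 : C^o) (F : C^o -> C)).
  exact: (f_equal2 (fun a b => a +i* b) er ei).
have g1 := green_disc (fun z _ => HF.1 z I).
have Fsub : form10_near (cdisc (swapmx R)) F by split=> [l _|_]; [exact: HF.1|exact: HF.2].
have g2 := green_mobius (unitmx_swap R) Fsub (fun s _ => erefl).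
suff e : cint1 (fun s => F (odflt 0 (mobius (swapmx R) (cis s))) *
    curve_deriv (fun s => odflt 0 (mobius (swapmx R) (cis s))) s) =
    - cint1 (fun s => F (cis s) * ('i%C * cis s)).
  have i0 : 2 * 'i%C != 0 :> C.
    rewrite mulf_neq0 ?pnatr_eq0//; apply/eqP => /(f_equal im) /= /eqP.
    by rewrite oner_eq0.
  apply: (mulfI i0); rewrite mulr0 mulrDr.
  apply: (etrans (f_equal2 +%R g1 (etrans g2 e))); exact: subrr.
pose k s := F (cis s) * ('i%C * cis s).
have ck : continuous (k : R^o -> C^o).
  move=> s; apply: cvgM.
    apply: (@continuous_comp _ _ _ (@cis R : R^o -> C^o) (F : C^o -> C^o)).
      exact: cis_continuous.
    exact: (Ck_at_continuous (HF.1 (cis s) I)).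
  by apply: cvgM; [exact: cvg_cst|exact: cis_continuous].
have cisN s : (cis s)^-1 = cis (- s) :> C.
  have c0 : cis s != 0 by rewrite -sqnorm_eq0 sqnorm_cis oner_eq0.
  apply: (mulfI c0); rewrite divff//; apply: complex_ext; rewrite ?ReM ?ImM /= cosN sinN.
    by rewrite mulrN opprK -!expr2 cos2Dsin2.
  by rewrite mulrN mulrC addrC subrr.
have kE s : F (odflt 0 (mobius (swapmx R) (cis s))) *
    curve_deriv (fun s => odflt 0 (mobius (swapmx R) (cis s))) s = - k (- s).
  have c0 : cis s != 0 by rewrite -sqnorm_eq0 sqnorm_cis oner_eq0.
  have d0 : mden (swapmx R) (cis s) != 0 by rewrite mden_swap.
  rewrite (curve_deriv_circle d0) mobius_Some//= mnum_swap mden_swap mdet_swap.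
  rewrite div1r cisN /k -mulrN; congr (_ * _).
  by rewrite -cisN; field; exact: c0.
have rev (f : R -> R) : continuous (f : R^o -> R^o) -> (forall s, f (s + 2 * pi) = f s) ->
    \int[mu]_(s in `[0, 2 * pi]) (- f (- s)) = - \int[mu]_(s in `[0, 2 * pi]) f s.
  move=> cf pf.
  have pi0 : 0 <= 2 * pi :> R by rewrite mulr_ge0// pi_ge0.
  have h0 : - 0 = - (2 * pi) + 2 * pi :> R by rewrite oppr0 addNr.
  rewrite -(Rintegral_segment_opp (k := fun s => - f s) pi0); last first.
    by apply: within_continuousT => s; apply: cvgN; exact: cf.
  rewrite h0 Rintegral_period ?oppr_le0//; last by move=> s; rewrite pf.
    rewrite -mulN1r -RintegralZl//; first by apply: eq_Rintegral => s _; rewrite mulN1r.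
    by apply: integrable_segment; exact: within_continuousT.
  by move=> s; apply: cvgN; exact: cf.
have kp s : k (s + 2 * pi) = k s by rewrite /k cisD2pi.
rewrite /cint1; apply: complex_ext.
  rewrite -[LHS]/(Rintegral _ _ _) -[RHS]/(- Rintegral _ _ _) -/k.
  rewrite -(rev (fun s => re (k s))); first by apply: eq_Rintegral => s _; rewrite kE ReN.
    by move=> s; exact: (@cvg_Re _ _ (nbhs (s : R^o)) _ _ _ (ck s)).
  by move=> s; rewrite kp.
rewrite -[LHS]/(Rintegral _ _ _) -[RHS]/(- Rintegral _ _ _) -/k.
rewrite -(rev (fun s => im (k s))); first by apply: eq_Rintegral => s _; rewrite kE ImN.
  by move=> s; exact: (@cvg_Im _ _ (nbhs (s : R^o)) _ _ _ (ck s)).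
by move=> s; rewrite kp.
Qed.

End Forms.

(** * Cutoff functions attached to discs of the sphere *)

Section Cutoff.
Variable R : realType.
Local Notation C := R[i].
Local Notation re := (@complex.Re R).
Local Notation im := (@complex.Im R).

(** A profile which is continuously differentiable and vanishes exactly for
    [x <= 0]. *)
Definition possq (x : R) : R := Num.max 0 x ^+ 2.

Lemma possq_ge0 x : 0 <= possq x. Proof. exact: sqr_ge0. Qed.
Lemma possq_le0 x : x <= 0 -> possq x = 0.
Proof. by move=> x0; rewrite /possq max_l// expr0n. Qed.
Lemma possq_gt0 x : 0 < x -> 0 < possq x.
Proof. by move=> x0; rewrite /possq max_r ?exprn_gt0// ltW. Qed.
Lemma possqM c x : 0 <= c -> possq (c * x) = c ^+ 2 * possq x.
Proof. by move=> c0; rewrite /possq -exprMn maxr_pMr// mulr0. Qed.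

(** A second-order remainder valid across the corner of the maximum, so that one estimate gives the
    derivative of [possq] at every point. *)
Lemma possq_quadratic x h :
  `|possq (h + x) - possq x - 2 * Num.max 0 x * h| <= h ^+ 2.
Proof.
rewrite /possq ler_norml; apply/andP.
have [a|a] := leP 0 x; have [b|b] := leP 0 (h + x); split; nra.
Qed.

Lemma is_derive_possq (x : R) : is_derive x 1 possq (2 * Num.max 0 x).
Proof.
have c : (fun h => h^-1 *: (possq (h *: (1 : R) + x) - possq x)) @ (0 : R)^' -->
    (2 * Num.max 0 x : R).
  apply/cvgrPdist_le => e e0; near=> h.
  have h0 : h != 0 by near: h; exact: nbhs_dnbhs_neq.
  have he : `|h| <= e.
    near: h; apply: (@nbhs_dnbhs _ (0 : R)); apply/nbhs_normP; exists e => // y /=.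
    by rewrite sub0r normrN => /ltW.
  have q := possq_quadratic x h; rewrite [h *: 1]mulr1.
  have -> : 2 * Num.max 0 x - h^-1 *: (possq (h + x) - possq x) =
      - (h^-1 * (possq (h + x) - possq x - 2 * Num.max 0 x * h)).
    by rewrite /GRing.scale /=; field.
  rewrite normrN normrM normfV mulrC ler_pdivrMr ?normr_gt0//.
  apply: le_trans q _; rewrite -real_normK ?num_real// expr2.
  by rewrite ler_wpM2r.
by split; [exact: cvgP c|exact: (cvg_lim _ c)].
Unshelve. all: by end_near. Qed.

Lemma Ck_possq : Ck 1 [set: C^o] (fun z : C^o => (possq (re z))%:C).
Proof.
have cmax : continuous ((fun z : C^o => Num.max 0 (re z)) : C^o -> R^o).
  move=> z; apply: (@continuous_comp _ _ _ (fun z : C^o => re z : R^o) (fun x : R^o => Num.max 0 x : R^o)).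
    exact: (continuous_re (f := id) cvg_id).
  apply/cvgrPdist_le => e e0; near=> y; have : `|re z - y| <= e.
    by near: y; exact: (@cvgr_dist_le _ _ _ _ (nbhs_filter (re z : R^o)) id (re z) cvg_id).
  apply: le_trans; rewrite ler_norml; have := ler_norm (re z - y); have := ler_norm (y - re z).
  rewrite distrC => h1 h2; apply/andP.
  by have [a|a] := leP 0 (re z); have [b|b] := leP 0 y; split; lra.
have cr (k : C -> R) (z : C^o) : {for z, continuous (k : C^o -> R^o)} ->
    {for z, continuous ((fun w => (k w)%:C) : C^o -> C^o)}.
  move=> h; have h' : (k : C^o -> R^o) @ z --> (k z : R^o) by exact: h.
  exact: (@cvg_real_complex _ _ (nbhs z) (nbhs_filter z) _ _ h').
split=> [z _|d].
  by apply: cr; have h := cmax z; exact: (cvgM h h).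
have hd (z : C^o) : is_cderive (along (fun z : C^o => (possq (re z))%:C) d z) 0
    (2 * Num.max 0 (re z) * re d)%:C.
  have -> : along (fun z : C^o => (possq (re z))%:C) d z =
      (fun s : R => (possq (re z + s * re d))%:C).
    apply/funext => s; rewrite /along ReD [_ *: d]/(_ * _) ReM /=.
    by rewrite mul0r subr0.
  apply: is_cderive_real.
  have h1 : is_derive (0 : R) 1 (fun s : R => re z + s * re d) (re d).
    have := is_deriveD (is_derive_cst (re z) (0 : R) 1)
      (is_deriveM (is_derive_id (0 : R) 1) (is_derive_cst (re d) (0 : R) 1)).
    by move=> h; apply: is_derive_eq h _; rewrite /GRing.scale /=; ring.
  have e0 : re z + 0 * re d = re z by rewrite mul0r addr0.
  have h2 := is_derive_possq (re z + 0 * re d).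
  have := @is_derive1_comp _ possq (fun s : R => re z + s * re d) 0 _ _ h2 h1.
  by rewrite e0.
split=> [z _|]; first exact: is_cderive_diff (hd z).
apply: (@Ck_ext _ _ 0 setT (fun z : C^o => (2 * Num.max 0 (re z) * re d)%:C) _ openT).
  by move=> z _; exact/esym/(is_cderive_deriv (hd z)).
split=> // z _; apply: cr; have h := cmax z.
have c2 (k : R) : ((fun _ : C^o => k) : C^o -> R^o) @ z --> (k : R^o).
  exact: (@cvg_cst R^o k C^o (nbhs z) (nbhs_filter z)).
exact: (cvgM (cvgM (c2 2) h) (c2 (re d))).
Unshelve. all: by end_near. Qed.

Lemma Ck_at_possq (f : C -> R) (z : C^o) : Ck_at 1 z ((fun w => (f w)%:C) : C^o -> C) ->
  Ck_at 1 z ((fun w => (possq (f w))%:C) : C^o -> C).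
Proof.
move=> Hf; have Hp : Ck_at 1 ((f z)%:C : C^o) (fun z : C^o => (possq (re z))%:C).
  by exists setT; split => //; [exact: openT|exact: Ck_possq].
exact: (Ck_at_comp1 Hp Hf).
Qed.

Lemma Ck_at_realD n (f g : C -> R) (z : C^o) : Ck_at n z ((fun w => (f w)%:C) : C^o -> C) ->
  Ck_at n z ((fun w => (g w)%:C) : C^o -> C) ->
  Ck_at n z ((fun w => (f w + g w)%:C) : C^o -> C).
Proof. by move=> Hf Hg; have := Ck_atD Hf Hg; under eq_fun do rewrite -rmorphD. Qed.

Lemma Ck_at_realZ n (k : R) (f : C -> R) (z : C^o) :
  Ck_at n z ((fun w => (f w)%:C) : C^o -> C) ->
  Ck_at n z ((fun w => (k * f w)%:C) : C^o -> C).
Proof.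
move=> Hf; have := Ck_atM (Ck_at_cst n z (k%:C)) Hf.
by under eq_fun do rewrite -rmorphM.
Qed.

Lemma Ck_at_sqnorm n (f : C -> C) (z : C^o) : Ck_at n z (f : C^o -> C) ->
  Ck_at n z ((fun w => (sqnorm (f w))%:C) : C^o -> C).
Proof.
move=> Hf; under eq_fun do rewrite sqnormE.
exact: (Ck_atM Hf (Ck_at_conj Hf)).
Qed.

(** Homogeneous of degree 0, so that it may be evaluated on the numerator and
    denominator of a Moebius coordinate, at infinity as well. *)
Definition cut (t a b : R) : R :=
  possq (a - t * b) / (possq (a - t * b) + possq ((1 + t) / 2 * b - a)).

Lemma cutM c t a b : 0 < c -> cut t (c * a) (c * b) = cut t a b.
Proof.
move=> c0; rewrite /cut.
have -> : c * a - t * (c * b) = c * (a - t * b) by ring.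
have -> : (1 + t) / 2 * (c * b) - c * a = c * ((1 + t) / 2 * b - a) by ring.
rewrite !possqM ?ltW// -mulrDr invfM mulrACA divff ?mul1r//.
by rewrite expf_neq0// gt_eqF.
Qed.

(** Both terms vanish only if [(1 + t) / 2 * b <= a <= t * b], which for [t < 1] and non-negative
    [a], [b] forces [a = b = 0]. *)
Lemma cut_den_gt0 t a b : t < 1 -> 0 <= a -> 0 <= b -> (b == 0 -> a != 0) ->
  0 < possq (a - t * b) + possq ((1 + t) / 2 * b - a).
Proof.
move=> t1 a0 b0 ab; have [h|h] := ltP 0 (a - t * b).
  by rewrite ltr_pwDl ?possq_gt0// possq_ge0.
rewrite ltr_wpDl ?possq_ge0//; apply: possq_gt0.
have b1 : 0 < b.
  rewrite lt_neqAle b0 andbT eq_sym; apply/negP => b_0; have := ab b_0.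
  by move: h; rewrite (eqP b_0) mulr0 subr0 => h; rewrite eq_le h a0.
nra.
Qed.

(** In terms of the point [w] with [mobius m w = z], it vanishes for [|w| ^ 2 <= t] and equals [1]
    for [|w| ^ 2 >= (1 + t) / 2]: for [t < 1] the transition takes place strictly inside the
    disc. *)
Definition cutoff (m : 'M[C]_2) (t : R) (z : C) : C :=
  (cut t (sqnorm (inum m z)) (sqnorm (iden m z)))%:C.

Section Fixed.
Variables (m : 'M[C]_2) (t : R).
Hypothesis um : m \in unitmx.
Hypothesis t1 : t < 1.

Let Hn n (z : C^o) : Ck_at n z ((fun w => (sqnorm (inum m w))%:C) : C^o -> C).
Proof.
apply: Ck_at_sqnorm; have := smooth_Ck_at n (smooth_at_affine (m 1 1) (- m 0 1) z); exact.
Qed.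

Let Hd n (z : C^o) : Ck_at n z ((fun w => (sqnorm (iden m w))%:C) : C^o -> C).
Proof.
apply: Ck_at_sqnorm; have := smooth_Ck_at n (smooth_at_affine (- m 1 0) (m 0 0) z).
by under eq_fun do rewrite addrC mulNr.
Qed.

Let den_gt0 z : 0 < possq (sqnorm (inum m z) - t * sqnorm (iden m z)) +
  possq ((1 + t) / 2 * sqnorm (iden m z) - sqnorm (inum m z)).
Proof.
apply: cut_den_gt0 => //; rewrite ?sqnorm_ge0// !sqnorm_eq0 => /eqP.
exact: iden_inum_neq0.
Qed.

Let HA n z : Ck_at n (z : C^o)
  ((fun w => (sqnorm (inum m w) - t * sqnorm (iden m w))%:C) : C^o -> C).
Proof.
have := Ck_at_realD (Hn n z) (Ck_at_realZ (- t) (Hd n z)).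
by under eq_fun do rewrite mulNr.
Qed.

Let HB n z : Ck_at n (z : C^o)
  ((fun w => ((1 + t) / 2 * sqnorm (iden m w) - sqnorm (inum m w))%:C) : C^o -> C).
Proof.
have := Ck_at_realD (Ck_at_realZ ((1 + t) / 2) (Hd n z)) (Ck_at_realZ (- 1) (Hn n z)).
by under eq_fun do rewrite mulN1r.
Qed.

Lemma Ck_at_cutoff (z : C^o) : Ck_at 1 z (cutoff m t : C^o -> C).
Proof.
have HP := Ck_at_possq (HA 1 z); have HQ := Ck_at_possq (HB 1 z).
have HS := Ck_at_realD HP HQ.
have S0 : (possq (sqnorm (inum m z) - t * sqnorm (iden m z)) +
    possq ((1 + t) / 2 * sqnorm (iden m z) - sqnorm (inum m z)))%:C != 0 :> C.
  by apply/eqP => /(f_equal re) /= e; have := den_gt0 z; rewrite e ltxx.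
have := Ck_atM HP (Ck_atV S0 HS).
by under eq_fun do rewrite -fmorphV -rmorphM.
Qed.

Let near_lt (f : C -> R) (z : C^o) : Ck_at 0 z ((fun w => (f w)%:C) : C^o -> C) ->
  f z < 0 -> \forall w \near z, f w < 0.
Proof.
move=> Hf fz; have cf := continuous_re (Ck_at_continuous Hf).
have : nbhs (f z : R^o) [set x : R^o | x < 0].
  by apply: open_nbhs_nbhs; split => //; exact: open_lt.
exact: cf.
Qed.

Lemma near_cutoff0 (z : C^o) : sqnorm (inum m z) < t * sqnorm (iden m z) ->
  \forall w \near z, cutoff m t w = 0.
Proof.
rewrite -subr_lt0 => /(near_lt (HA 0 z)); apply: filterS => w h.
by rewrite /cutoff /cut possq_le0 ?mul0r// ltW.
Qed.

Lemma near_cutoff1 (z : C^o) : sqnorm (iden m z) <= sqnorm (inum m z) ->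
  \forall w \near z, cutoff m t w = 1.
Proof.
move=> h; have h0 : (1 + t) / 2 * sqnorm (iden m z) - sqnorm (inum m z) < 0.
  have := sqnorm_ge0 (iden m z); rewrite le_eqVlt => /orP[/eqP e|d0]; last first.
    by rewrite subr_lt0; apply: lt_le_trans h; rewrite gtr_pMl//; move: t1; lra.
  rewrite -e mulr0 sub0r oppr_lt0 sqnorm_gt0//; apply: iden_inum_neq0 => //.
  by apply/eqP; rewrite -sqnorm_eq0 -e.
apply: filterS (near_lt (HB 0 z) h0) => w B0.
have := den_gt0 w; rewrite /cutoff /cut [possq (_ * _ - _)]possq_le0 ?ltW//.
by rewrite addr0 => p0; rewrite divff// gt_eqF.
Qed.

Lemma swapmxE j : ((swapmx R *m m) 0 j = m 1 j) * ((swapmx R *m m) 1 j = m 0 j).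
Proof.
have e : lift ord0 ord0 = 1 :> 'I_2 by apply/val_inj.
have e0 : ord0 = 0 :> 'I_2 by [].
by split; rewrite mxE !big_ord_recl big_ord0 !mxE e e0 /= ?mul0r ?mul1r ?add0r ?addr0.
Qed.

(** Inversion multiplies the square norms of [inum] and [iden] by the same positive factor, under
    which [cut] is invariant. *)
Lemma cutoff_inv z : z != 0 -> cutoff m t z^-1 = cutoff (swapmx R *m m) t z.
Proof.
move=> z0; rewrite /cutoff; congr (_%:C).
have c0 : 0 < (sqnorm z)^-1 by rewrite invr_gt0 sqnorm_gt0.
have e1 : sqnorm (inum m z^-1) = (sqnorm z)^-1 * sqnorm (inum (swapmx R *m m) z).
  rewrite -sqnormV -sqnormM /inum !swapmxE -sqnormN.
  by congr sqnorm; field.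
have e2 : sqnorm (iden m z^-1) = (sqnorm z)^-1 * sqnorm (iden (swapmx R *m m) z).
  rewrite -sqnormV -sqnormM /iden !swapmxE -sqnormN.
  by congr sqnorm; field.
by rewrite e1 e2 cutM.
Qed.

End Fixed.
End Cutoff.

(** * Extending a form over the discs *)

Section Extension.
Variable R : realType.
Local Notation C := R[i].
Local Notation re := (@complex.Re R).
Local Notation im := (@complex.Im R).

Definition regular (F : C -> C) (P : CP1 R) : Prop := form10_near [set P] F.

Lemma form10_nearP S F : form10_near S F <-> forall P, S P -> regular F P.
Proof.
split=> [[h1 h2] [l|] SP|h].
- by split=> [l' [->]|//]; exact: h1.
- by split=> [l' //|_]; exact: h2.
- by split=> [l Sl|SN]; [exact: (h _ Sl).1|exact: (h _ SN).2].
Qed.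

Lemma regular_Some F (l : C) : Ck_at 1 (l : C^o) (F : C^o -> C) -> regular F (Some l).
Proof. by move=> h; split=> [l' [->]|]. Qed.

Lemma near_infty_regular F (F1 : C^o -> C) : Ck_at 1 0 F1 ->
  (\forall z \near (0 : C^o), z != 0 -> F z^-1 = - (z ^+ 2 * F1 z)) ->
  \forall z \near (0 : C^o), z != 0 -> regular F (Some z^-1).
Proof.
move=> c1 /near_inversion e; apply: filterS2 (near_Ck_at c1) e => z Hz ez z0.
have {}ez := ez z0; have zV0 : z^-1 != 0 by rewrite invr_neq0.
have Hi := smooth_Ck_at 1 (smooth_at_inv zV0).
have Hz' : Ck_at 1 ((z^-1)^-1 : C^o) F1 by rewrite invrK.
have Hic := Ck_atN (Ck_atM (Ck_atM Hi Hi) (Ck_at_comp1 Hz' Hi)).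
apply: regular_Some; apply: (Ck_at_near _ Hic).
by apply: filterS ez => l ->; rewrite -expr2.
Qed.

Section Disc.
Variables (m : 'M[C]_2) (F : C -> C).
Hypothesis um : m \in unitmx.

(** Regularity at a point spreads to a neighbourhood in a local coordinate; around infinity this is
    the inverse of lambda, here [mden m / mnum m]. *)
Lemma regular_mobius_open (z : C^o) : regular F (mobius m z) ->
  \forall w \near z, regular F (mobius m w).
Proof.
have [d0|d0] := eqVneq (mden m z) 0.
  rewrite mobius_None// => hN; have [_ /(_ erefl)[F1 [c1 e1]]] := hN.
  have n0 := mnum_neq0 um d0.
  have Hq := smooth_Ck_at 0 (smooth_atM (smooth_at_mden m z) (smooth_atV n0 (smooth_at_mnum m z))).
  have cq := Ck_at_continuous Hq.
  have e0 : mden m z / mnum m z = 0 by rewrite d0 mul0r.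
  have e : \forall w \near z, mden m w / mnum m w != 0 ->
      regular F (Some (mden m w / mnum m w)^-1).
    have h := near_infty_regular c1 e1.
    by apply: (cq [set y | y != 0 -> regular F (Some y^-1)]); rewrite e0.
  apply: filterS2 e (near_mnum n0) => w ew nw.
  have [dw|dw] := eqVneq (mden m w) 0; first by rewrite mobius_None.
  rewrite (mobius_Some dw) -[mnum m w / mden m w]invf_div; apply: ew.
  by rewrite mulf_neq0// invr_neq0.
rewrite mobius_Some// => -[/(_ _ erefl) HF _].
have cq := Ck_at_continuous (smooth_Ck_at 0 (smooth_at_phi d0)).
have := near_Ck_at HF => /cq e.
have {}e : \forall w \near z, Ck_at 1 (mnum m w / mden m w : C^o) (F : C^o -> C) by exact: e.
apply: filterS2 e (near_mden d0) => w ew dw.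
by rewrite mobius_Some//; exact: regular_Some.
Qed.

(** The singular points in the closed disc form a compact set disjoint from the circle, so the
    square norm has a maximum less than [1] on it. *)
Lemma disc_margin : (forall z, sqnorm z = 1 -> regular F (mobius m z)) ->
  exists2 t, t < 1 & forall z, t <= sqnorm z -> sqnorm z <= 1 -> regular F (mobius m z).
Proof.
move=> hF; pose K : set C^o := [set z | ~ regular F (mobius m z)].
have cK : closed K.
  apply: open_closedC; rewrite openE => z /= h.
  by apply: regular_mobius_open.
have kK := compact_closed_disc cK.
have [[p0 Kp0]|K0] := pselect (exists p : R^o * R^o, K (cplx p) /\ sqnorm (cplx p) <= 1); last first.
  exists 0 => // z _ z1; apply: contrapT => n; apply: K0; exists (pair_of z).
  by rewrite pair_ofK.
have cs : {within [set p : R^o * R^o | K (cplx p) /\ sqnorm (cplx p) <= 1],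
    continuous (fun p : R^o * R^o => sqnorm (cplx p) : R^o)}.
  apply: continuous_in_subspaceT => p _.
  apply: (@continuous_comp _ _ _ (fun p : R^o * R^o => cplx p : C^o) (@sqnorm R : C^o -> R^o)).
    exact: cvg_cplx.
  exact: continuous_sqnorm.
have [c Kc cmax] := compact_EVT_max (ex_intro _ p0 Kp0) kK cs.
move: Kc; rewrite inE => -[Kc c1].
have {}c1 : sqnorm (cplx c) < 1.
  by rewrite lt_neqAle c1 andbT; apply/eqP => e; apply: Kc; exact: hF.
(* The midpoint between that maximum and [1]. *)
exists ((1 + sqnorm (cplx c)) / 2) => [|z tz z1]; first by move: c1; lra.
apply: contrapT => n; have := cmax (pair_of z); rewrite inE /= pair_ofK => /(_ (conj n z1)).
by move: tz c1; lra.
Qed.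

End Disc.

Section Discs.
Variable D : discs R.
Local Notation dm := (@dmob R D).

(** A circle does not meet the open disc it bounds, and the other open discs are excluded because
    the closed discs are disjoint. *)
Lemma circle_Dplus j (z : C) : sqnorm z = 1 -> Dplus D (mobius (dm j) z).
Proof.
move=> z1 [k _ Hk].
have Hj : cdisc (dm j) (mobius (dm j) z) by exists z => //=; rewrite sqnorm_le1 z1.
have [jk|jk] := eqVneq j k; last first.
  have Hk' : cdisc (dm k) (mobius (dm j) z).
    by case: Hk => w w1 e; exists w => //=; exact: ltW.
  suff : set0 (mobius (dm j) z) by [].
  by rewrite -(dmob_disj jk); split.
move: Hk; rewrite -jk; case: (eqVneq (mden (dm j) z) 0) => d0.
  rewrite mobius_None// (odisc_None (dmob_unit j)).
  have c0 := cdet0 (dmob_unit j) d0; move: z1; rewrite (mden_eq0 c0 d0) mulNr sqnormN sqnormM sqnormV.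
  have s0 := sqnorm_gt0 c0; move=> /(f_equal (fun x => x * sqnorm (dm j 1 0))).
  by rewrite mulfVK ?gt_eqF// mul1r => ->; rewrite ltxx.
rewrite mobius_Some// (odisc_Some (dmob_unit j)) inum_mobius// iden_mobius//.
by rewrite !sqnormM z1 mulr1 ltxx.
Qed.

Lemma Dplus_Some l : Dplus D (Some l) <->
  forall j, sqnorm (iden (dm j) l) <= sqnorm (inum (dm j) l).
Proof.
split=> [h j|h [j _ /(odisc_Some (dmob_unit j))]]; last by rewrite ltNge h.
by rewrite leNgt; apply/negP => hj; apply: h; exists j => //; apply/odisc_Some => //; exact: dmob_unit.
Qed.

Lemma Dplus_None : Dplus D None <-> forall j, sqnorm (dm j 1 0) <= sqnorm (dm j 1 1).
Proof.
split=> [h j|h [j _ /(odisc_None (dmob_unit j))]]; last by rewrite ltNge h.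
by rewrite leNgt; apply/negP => hj; apply: h; exists j => //; apply/odisc_None => //; exact: dmob_unit.
Qed.

Lemma Ck_at_prod n (I : Type) (r : seq I) (f : I -> C -> C) (z : C^o) :
  (forall i, Ck_at n z (f i : C^o -> C)) ->
  Ck_at n z ((fun w => \prod_(i <- r) f i w) : C^o -> C).
Proof.
move=> h; elim: r => [|i r IH].
  by under eq_fun do rewrite big_nil; exact: Ck_at_cst.
by under eq_fun do rewrite big_cons; exact: Ck_atM.
Qed.

(** [F] is multiplied by the cutoffs of all discs, each with the margin from [disc_margin]: [F] is
    regular wherever no cutoff vanishes locally, and the cutoffs are [1] near every point of
    [Dplus]. *)
Lemma form10_extend (F : C -> C) : form10_near (Dplus D) F ->
  exists G : C -> C, form10_near setT G /\
    forall l : C^o, Dplus D (Some l) -> \forall w \near l, G w = F w.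
Proof.
move=> HF; have HFr P := (form10_nearP (Dplus D) F).1 HF P.
have /choice[t Ht] : forall j, exists t, t < 1 /\
    forall z, t <= sqnorm z -> sqnorm z <= 1 -> regular F (mobius (dm j) z).
  move=> j; have [t t1 ht] := disc_margin (dmob_unit j) (fun z z1 => HFr _ (circle_Dplus (j := j) z1)).
  by exists t.
pose chi j := cutoff (dm j) (t j).
(* [chi1 j] is [chi j] in the coordinate [1 / lambda]. *)
pose chi1 j := cutoff (swapmx R *m dm j) (t j).
have u1 j : swapmx R *m dm j \in unitmx by rewrite unitmx_mul unitmx_swap dmob_unit.
have Hchi z : Ck_at 1 (z : C^o) ((fun w => \prod_j chi j w) : C^o -> C).
  by apply: Ck_at_prod => j; apply: Ck_at_cutoff; [exact: dmob_unit|exact: (Ht j).1].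
have Hchi1 z : Ck_at 1 (z : C^o) ((fun w => \prod_j chi1 j w) : C^o -> C).
  by apply: Ck_at_prod => j; apply: Ck_at_cutoff; [exact: u1|exact: (Ht j).1].
exists (fun w => (\prod_j chi j w) * F w); split; last first.
  move=> l /Dplus_Some h.
  have hj j : \forall w \near l, chi j w = 1.
    exact: (near_cutoff1 (dmob_unit j) (Ht j).1 (h j)).
  have hh : \forall w \near l, forall j, chi j w = 1.
    exact: (@filter_forall _ _ (fun j w => chi j w = 1) (nbhs l) _ hj).
  by apply: filterS hh => w hw; rewrite big1 ?mul1r.
split=> [l _|_].
  (* Deep inside some disc the product is zero on a neighbourhood; elsewhere [F] itself is regular,
     by the choice of the [t j]. *)
  have [[j hj]|n] := pselect (exists j, sqnorm (inum (dm j) l) < t j * sqnorm (iden (dm j) l)).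
    apply: Ck_at_near (Ck_at_cst 1 l 0).
    apply: filterS (near_cutoff0 hj) => w e.
    by rewrite (bigD1 j)//= /chi e !mul0r.
  have hn j : t j * sqnorm (iden (dm j) l) <= sqnorm (inum (dm j) l).
    by rewrite leNgt; apply/negP => h; apply: n; exists j.
  apply: Ck_atM (Hchi l) _.
  have [|/contrapT[j _ hj]] := pselect (Dplus D (Some l)); first exact: HF.1.
  have [z z1 zl] := hj.
  have i0 := iden_neq0 (dmob_unit j) zl.
  suff : regular F (Some l) by move=> [/(_ l erefl)].
  rewrite -zl; apply: (Ht j).2; last by rewrite -sqnorm_le1 ltW.
  rewrite (mobius_SomeE (dmob_unit j) zl) sqnormM sqnormV ler_pdivlMr ?sqnorm_gt0//.
have Einf : \forall z \near (0 : C^o), z != 0 -> forall j, chi j z^-1 = chi1 j z.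
  by apply: filterE => z z0 j; exact: cutoff_inv.
(* The same alternative at infinity, read off from the second rows of the matrices. *)
have [[j hj]|n] := pselect (exists j, sqnorm (dm j 1 1) < t j * sqnorm (dm j 1 0)).
  exists (fun=> 0); split; first exact: Ck_at_cst.
  have hj0 : sqnorm (inum (swapmx R *m dm j) 0) < t j * sqnorm (iden (swapmx R *m dm j) 0).
    by rewrite /inum /iden !swapmxE !mulr0 sub0r subr0 sqnormN.
  apply: filterS (near_cutoff0 hj0) => z e z0.
  by rewrite (bigD1 j)//= /chi cutoff_inv// e !mul0r mulr0 oppr0.
have hn j : t j * sqnorm (dm j 1 0) <= sqnorm (dm j 1 1).
  by rewrite leNgt; apply/negP => h; apply: n; exists j.
have [_ /(_ erefl)[F1 [c1 e1]]] : regular F None.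
  have [|/contrapT[j _ hj]] := pselect (Dplus D None); first exact: HFr.
  have [z z1 zN] := hj.
  have d0 : mden (dm j) z = 0.
    by apply/eqP; apply: contraPT zN => d0; rewrite mobius_Some.
  have c0 := cdet0 (dmob_unit j) d0.
  rewrite -zN; apply: (Ht j).2; last by rewrite -sqnorm_le1 ltW.
  by rewrite (mden_eq0 c0 d0) mulNr sqnormN sqnormM sqnormV ler_pdivlMr ?sqnorm_gt0.
exists (fun z => (\prod_j chi1 j z) * F1 z); split; first exact: Ck_atM (Hchi1 0) c1.
apply: filterS e1 => z e z0; rewrite (e z0) mulrN [in RHS]mulrCA.
by congr (- (_ * _)); apply: eq_bigr => j _; exact: cutoff_inv.
Qed.

End Discs.
End Extension.

(** * Stokes' theorem on [Dplus] *)

Section Stokes.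
Variable R : realType.
Local Notation C := R[i].
Local Notation re := (@complex.Re R).
Local Notation im := (@complex.Im R).
Local Notation mu := (@lebesgue_measure R).
Local Notation mu2 := (mu \x mu)%E.

Lemma Rintegral_bigsetU (I : choiceType) (s : seq I) (A : I -> set (R * R)) (f : R * R -> R) :
  (forall i, measurable (A i)) -> (forall i j, i != j -> A i `&` A j = set0) -> uniq s ->
  mu2.-integrable setT (EFin \o f) ->
  \int[mu2]_(p in \big[setU/set0]_(i <- s) A i) f p = \sum_(i <- s) \int[mu2]_(p in A i) f p.
Proof.
move=> mA dA us fi; elim: s us => [_|i s IH /= /andP[si us]].
  by rewrite !big_nil /Rintegral integral_set0.
have mU : measurable (\big[setU/set0]_(i <- s) A i) by exact: bigsetU_measurable.
rewrite !big_cons -IH//; apply: Rintegral_setU.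
- exact: mA.
- exact: mU.
- by apply: integrableS fi => //; apply: measurableU => //; exact: mA.
- apply/disj_set2P; apply/seteqP; split => // p [ip].
  rewrite -bigcup_seq => -[j /= js jp].
  have ij : i != j by apply/eqP => e; move: si; rewrite e (js : j \in s).
  suff : set0 p by [].
  by rewrite -(dA i j ij).
Qed.

Lemma re_sum (I : Type) (r : seq I) (f : I -> C) :
  re (\sum_(i <- r) f i) = \sum_(i <- r) re (f i).
Proof. by elim: r => [|i r IH]; rewrite ?big_nil// !big_cons ReD IH. Qed.
Lemma im_sum (I : Type) (r : seq I) (f : I -> C) :
  im (\sum_(i <- r) f i) = \sum_(i <- r) im (f i).
Proof. by elim: r => [|i r IH]; rewrite ?big_nil// !big_cons ImD IH. Qed.

Variable D : discs R.
Local Notation dm := (@dmob R D).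

Lemma Dplus_inf z : Dplus D (chart true z) <->
  forall j, sqnorm (iden (swapmx R *m dm j) z) <= sqnorm (inum (swapmx R *m dm j) z).
Proof.
rewrite /chart /iden /inum; case: eqVneq => [->|z0].
  rewrite Dplus_None; split=> h j; have := h j; rewrite !swapmxE !mulr0 subr0 sub0r sqnormN//.
have e1 j : sqnorm (dm j 1 0 - dm j 0 0 * z) = sqnorm (iden (dm j) z^-1) * sqnorm z.
  by rewrite -sqnormM -sqnormN; congr sqnorm; rewrite /iden; field.
have e2 j : sqnorm (dm j 0 1 * z - dm j 1 1) = sqnorm (inum (dm j) z^-1) * sqnorm z.
  by rewrite -sqnormM -sqnormN; congr sqnorm; rewrite /inum; field.
rewrite Dplus_Some; split=> h j; have := h j; rewrite !swapmxE e1 e2 ler_pM2r ?sqnorm_gt0//.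
Qed.

(** In either coordinate [Dplus] is cut out by weak inequalities between moduli of affine
    functions. *)
Lemma closed_Dplus : closed_sphere (Dplus D).
Proof.
have cl (a b c d : C) : closed [set z : C^o | sqnorm (a * z + b) <= sqnorm (c * z + d)].
  have cf (k l : C) : continuous ((fun z => sqnorm (k * z + l)) : C^o -> R^o).
    move=> z; apply: (@continuous_comp _ _ _ (fun z : C^o => k * z + l : C^o) (@sqnorm R : C^o -> R^o)).
      exact: (Ck_at_continuous (smooth_Ck_at 0 (smooth_at_affine k l z))).
    exact: continuous_sqnorm.
  have -> : [set z : C^o | sqnorm (a * z + b) <= sqnorm (c * z + d)] =
      (fun z => sqnorm (a * z + b) - sqnorm (c * z + d)) @^-1` [set x : R^o | x <= 0].
    by apply/seteqP; split => z /=; rewrite subr_le0.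
  apply: closed_comp; last exact: closed_le.
  by move=> z _; exact: (cvgB (cf a b z) (cf c d z)).
have cI (m : 'I_(ndiscs D) -> 'M[C]_2) :
    closed [set z : C^o | forall j, sqnorm (iden (m j) z) <= sqnorm (inum (m j) z)].
  have -> : [set z : C^o | forall j, sqnorm (iden (m j) z) <= sqnorm (inum (m j) z)] =
      \bigcap_(j in setT) [set z : C^o | sqnorm (- m j 1 0 * z + m j 0 0) <=
        sqnorm (m j 1 1 * z + (- m j 0 1))].
    apply/seteqP; split => z h j; first by move=> _ /=; rewrite addrC mulNr; exact: h.
    by have := h j I; rewrite /= addrC mulNr.
  by apply: closed_bigI => j _; exact: cl.
case.
  suff -> : [set z : C^o | Dplus D (chart true z)] = [set z : C^o |
    forall j, sqnorm (iden (swapmx R *m dm j) z) <= sqnorm (inum (swapmx R *m dm j) z)] by exact: cI.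
  by apply/seteqP; split => z /Dplus_inf.
suff -> : [set z : C^o | Dplus D (chart false z)] = [set z : C^o |
  forall j, sqnorm (iden (dm j) z) <= sqnorm (inum (dm j) z)] by exact: cI.
by apply/seteqP; split => z /Dplus_Some.
Qed.

Lemma odisc_plane_disjoint j k : j != k -> odisc_plane (dm j) `&` odisc_plane (dm k) = set0.
Proof.
move=> jk; have sub i P : odisc (dm i) P -> cdisc (dm i) P.
  by move=> [z z1 e]; exists z => //=; exact: ltW.
apply/seteqP; split => // p [pj pk]; suff : set0 (Some (cplx p)) by [].
by rewrite -(dmob_disj jk); split; exact: sub.
Qed.

Lemma Dplus_planeE : sphere_plane (Dplus D) `|`
  \big[setU/set0]_(j < ndiscs D) odisc_plane (dm j) = setT.
Proof.
apply/seteqP; split => // p _; rewrite -bigcup_seq.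
have [h|/contrapT[j _ h]] := pselect (Dplus D (Some (cplx p))); [by left|right].
by exists j => //=; rewrite mem_index_enum.
Qed.

Lemma Rintegral_Dplus (f : R * R -> R) : mu2.-integrable setT (EFin \o f) ->
  \int[mu2]_p f p = \int[mu2]_(p in sphere_plane (Dplus D)) f p +
    \sum_(j < ndiscs D) \int[mu2]_(p in odisc_plane (dm j)) f p.
Proof.
move=> fi; have mA j : measurable (odisc_plane (dm j)).
  exact: (measurable_odisc_plane (dmob_unit j)).
rewrite -(Rintegral_bigsetU mA odisc_plane_disjoint (index_enum_uniq _) fi).
rewrite -[in LHS]Dplus_planeE; apply: Rintegral_setU.
- exact: (measurable_sphere_plane closed_Dplus).
- by apply: bigsetU_measurable => j _; exact: mA.
- by rewrite Dplus_planeE.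
- apply/disj_set2P; apply/seteqP; split => // p [h]; rewrite -bigcup_seq => -[j _ hj].
  by apply: h; exists j.
Qed.

Lemma int_DplusE (f : C -> C) : int_Dplus D f = - (2 * 'i%C * cint2 (sphere_plane (Dplus D)) f).
Proof. by rewrite -!mulNr. Qed.

(** The integral of [dbar G] over the sphere is zero, so over [Dplus] it is minus the sum over the
    discs, where [green_mobius] applies. The sign on the right is that of [d (F d lambda) = - dbar F
    d lambda /\ d (conj lambda)]. *)
Lemma stokes (F w1 w2 : C -> C) : form10_near (Dplus D) F ->
  (forall j s, mden (dm j) (cis s) != 0 -> circ_integrand w1 w2 j s =
    F (circ j s) * curve_deriv (circ j) s) ->
  int_Dplus D (dbar (1 : C^o) (F : C^o -> C)) = - int_bdry D w1 w2.
Proof.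
move=> /form10_extend[G [HG GF]] wE.
pose dG : C -> C := dbar (1 : C^o) (G : C^o -> C).
have tot := sphere_total HG.
have HD := form10_dbar HG.
have cT : closed_sphere (setT : set (CP1 R)) by move=> k; exact: closedT.
have ir := integrable_sphere cT (form11_re HD); have ii := integrable_sphere cT (form11_im HD).
have er := Rintegral_Dplus ir; have ei := Rintegral_Dplus ii.
have sub : int_Dplus D (dbar (1 : C^o) (F : C^o -> C)) = int_Dplus D dG.
  have e p : sphere_plane (Dplus D) p -> dbar (1 : C^o) (F : C^o -> C) (cplx p) = dG (cplx p).
    move=> Dp; apply/esym; apply: (dbar_near _ (GF _ Dp)); exact: (HG.1 _ I).
  have r : \int[mu2]_(p in sphere_plane (Dplus D)) re (dbar (1 : C^o) (F : C^o -> C) (cplx p)) =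
      \int[mu2]_(p in sphere_plane (Dplus D)) re (dG (cplx p)).
    by apply: eq_Rintegral => p; rewrite inE => hp; exact: (f_equal re (e p hp)).
  have i : \int[mu2]_(p in sphere_plane (Dplus D)) im (dbar (1 : C^o) (F : C^o -> C) (cplx p)) =
      \int[mu2]_(p in sphere_plane (Dplus D)) im (dG (cplx p)).
    by apply: eq_Rintegral => p; rewrite inE => hp; exact: (f_equal im (e p hp)).
  have ce := f_equal2 (fun a b => - (2 * 'i%C * (a +i* b))) r i.
  exact: (etrans (int_DplusE _) (etrans ce (esym (int_DplusE _)))).
have c2 : cint2 (sphere_plane (Dplus D)) dG = - \sum_(j < ndiscs D) cint2 (odisc_plane (dm j)) dG.
  have s : cint2 (sphere_plane (Dplus D)) dG +
      \sum_(j < ndiscs D) cint2 (odisc_plane (dm j)) dG = 0.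
    have sr : re (\sum_(j < ndiscs D) cint2 (odisc_plane (dm j)) dG) =
        \sum_(j < ndiscs D) re (cint2 (odisc_plane (dm j)) dG) by exact: re_sum.
    have si : im (\sum_(j < ndiscs D) cint2 (odisc_plane (dm j)) dG) =
        \sum_(j < ndiscs D) im (cint2 (odisc_plane (dm j)) dG) by exact: im_sum.
    apply: (etrans _ tot); apply: complex_ext.
      by rewrite ReD sr; exact: (esym er).
    by rewrite ImD si; exact: (esym ei).
  by apply/eqP; rewrite -addr_eq0 s.
rewrite sub int_DplusE c2 mulrN opprK opprK mulr_sumr; apply: eq_bigr => j _.
apply: (@green_mobius _ _ (dmob_unit j)).
  by split=> [l _|_]; [exact: HG.1|exact: HG.2].
move=> s d0; have Dc : Dplus D (Some (circ j s)).
  have := circle_Dplus (j := j) (sqnorm_cis s).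
  by rewrite /circ -/(cis s) mobius_Some.
have e : G (circ j s) = F (circ j s) := nbhs_singleton (GF _ Dc).
exact: (etrans (wE j s d0) (f_equal (fun x => x * curve_deriv (circ j) s) (esym e))).
Qed.

End Stokes.

(** * Tensor fields and matrix calculus on the sphere *)

Section Tensors.
Variable R : realType.
Local Notation C := R[i].
Local Notation Mx := 'M[C]_2.

(** Coefficient, in the coordinate lambda, of a tensor field on the sphere: [J]
    is the transition factor in the coordinate [z = 1 / lambda]. *)
Definition tens (J : C -> C) (S : set (CP1 R)) (f : C -> C) : Prop :=
  (forall l : C^o, S (Some l) -> smooth_at l (f : C^o -> C)) /\
  (S None -> exists f1 : C^o -> C, smooth_at 0 f1 /\
     \forall z \near (0 : C^o), z != 0 -> f z^-1 = J z * f1 z).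

(** Transition factors of (1,0)- and (0,1)-forms; vector fields have the inverse factors, and
    functions the factor [1]. *)
Definition jz (z : C) : C := - z ^+ 2.
Definition jzb (z : C) : C := - conjc z ^+ 2.

Lemma tens_sub (J : C -> C) (S T : set (CP1 R)) f : S `<=` T -> tens J T f -> tens J S f.
Proof. by move=> ST [h1 h2]; split=> [l /ST|/ST]; [exact: h1|exact: h2]. Qed.

Variable S : set (CP1 R).

Lemma tens_ext J J' f : (forall z, z != 0 -> J z = J' z) -> tens J S f -> tens J' S f.
Proof.
move=> e [h1 h2]; split=> // /h2[f1 [s1 e1]]; exists f1; split => //.
by apply: filterS e1 => z ez z0; rewrite ez// e.
Qed.

Lemma tens_cst (k : C) : tens (fun=> 1) S (fun=> k).
Proof.
split=> [l _|_]; first exact: smooth_at_cst.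
exists (fun=> k); split; first exact: smooth_at_cst.
by apply: filterE => z _; rewrite mul1r.
Qed.

Lemma tensD J f g : tens J S f -> tens J S g -> tens J S (fun z => f z + g z).
Proof.
move=> [f1 f2] [g1 g2]; split=> [l Sl|SN]; first exact: smooth_atD (f1 l Sl) (g1 l Sl).
have [a [sa ea]] := f2 SN; have [b [sb eb]] := g2 SN.
exists (fun z => a z + b z); split; first exact: smooth_atD.
by apply: filterS2 ea eb => z e1 e2 z0; rewrite e1// e2// mulrDr.
Qed.

Lemma tensM J K f g : tens J S f -> tens K S g -> tens (fun z => J z * K z) S (fun z => f z * g z).
Proof.
move=> [f1 f2] [g1 g2]; split=> [l Sl|SN]; first exact: smooth_atM (f1 l Sl) (g1 l Sl).
have [a [sa ea]] := f2 SN; have [b [sb eb]] := g2 SN.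
exists (fun z => a z * b z); split; first exact: smooth_atM.
by apply: filterS2 ea eb => z e1 e2 z0; rewrite e1// e2// mulrACA.
Qed.

Lemma tensN J f : tens J S f -> tens J S (fun z => - f z).
Proof.
move=> [f1 f2]; split=> [l Sl|SN]; first exact: smooth_atN (f1 l Sl).
have [a [sa ea]] := f2 SN; exists (fun z => - a z); split; first exact: smooth_atN.
by apply: filterS ea => z e1 z0; rewrite e1// mulrN.
Qed.

Lemma tens_conj J f : tens J S f -> tens (fun z => conjc (J z)) S (fun z => conjc (f z)).
Proof.
move=> [f1 f2]; split=> [l Sl|SN]; first exact: smooth_at_conj (f1 l Sl).
have [a [sa ea]] := f2 SN; exists (fun z => conjc (a z)); split; first exact: smooth_at_conj.
by apply: filterS ea => z e1 z0; rewrite e1// rmorphM.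
Qed.

Lemma tens_fun (f : CP1 R -> C) : fun_smooth_near S f -> tens (fun=> 1) S (fun l => f (Some l)).
Proof.
move=> h; split=> [l Sl|SN]; first exact: (h false l Sl).
exists (fun z => f (chart true z)); split; first by apply: (h true 0); rewrite /chart eqxx.
by apply: filterE => z z0; rewrite mul1r /chart (negbTE z0).
Qed.

Section Inversion.
Variables (J f1 : C^o -> C) (f : C^o -> C) (z : C^o).
Hypotheses (z0 : z != 0) (HJ : Ck_at 1 z J) (H1 : Ck_at 1 z f1).
Hypothesis e : \forall l \near (z^-1 : C^o), f l = J l^-1 * f1 l^-1.

Let zV0 : z^-1 != 0. Proof. by rewrite invr_neq0. Qed.
Let Hi : Ck_at 1 (z^-1 : C^o) (fun w : C^o => w^-1 : C).
Proof. exact: (smooth_Ck_at 1 (smooth_at_inv zV0)). Qed.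
Let HJ' : Ck_at 1 ((z^-1)^-1 : C^o) J. Proof. by rewrite invrK. Qed.
Let H1' : Ck_at 1 ((z^-1)^-1 : C^o) f1. Proof. by rewrite invrK. Qed.
Let HP := Ck_atM (Ck_at_comp1 HJ' Hi) (Ck_at_comp1 H1' Hi).
Let e' : \forall l \near (z^-1 : C^o), J l^-1 * f1 l^-1 = f l.
Proof. by apply: filterS e => l ->. Qed.

Lemma dhol_inversion : dhol (1 : C^o) J z = 0 ->
  dhol (1 : C^o) f z^-1 = jz z * J z * dhol (1 : C^o) f1 z.
Proof.
move=> d0; rewrite -(dhol_near _ e' HP) (dholM _ (Ck_at_comp1 HJ' Hi) (Ck_at_comp1 H1' Hi)).
rewrite (dhol_comp1 HJ' Hi (dbar_inv zV0)) (dhol_comp1 H1' Hi (dbar_inv zV0)).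
rewrite (dhol_inv zV0) invrK d0 mulr0 mul0r add0r -exprVn invrK.
by rewrite mulrA [J z * _]mulrC.
Qed.

Lemma dbar_inversion : dbar (1 : C^o) J z = 0 ->
  dbar (1 : C^o) f z^-1 = jzb z * J z * dbar (1 : C^o) f1 z.
Proof.
move=> d0; rewrite -(dbar_near _ e' HP) (dbarM _ (Ck_at_comp1 HJ' Hi) (Ck_at_comp1 H1' Hi)).
rewrite (dbar_comp1 HJ' Hi (dbar_inv zV0)) (dbar_comp1 H1' Hi (dbar_inv zV0)).
rewrite (dhol_inv zV0) invrK d0 mulr0 mul0r add0r -exprVn invrK rmorphN rmorphXn.
by rewrite mulrA [J z * _]mulrC.
Qed.

End Inversion.

(** A derivative of the transition factor would add a non-tensorial term. It is absent for functions
    and for (0,1)-forms, whose factor is antiholomorphic; for [dbar] below, (1,0)-forms take their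
    place. *)
Lemma tens_dhol J f : (forall z : C^o, smooth_at z (J : C^o -> C)) ->
  (forall z, dhol (1 : C^o) (J : C^o -> C) z = 0) ->
  tens J S f -> tens (fun z => jz z * J z) S (dhol (1 : C^o) (f : C^o -> C)).
Proof.
move=> sJ dJ [f1 f2]; split=> [l Sl|SN]; first exact: smooth_at_dhol (f1 l Sl).
have [a [sa /near_inversion ea]] := f2 SN.
exists (dhol (1 : C^o) a); split; first exact: smooth_at_dhol.
apply: filterS2 (near_smooth_at sa) ea => z s1 e1 z0.
exact: (dhol_inversion z0 (smooth_Ck_at 1 (sJ z)) (smooth_Ck_at 1 s1) (e1 z0) (dJ z)).
Qed.

Lemma tens_dbar J f : (forall z : C^o, smooth_at z (J : C^o -> C)) ->
  (forall z, dbar (1 : C^o) (J : C^o -> C) z = 0) ->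
  tens J S f -> tens (fun z => jzb z * J z) S (dbar (1 : C^o) (f : C^o -> C)).
Proof.
move=> sJ dJ [f1 f2]; split=> [l Sl|SN]; first exact: smooth_at_dbar (f1 l Sl).
have [a [sa /near_inversion ea]] := f2 SN.
exists (dbar (1 : C^o) a); split; first exact: smooth_at_dbar.
apply: filterS2 (near_smooth_at sa) ea => z s1 e1 z0.
exact: (dbar_inversion z0 (smooth_Ck_at 1 (sJ z)) (smooth_Ck_at 1 s1) (e1 z0) (dJ z)).
Qed.

Lemma smooth_jz (z : C^o) : smooth_at z (jz : C^o -> C).
Proof.
have h := smooth_at_id z; apply: smooth_atN.
by under eq_fun do rewrite expr2; exact: (smooth_atM h h).
Qed.

Lemma smooth_jzb (z : C^o) : smooth_at z (jzb : C^o -> C).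
Proof.
have h := smooth_at_conj (smooth_at_id z); apply: smooth_atN.
by under eq_fun do rewrite expr2; exact: (smooth_atM h h).
Qed.

Lemma dbar_jz (z : C^o) : dbar (1 : C^o) (jz : C^o -> C) z = 0.
Proof.
have h := smooth_Ck_at 1 (smooth_at_id z).
have -> : (jz : C^o -> C) = (fun w => - (w * w)) by apply/funext => w; rewrite /jz expr2.
by rewrite (dbarN _ (Ck_atM h h)) (dbarM _ h h) dbar_id mul0r mulr0 addr0 oppr0.
Qed.

Lemma dhol_jzb (z : C^o) : dhol (1 : C^o) (jzb : C^o -> C) z = 0.
Proof.
have -> : (jzb : C^o -> C) = (fun w => conjc (jz w)).
  by apply/funext => w; rewrite /jzb /jz rmorphN rmorphXn.
by rewrite (dhol_conj _ (smooth_Ck_at 1 (smooth_jz z))) dbar_jz conjc0.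
Qed.

Lemma tens_form10 f : tens jz S f -> form10_near S f.
Proof.
move=> [h1 h2]; split=> [l Sl|SN]; first exact: smooth_Ck_at (h1 l Sl).
have [a [sa ea]] := h2 SN; exists a; split; first exact: smooth_Ck_at.
by apply: filterS ea => z e1 z0; rewrite e1// /jz mulNr.
Qed.

Lemma tens_form11 f : tens (fun z => jz z * jzb z) S f -> form11_near S f.
Proof.
move=> [h1 h2]; split=> [l Sl|SN].
  exact: (Ck_at_continuous (smooth_Ck_at 0 (h1 l Sl))).
have [a [sa ea]] := h2 SN; exists a; split.
  exact: (Ck_at_continuous (smooth_Ck_at 0 sa)).
apply: filterS ea => z e1 z0; rewrite e1//; congr (_ * _).
by rewrite /jz /jzb mulrNN -exprMn rmorphXn /= sqnormE.
Qed.

Definition mtens (J : C -> C) (M : C -> Mx) : Prop := forall i j, tens J S (fun l => M l i j).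

Lemma mtens_ext J J' M : (forall z, z != 0 -> J z = J' z) -> mtens J M -> mtens J' M.
Proof. by move=> e h i j; exact: tens_ext e (h i j). Qed.

Lemma mtensD J M N : mtens J M -> mtens J N -> mtens J (fun l => M l + N l).
Proof. by move=> h k i j; have := tensD (h i j) (k i j); congr tens; apply/funext => l; rewrite mxE. Qed.

Lemma mtensN J M : mtens J M -> mtens J (fun l => - M l).
Proof. by move=> h i j; have := tensN (h i j); congr tens; apply/funext => l; rewrite mxE. Qed.

Lemma mtensZ J K f M : tens J S f -> mtens K M -> mtens (fun z => J z * K z) (fun l => f l *: M l).
Proof. by move=> h k i j; have := tensM h (k i j); congr tens; apply/funext => l; rewrite mxE. Qed.

Lemma mulmx2E (A B : Mx) i j : (A *m B) i j = A i 0 * B 0 j + A i 1 * B 1 j.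
Proof.
rewrite mxE !big_ord_recl big_ord0 addr0.
by have -> : lift ord0 ord0 = 1 :> 'I_2 by apply/val_inj.
Qed.

Lemma mxtrace2 (A : Mx) : \tr A = A 0 0 + A 1 1.
Proof.
rewrite /mxtrace !big_ord_recl big_ord0 addr0.
by have -> : lift ord0 ord0 = 1 :> 'I_2 by apply/val_inj.
Qed.

Lemma mtensM J K M N : mtens J M -> mtens K N -> mtens (fun z => J z * K z) (fun l => M l *m N l).
Proof.
move=> h k i j; have := tensD (tensM (h i 0) (k 0 j)) (tensM (h i 1) (k 1 j)).
by congr tens; apply/funext => l; rewrite mulmx2E.
Qed.

Lemma mtens_tr J M : mtens J M -> tens J S (fun l => \tr (M l)).
Proof. by move=> h; have := tensD (h 0 0) (h 1 1); congr tens; apply/funext => l; rewrite mxtrace2. Qed.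

Lemma mtens_adj J M : mtens J M -> mtens (fun z => conjc (J z)) (fun l => adj (M l)).
Proof.
move=> h i j; have := tens_conj (h j i).
by congr tens; apply/funext => l; rewrite !mxE.
Qed.

Lemma mtens_dl J M : (forall z : C^o, smooth_at z (J : C^o -> C)) ->
  (forall z, dhol (1 : C^o) (J : C^o -> C) z = 0) ->
  mtens J M -> mtens (fun z => jz z * J z) (dl M).
Proof.
move=> sJ dJ h i j; have := tens_dhol sJ dJ (h i j).
by congr tens; apply/funext => l; rewrite mxE.
Qed.

Lemma mtens_dlb J M : (forall z : C^o, smooth_at z (J : C^o -> C)) ->
  (forall z, dbar (1 : C^o) (J : C^o -> C) z = 0) ->
  mtens J M -> mtens (fun z => jzb z * J z) (dlb M).
Proof.
move=> sJ dJ h i j; have := tens_dbar sJ dJ (h i j).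
by congr tens; apply/funext => l; rewrite mxE.
Qed.

Lemma mtens_fun (F : CP1 R -> Mx) : mx_smooth_near S F -> mtens (fun=> 1) (fun l => F (Some l)).
Proof. by move=> h i j; apply: (tens_fun (f := fun z => F z i j)) => k z Sz; exact: h. Qed.

Lemma mtens_form01 M : mtens jzb M -> form01_smooth_near S M.
Proof.
move=> h; split=> [l Sl i j|SN]; first exact: (h i j).1.
have /choice[a ha] : forall ij : 'I_2 * 'I_2, exists a : C^o -> C, smooth_at 0 a /\
    \forall z \near (0 : C^o), z != 0 -> M z^-1 ij.1 ij.2 = jzb z * a z.
  by move=> [i j]; exact: (h i j).2 SN.
exists (fun z => \matrix_(i, j) a (i, j) z); split=> [i j|].
  by under eq_fun do rewrite mxE; exact: (ha (i, j)).1.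
have : \forall z \near (0 : C^o), forall ij : 'I_2 * 'I_2,
    z != 0 -> M z^-1 ij.1 ij.2 = jzb z * a ij z.
  exact: (@filter_forall _ _ (fun (ij : 'I_2 * 'I_2) (z : C^o) =>
    z != 0 -> M z^-1 ij.1 ij.2 = jzb z * a ij z) (nbhs (0 : C^o)) _ (fun ij => (ha ij).2)).
apply: filterS => z hz z0; apply/matrixP => i j; rewrite !mxE.
exact: (hz (i, j) z0).
Qed.

Lemma vect01_tens e : vect01_smooth_near S e -> tens (fun z => (jzb z)^-1) S e.
Proof.
move=> [h1 h2]; split=> // SN; have [a [sa ea]] := h2 SN; exists a; split => //.
by apply: filterS ea => z e1 z0; rewrite e1// /jzb invrN mulrC mulrN mulNr.
Qed.

End Tensors.

(** * Differential calculus of matrix-valued functions *)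

Section MatrixCalculus.
Variable R : realType.
Local Notation C := R[i].
Local Notation Mx := 'M[C]_2.

Definition mCk n (l : C) (M : C -> Mx) : Prop := forall i j, Ck_at n (l : C^o) (fun w => M w i j).

Lemma mCkD n l M N : mCk n l M -> mCk n l N -> mCk n l (fun w => M w + N w).
Proof.
by move=> h k i j; have := Ck_atD (h i j) (k i j); congr Ck_at; apply/funext => w; rewrite mxE.
Qed.
Lemma mCkN n l M : mCk n l M -> mCk n l (fun w => - M w).
Proof. by move=> h i j; have := Ck_atN (h i j); congr Ck_at; apply/funext => w; rewrite mxE. Qed.
Lemma mCkM n l M N : mCk n l M -> mCk n l N -> mCk n l (fun w => M w *m N w).
Proof.
move=> h k i j; have := Ck_atD (Ck_atM (h i 0) (k 0 j)) (Ck_atM (h i 1) (k 1 j)).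
by congr Ck_at; apply/funext => w; rewrite mulmx2E.
Qed.
Lemma mCkZ n (l : C^o) (x : C^o -> C) M : Ck_at n l x -> mCk n l M -> mCk n l (fun w => x w *: M w).
Proof.
by move=> h k i j; have := Ck_atM h (k i j); congr Ck_at; apply/funext => w; rewrite mxE.
Qed.
Lemma mCk_adj n l M : mCk n l M -> mCk n l (fun w => adj (M w)).
Proof.
by move=> h i j; have := Ck_at_conj (h j i); congr Ck_at; apply/funext => w; rewrite !mxE.
Qed.
Lemma mCk_tr n l M : mCk n l M -> Ck_at n (l : C^o) (fun w => \tr (M w)).
Proof.
by move=> h; have := Ck_atD (h 0 0) (h 1 1); congr Ck_at; apply/funext => w; rewrite mxtrace2.
Qed.

(** * Rules common to [dl] and [dlb], for a derivation acting on entries *)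

Section Derivation.
Variable d : (C^o -> C) -> C^o -> C.
Hypothesis dD : forall (l : C^o) f g, Ck_at 1 l f -> Ck_at 1 l g -> d (fun w => f w + g w) l = d f l + d g l.
Hypothesis dM : forall (l : C^o) f g, Ck_at 1 l f -> Ck_at 1 l g ->
  d (fun w => f w * g w) l = d f l * g l + f l * d g l.

Let mxd (M : C -> Mx) (l : C) : Mx := \matrix_(i, j) d (fun w => M w i j) l.

Lemma mxdD l M N : mCk 1 l M -> mCk 1 l N -> mxd (fun w => M w + N w) l = mxd M l + mxd N l.
Proof.
move=> h k; apply/matrixP => i j; rewrite !mxE; rewrite -(dD (h i j) (k i j)).
by congr (d _ _); apply/funext => w; rewrite mxE.
Qed.

Lemma mxdM l M N : mCk 1 l M -> mCk 1 l N ->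
  mxd (fun w => M w *m N w) l = mxd M l *m N l + M l *m mxd N l.
Proof.
move=> h k; apply/matrixP => i j.
have e : d (fun w => (M w *m N w) i j) l = d (fun w => M w i 0 * N w 0 j + M w i 1 * N w 1 j) l.
  by congr (d _ _); apply/funext => w; rewrite mulmx2E.
rewrite [LHS]mxE (etrans e (dD (Ck_atM (h i 0) (k 0 j)) (Ck_atM (h i 1) (k 1 j)))).
rewrite (dM (h i 0) (k 0 j)) (dM (h i 1) (k 1 j)).
by rewrite mxE !mulmx2E ![mxd _ _ _ _]mxE; ring.
Qed.

Lemma mxd_tr l M : mCk 1 l M -> d (fun w => \tr (M w)) l = \tr (mxd M l).
Proof.
move=> h; rewrite mxtrace2 !mxE -(dD (h 0 0) (h 1 1)).
by congr (d _ _); apply/funext => w; rewrite mxtrace2.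
Qed.

Lemma mxdN l M :
  (forall (l : C^o) f, Ck_at 1 l f -> d (fun w => - f w) l = - d f l) ->
  mCk 1 l M -> mxd (fun w => - M w) l = - mxd M l.
Proof.
move=> dN h; apply/matrixP => i j; rewrite !mxE -(dN _ _ (h i j)).
by congr (d _ _); apply/funext => w; rewrite mxE.
Qed.

Lemma mxd_adj (d' : (C^o -> C) -> C^o -> C) l M :
  (forall (l : C^o) f, Ck_at 1 l f -> d (fun w => conjc (f w)) l = conjc (d' f l)) ->
  mCk 1 l M -> mxd (fun w => adj (M w)) l = adj (\matrix_(i, j) d' (fun w => M w i j) l).
Proof.
move=> dc h; apply/matrixP => i j; rewrite !mxE conj_conjc -(dc _ _ (h j i)).
by congr (d _ _); apply/funext => w; rewrite !mxE.
Qed.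

End Derivation.

Lemma dlbD l M N : mCk 1 l M -> mCk 1 l N -> dlb (fun w => M w + N w) l = dlb M l + dlb N l.
Proof. exact: (mxdD (@dbarD _ _ _)). Qed.
Lemma dlM l M N : mCk 1 l M -> mCk 1 l N ->
  dl (fun w => M w *m N w) l = dl M l *m N l + M l *m dl N l.
Proof. exact: (mxdM (@dholD _ _ _) (@dholM _ _ _)). Qed.
Lemma dlbM l M N : mCk 1 l M -> mCk 1 l N ->
  dlb (fun w => M w *m N w) l = dlb M l *m N l + M l *m dlb N l.
Proof. exact: (mxdM (@dbarD _ _ _) (@dbarM _ _ _)). Qed.
Lemma dbar_tr (l : C^o) M : mCk 1 l M -> dbar (1 : C^o) (fun w => \tr (M w)) l = \tr (dlb M l).
Proof. exact: (mxd_tr (@dbarD _ _ _)). Qed.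

Lemma dlN l M : mCk 1 l M -> dl (fun w => - M w) l = - dl M l.
Proof. exact: (mxdN (@dholN _ _ _)). Qed.
Lemma dlbN l M : mCk 1 l M -> dlb (fun w => - M w) l = - dlb M l.
Proof. exact: (mxdN (@dbarN _ _ _)). Qed.
Lemma dl_adj l M : mCk 1 l M -> dl (fun w => adj (M w)) l = adj (dlb M l).
Proof. exact: (mxd_adj (d := dhol (1 : C^o)) (@dhol_conj _ _ _)). Qed.
Lemma dl_cst l (K : Mx) : dl (fun=> K) l = 0.
Proof. by apply/matrixP => i j; rewrite !mxE dhol_cst. Qed.
Lemma dlb_cst m n l (K : 'M[C]_(m, n)) : dlb (fun=> K) l = 0.
Proof. by apply/matrixP => i j; rewrite !mxE dbar_cst. Qed.

Lemma mCk_dl n l M : mCk n.+1 l M -> mCk n l (dl M).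
Proof.
move=> h i j; have := Ck_atD (Ck_at_ddir (1 : C^o) (h i j))
  (Ck_atN (Ck_atM (Ck_at_cst n (l : C^o) 'i%C) (Ck_at_ddir ('i%C *: (1 : C^o)) (h i j)))).
move=> /Ck_atM/(_ (Ck_at_cst n (l : C^o) 2^-1)).
by congr Ck_at; apply/funext => w; rewrite mxE.
Qed.
Lemma mCk_dlb n l M : mCk n.+1 l M -> mCk n l (dlb M).
Proof.
move=> h i j; have := Ck_at_dbar (1 : C^o) (h i j).
by congr Ck_at; apply/funext => w; rewrite mxE.
Qed.

Lemma dl_dlb l M : mCk 2 l M -> dl (dlb M) l = dlb (dl M) l.
Proof.
move=> h; apply/matrixP => i j; rewrite !mxE.
have e1 : (fun w => dlb M w i j) = dbar (1 : C^o) (fun w => M w i j).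
  by apply/funext => w; rewrite mxE.
have e2 : (fun w => dl M w i j) = dhol (1 : C^o) (fun w => M w i j).
  by apply/funext => w; rewrite mxE.
rewrite e1 e2; exact: dhol_dbar (h i j).
Qed.

(** Cayley-Hamilton in size 2. The inverse of a unimodular matrix becomes linear in its entries, so
    smoothness and transition laws pass to it at once. *)
Lemma inv2E (M : Mx) : \det M = 1 -> invmx M = (\tr M)%:M - M.
Proof.
move=> d1; have um : M \in unitmx by rewrite unitmxE d1 unitr1.
suff e : M *m ((\tr M)%:M - M) = 1%:M by rewrite -[RHS](mulKmx um) e mulmx1.
have d : M 0 0 * M 1 1 - M 0 1 * M 1 0 = 1 by rewrite -d1 det_mdet.
have case2 (i : 'I_2) : i = 0 \/ i = 1.
  by case: i => [[|[|//]]] p; [left|right]; exact/val_inj.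
apply/matrixP => i j; rewrite mulmx2E !mxE mxtrace2.
by case: (case2 i) => ->; case: (case2 j) => ->; rewrite /= ?mulr1n ?mulr0n ?sub0r -?d; ring.
Qed.

End MatrixCalculus.

(** * The variation of the determinant *)

Section Gauge.
Variable R : realType.
Local Notation C := R[i].
Local Notation Mx := 'M[C]_2.

Lemma mulmx_cols (A B : Mx) : (forall j, A *m delta_mx j 0 = B *m delta_mx j 0 :> 'cV[C]_2) -> A = B.
Proof.
move=> h; apply/matrixP => i j; have /matrixP/(_ i 0) := h j.
by rewrite -!colE !mxE.
Qed.

Variables (g : CP1 R -> Mx) (a : C -> Mx).
Hypothesis g_smooth : mx_smooth_near setT g.
Hypothesis g_det : forall z, \det (g z) = 1.
Hypothesis g_conj : forall l, conjugates_at a g l.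

Let gl (l : C) : Mx := g (Some l).
Definition frame_inv (l : C) : Mx := invmx (g (Some l)).
Definition frame_dlog (l : C) : Mx := dl (fun l => g (Some l)) l *m frame_inv l.
(** [- frame_dlog] is the (1,0)-part of the flat connection trivialized by [g],
    whose (0,1)-part is [a] as well. *)
Definition frame_c (l : C) : Mx := (conn a).1 l + frame_dlog l.

Let gV l : gl l *m frame_inv l = 1%:M.
Proof. by rewrite mulmxV// unitmxE g_det unitr1. Qed.
Let Vg l : frame_inv l *m gl l = 1%:M.
Proof. by rewrite mulVmx// unitmxE g_det unitr1. Qed.

Lemma mCk_frame n l : mCk n l gl.
Proof. by move=> i j; apply: smooth_Ck_at; exact: (g_smooth (k := false) (z := l) I i j). Qed.

Lemma mtens_frame : mtens setT (fun=> 1) gl.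
Proof. exact: (mtens_fun g_smooth). Qed.

Lemma mtens_frame_inv : mtens setT (fun=> 1) frame_inv.
Proof.
move=> i j.
have -> : (fun l => frame_inv l i j) = (fun l => \tr (gl l) * (i == j)%:R + - (gl l i j)).
  by apply/funext => l; rewrite /frame_inv inv2E// !mxE mulr_natr.
apply: tensD; last exact: tensN (mtens_frame i j).
apply: (tens_ext (J := fun z => 1 * 1)); first by move=> z _; rewrite mulr1.
exact: tensM (mtens_tr mtens_frame) (tens_cst _ _).
Qed.

Lemma mCk_frame_inv n l : mCk n l frame_inv.
Proof. by move=> i j; apply: smooth_Ck_at; exact: (mtens_frame_inv i j).1. Qed.

(** Testing [conjugates_at] on the constant sections [delta_mx j 0] gives the columns of [a]. *)
Lemma frame_aE l : a l = gl l *m dlb frame_inv l.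
Proof.
apply: mulmx_cols => j.
have sm (z : C^o) : mx_smooth_at z (fun=> delta_mx j 0 : 'cV[C]_2).
  by move=> i k; exact: smooth_at_cst.
have := g_conj l sm; rewrite dlb_cst add0r => ->; rewrite -mulmxA; congr (_ *m _).
apply/matrixP => i k; rewrite [RHS](_ : _ = dlb frame_inv l i j); last first.
  by rewrite -(colE j) !mxE.
rewrite !mxE.
have fe : (fun w => (invmx (g (Some w)) *m delta_mx j 0 : 'cV[C]_2) i k) =
    (fun w => frame_inv w i j).
  by apply/funext => w; rewrite -(colE j) !mxE.
exact: (f_equal (fun f : C^o -> C => dbar (1 : C^o) f l) fe).
Qed.

Let d1b l : dlb gl l *m frame_inv l + gl l *m dlb frame_inv l = 0.
Proof.
rewrite -(dlbM (mCk_frame 1 l) (mCk_frame_inv 1 l)).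
have -> : (fun w => gl w *m frame_inv w) = (fun=> 1%:M) by apply/funext => w; exact: gV.
exact: dlb_cst.
Qed.

Let d1l l : dl gl l *m frame_inv l + gl l *m dl frame_inv l = 0.
Proof.
rewrite -(dlM (mCk_frame 1 l) (mCk_frame_inv 1 l)).
have -> : (fun w => gl w *m frame_inv w) = (fun=> 1%:M) by apply/funext => w; exact: gV.
exact: dl_cst.
Qed.

Lemma frame_aE' l : a l = - (dlb gl l *m frame_inv l).
Proof. by rewrite frame_aE; apply/eqP; rewrite -addr_eq0 addrC d1b. Qed.

Lemma frame_dlb l : dlb gl l = - (a l *m gl l).
Proof. by rewrite frame_aE' mulNmx opprK -mulmxA Vg mulmx1. Qed.

Let dVb l : dlb frame_inv l = frame_inv l *m a l.
Proof. by rewrite frame_aE mulmxA Vg mul1mx. Qed.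

Let dVl l : dl frame_inv l = - (frame_inv l *m frame_dlog l).
Proof.
have := d1l l => /eqP; rewrite addr_eq0 => /eqP e.
by rewrite /frame_dlog -/gl e mulmxN opprK mulmxA Vg mul1mx.
Qed.

Lemma aE_fun : a = (fun l => - (dlb gl l *m frame_inv l)).
Proof. by apply/funext => l; exact: frame_aE'. Qed.

Lemma mtens_a : mtens setT (@jzb R) a.
Proof.
rewrite aE_fun; apply: mtensN.
apply: (mtens_ext (J := fun z => jzb z * 1 * 1)); first by move=> z _; rewrite !mulr1.
apply: mtensM mtens_frame_inv; apply: mtens_dlb mtens_frame => z.
  exact: smooth_at_cst.
exact: dbar_cst.
Qed.

Lemma mtens_dlog : mtens setT (@jz R) frame_dlog.
Proof.
apply: (mtens_ext (J := fun z => jz z * 1 * 1)); first by move=> z _; rewrite !mulr1.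
apply: mtensM mtens_frame_inv; apply: mtens_dl mtens_frame => z.
  exact: smooth_at_cst.
exact: dhol_cst.
Qed.

Lemma mtens_conn1 : mtens setT (@jz R) (conn a).1.
Proof.
apply: mtensN; apply: (mtens_ext (J := fun z => conjc (jzb z))).
  by move=> z _; rewrite /jzb /jz rmorphN rmorphXn /= conjcK.
exact: mtens_adj mtens_a.
Qed.

Lemma mtens_c : mtens setT (@jz R) frame_c.
Proof. exact: mtensD mtens_conn1 mtens_dlog. Qed.

Lemma mtens_mCk J n (l : C) (M : C -> Mx) : mtens setT J M -> mCk n l M.
Proof. by move=> h i j; apply: smooth_Ck_at; exact: ((h i j).1 l I). Qed.

(** Flatness of the connection trivialized by [g]: the equality of the two mixed derivatives of [g],
    rewritten with [dbar g = - a g]. *)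
Lemma frame_flat l : dl a l + dlb frame_dlog l = frame_dlog l *m a l - a l *m frame_dlog l.
Proof.
have Hi := mCk_frame_inv 1 l.
have H2 := mCk_dlb (mCk_frame 2 l); have H3 := mCk_dl (mCk_frame 2 l).
have -> : dl a l = - (dl (dlb gl) l *m frame_inv l + dlb gl l *m dl frame_inv l).
  rewrite aE_fun (dlN (mCkM H2 Hi)) (dlM H2 Hi); congr (- (_ + _)).
have -> : dlb frame_dlog l = dlb (dl gl) l *m frame_inv l + dl gl l *m dlb frame_inv l.
  exact: (dlbM H3 Hi).
rewrite (dl_dlb (mCk_frame 2 l)) dVl dVb frame_dlb.
rewrite mulmxN mulNmx opprK opprD addrACA addNr add0r.
have -> : a l *m gl l *m (frame_inv l *m frame_dlog l) = a l *m frame_dlog l.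
  by rewrite mulmxA -(mulmxA (a l)) gV mulmx1.
by rewrite mulmxA addrC.
Qed.

(** Two connections with the same (0,1)-part [a] have (1,0)-parts differing by [c], and one of them
    is flat by [frame_flat]; the curvature of the other is linear in [c]. *)
Lemma frame_curv l : curv a l = - (dlb frame_c l + (a l *m frame_c l - frame_c l *m a l)).
Proof.
have e : dlb frame_c l = dlb (conn a).1 l + dlb frame_dlog l.
  exact: (dlbD (mtens_mCk 1 l mtens_conn1) (mtens_mCk 1 l mtens_dlog)).
have f := frame_flat l.
have {}f : dl a l = frame_dlog l *m a l - a l *m frame_dlog l - dlb frame_dlog l.
  by rewrite -f addrK.
rewrite /curv /d1 /wedge e [(conn a).2]/= f /frame_c mulmxDl mulmxDr.
move: (dlb _ l) (dlb _ l) ((conn a).1 l *m a l) (a l *m (conn a).1 l).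
move: (frame_dlog l *m a l) (a l *m frame_dlog l) => x y u v z t.
by apply/matrixP => i j; rewrite !mxE; ring.
Qed.

(** By [dbar g = - a g] the form [h0 ^ -1 dl h0] is [g ^ -1 c g], and the conjugations by [g] cancel
    under the trace. *)
Lemma quillen_integrand (th : C -> Mx) l :
  \tr (wedge
     (fun l => invmx (adj (gl l) *m gl l) *m dl (fun l => adj (gl l) *m gl l) l, fun=> 0)
     (fun=> 0, fun l => invmx (gl l) *m th l *m gl l) l) = \tr (frame_c l *m th l).
Proof.
rewrite /wedge /= mul0mx subr0.
have Hg := mCk_frame 1 l.
have -> : dl (fun l => adj (gl l) *m gl l) l =
    dl (fun l => adj (gl l)) l *m gl l + adj (gl l) *m dl gl l := dlM (mCk_adj Hg) Hg.
rewrite (dl_adj Hg) frame_dlb.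
have adjM (A B : Mx) : adj (A *m B) = adj B *m adj A.
  by rewrite /adj trmx_mul map_mxM.
have adjN (A : Mx) : adj (- A) = - adj A by apply/matrixP => i j; rewrite !mxE rmorphN.
have ug : gl l \in unitmx by rewrite unitmxE g_det unitr1.
have uA : adj (gl l) \in unitmx by rewrite /adj map_unitmx unitmx_tr.
rewrite adjN adjM.
have -> : invmx (adj (gl l) *m gl l) = frame_inv l *m invmx (adj (gl l)).
  have uP : adj (gl l) *m gl l \in unitmx by rewrite unitmx_mul uA ug.
  rewrite -[RHS](mulKmx uP); have -> : adj (gl l) *m gl l *m (frame_inv l *m invmx (adj (gl l))) = 1%:M.
    by rewrite mulmxA -(mulmxA (adj (gl l))) gV mulmx1 mulmxV.
  by rewrite mulmx1.
have -> : frame_inv l *m invmx (adj (gl l)) *m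
    (- (adj (gl l) *m adj (a l)) *m gl l + adj (gl l) *m dl gl l) =
    frame_inv l *m (frame_c l *m gl l).
  rewrite -mulmxA; congr (_ *m _).
  rewrite /frame_c mulmxDl /conn /= /frame_dlog -/gl -[dl gl l *m _ *m _]mulmxA Vg mulmx1.
  have -> : - (adj (gl l) *m adj (a l)) *m gl l + adj (gl l) *m dl gl l =
      adj (gl l) *m (- adj (a l) *m gl l + dl gl l).
    by rewrite mulmxDr !mulNmx mulmxN mulmxA.
  by rewrite mulKmx.
rewrite -/(frame_inv l) !mulmxA mxtrace_mulC !mulmxA gV mul1mx.
by rewrite -[frame_c l *m gl l *m _]mulmxA gV mulmx1.
Qed.

End Gauge.

(** * The integrand as an exact term plus curvature terms *)

Section Integrand.
Variable R : realType.
Local Notation C := R[i].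
Local Notation Mx := 'M[C]_2.

Variables (g : CP1 R -> Mx) (a : C -> Mx).
Hypothesis g_smooth : mx_smooth_near setT g.
Hypothesis g_det : forall z, \det (g z) = 1.
Hypothesis g_conj : forall l, conjugates_at a g l.
Variables (x1 x2 : C -> C) (u : C -> Mx).

Let c := frame_c g a.
Let Ax := contr1 (x1, x2) (conn a).

Definition primitive (l : C) : C :=
  - 2^-1 * (x1 l * \tr (c l *m c l)) + \tr (c l *m (Ax l - u l)).

(** With [w = Ax - u], invariance of the trace gives [tr (c (dbar w + [a, w])) = dbar tr (c w) - tr
    ((dbar c + [a, c]) w)], and the last term is [tr (F_A w)] by [frame_curv]. In
    [- x1 dbar tr (c ^ 2) / 2] the factor [x1] passes under [dbar] by holomorphy. *)
Lemma dbar_primitive (l : C) : Ck_at 1 (l : C^o) (x1 : C^o -> C) ->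
  Ck_at 1 (l : C^o) (x2 : C^o -> C) -> mCk 1 l u -> dbar (1 : C^o) (x1 : C^o -> C) l = 0 ->
  \tr (c l *m (lie1 (x1, x2) (conn a)).2 l) + \tr (c l *m - (cov_d a u).2 l) =
  dbar (1 : C^o) (primitive : C^o -> C) l +
  \tr (curv a l *m Ax l) - \tr (curv a l *m u l).
Proof.
move=> H1 H2 Hu d0.
have Hc : mCk 1 l c by exact: mtens_mCk (mtens_c g_smooth g_det g_conj).
have Ha : mCk 1 l a by exact: mtens_mCk (mtens_a g_smooth g_det g_conj).
have HA1 : mCk 1 l (conn a).1 by exact: mtens_mCk (mtens_conn1 g_smooth g_det g_conj).
have HA : mCk 1 l Ax by exact: mCkD (mCkZ H1 HA1) (mCkZ H2 Ha).
have HW : mCk 1 l (fun l => Ax l - u l) by exact: mCkD HA (mCkN Hu).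
have Hcc := mCk_tr (mCkM Hc Hc); have HcW := mCk_tr (mCkM Hc HW).
have K := Ck_at_cst 1 (l : C^o) (- 2^-1).
have -> : dbar (1 : C^o) (primitive : C^o -> C) l =
    - 2^-1 * (x1 l * \tr (dlb c l *m c l + c l *m dlb c l)) +
    \tr (dlb c l *m (Ax l - u l) + c l *m (dlb Ax l - dlb u l)).
  rewrite /primitive (dbarD _ (Ck_atM K (Ck_atM H1 Hcc)) HcW) (dbarM _ K (Ck_atM H1 Hcc)).
  rewrite (dbarM _ H1 Hcc) dbar_cst d0 (dbar_tr (mCkM Hc Hc)) (dbar_tr (mCkM Hc HW)).
  rewrite (dlbM Hc Hc) (dlbM Hc HW) (dlbD HA (mCkN Hu)) (dlbN Hu).
  by rewrite !mul0r !add0r.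
(* The exterior derivative of [A] is curvature minus the quadratic term; the latter, times [x1],
   completes [dbar Ax] to [dbar Ax + [a, Ax]]. *)
have E1 : (lie1 (x1, x2) (conn a)).2 l = x1 l *: (curv a l - wedge (conn a) (conn a) l) + dlb Ax l.
  by rewrite /curv addrK.
have E2 : (cov_d a u).2 l = dlb u l + (a l *m u l - u l *m a l) by [].
have E3 : Ax l = x1 l *: (conn a).1 l + x2 l *: a l by [].
have E4 : wedge (conn a) (conn a) l = (conn a).1 l *m a l - a l *m (conn a).1 l by [].
rewrite E1 E2 E4 (frame_curv g_smooth g_det g_conj) -/c.
move: (dlb c l) (dlb Ax l) (dlb u l) E3 => dc dA du ->.
move: (c l) ((conn a).1 l) (a l) (u l) (x1 l) (x2 l) => c0 A1 a0 u0 y1 y2.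
rewrite !mxtrace2 !(mulmx2E, mxE).
by field.
Qed.

End Integrand.

(** * The symmetry at infinity and the integrals over [Dplus] *)

Section LiftedVariation.
Variable R : realType.
Local Notation C := R[i].
Local Notation Mx := 'M[C]_2.

Lemma jz_neq0 (z : C) : z != 0 -> jz z != 0.
Proof. by move=> z0; rewrite /jz oppr_eq0 expf_neq0. Qed.
Lemma jzb_neq0 (z : C) : z != 0 -> jzb z != 0.
Proof. by move=> z0; rewrite /jzb oppr_eq0 expf_neq0// conjc_eq0. Qed.

Lemma tens_Vcoef (S : set (CP1 R)) (X : sym_coef R) : tens (fun z => (jz z)^-1) S (Vcoef X).
Proof.
have s (a b c : C) (z : C^o) : smooth_at z (fun w : C^o => a * w ^+ 2 + b * w + c).
  have i := smooth_at_id z.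
  have q : smooth_at z (fun w : C^o => w ^+ 2).
    by under eq_fun do rewrite expr2; exact: (smooth_atM i i).
  exact: (smooth_atD (smooth_atD (smooth_atM (smooth_at_cst z a) q)
    (smooth_atM (smooth_at_cst z b) i)) (smooth_at_cst z c)).
split=> [l _|_]; first exact: (s (s_al X) (s_be X) (s_ga X) l).
(* A quadratic vector field stays quadratic in the coordinate [1 / lambda], with its coefficients
   reversed and negated. *)
exists (fun z => - s_ga X * z ^+ 2 + - s_be X * z + - s_al X); split; first exact: s.
apply: filterE => z z0; rewrite /Vcoef /jz; field; exact: z0.
Qed.

Lemma dbar_Vcoef (X : sym_coef R) (l : C^o) : dbar (1 : C^o) (Vcoef X : C^o -> C) l = 0.
Proof.
have i := smooth_Ck_at 1 (smooth_at_id l); have k (b : C) := Ck_at_cst 1 l b.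
have -> : (Vcoef X : C^o -> C) = (fun w => s_al X * (w * w) + s_be X * w + s_ga X).
  by apply/funext => w; rewrite /Vcoef expr2.
rewrite (dbarD _ (Ck_atD (Ck_atM (k _) (Ck_atM i i)) (Ck_atM (k _) i)) (k _)).
rewrite (dbarD _ (Ck_atM (k _) (Ck_atM i i)) (Ck_atM (k _) i)).
rewrite (dbarM _ (k _) (Ck_atM i i)) (dbarM _ (k _) i) (dbarM _ i i) dbar_id !dbar_cst.
by rewrite !(mul0r, mulr0, addr0).
Qed.

Lemma holo_smooth_at (z : C^o) (f : C^o -> C) : holo_at z f -> smooth_at z f.
Proof. by move=> [ O [ oO Oz [h _]]]; exists O. Qed.

Lemma holo_dbar (z : C^o) (f : C^o -> C) : holo_at z f -> dbar (1 : C^o) f z = 0.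
Proof. by move=> [ O [ oO Oz [_ h]]]; exact: h. Qed.

(** Along a twistor line the fibre coordinate is polynomial in the base coordinate, over infinity
    too, where [nu = ct p + z cx p + z ^ 2 cv p]. *)
Lemma smooth_pull_phi (X : sym_coef R) (E : twistor_bundle R) (I : invariant_under X E) (p : C3 R) :
  mx_smooth_near setT (pull_phi I p).
Proof.
have s (a b c : C) (z : C^o) : smooth_at z (fun w : C^o => a + w * b + w ^+ 2 * c).
  have i := smooth_at_id z.
  have q : smooth_at z (fun w : C^o => w ^+ 2).
    by under eq_fun do rewrite expr2; exact: (smooth_atM i i).
  exact: (smooth_atD (smooth_atD (smooth_at_cst z a) (smooth_atM i (smooth_at_cst z b)))
    (smooth_atM q (smooth_at_cst z c))).
have comp k (a b c : C) (z : C^o) i j := smooth_at_comp2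
  (f := fun w => iv_phi I (zchart k w) i j) (fun w => iv_smooth I k w i j)
  (@smooth_at_id R) (s a b c) z.
move=> [] z _ i j; last exact: (comp false (cv p) (cx p) (ct p) z i j).
have := comp true (ct p) (cx p) (cv p) z i j; congr smooth_at; apply/funext => w.
rewrite /pull_phi /zchart /qmap /chart /=; case: eqVneq => [->|w0].
  by rewrite mul0r expr0n /= mul0r !addr0.
have -> : mu p w^-1 = (ct p + w * cx p + w ^+ 2 * cv p) / w ^+ 2 by rewrite /mu; field.
by [].
Qed.

Lemma cint1_0 : cint1 (fun _ : R => 0 : C) = 0.
Proof. by rewrite /cint1 /= !Rintegral_cst//= mul0r. Qed.

Section Discs.
Variable D : discs R.

Lemma int_bdry0 (w1 w2 : C -> C) : (forall j s, mden (dmob (d := D) j) (cis s) != 0 ->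
    w1 (circ j s) = 0 /\ w2 (circ j s) = 0) -> int_bdry D w1 w2 = 0.
Proof.
move=> w0; apply/eqP; rewrite oppr_eq0; apply/eqP; apply: big1 => j _.
rewrite -[LHS]/(cint1 (circ_integrand w1 w2 j)) -[RHS]cint1_0.
apply: (cint1_off (dmob_unit j)) => // s d0.
by rewrite /circ_integrand; have [-> ->] := w0 j s d0; rewrite !mul0r addr0.
Qed.

Lemma circ_closed_disc j s : mden (dmob (d := D) j) (cis s) != 0 ->
  Dminus_closed D (Some (circ j s)).
Proof.
move=> d0; exists j => //; exists (cis s); first by rewrite /= sqnorm_le1 sqnorm_cis.
by rewrite /circ -/(cis s) mobius_Some.
Qed.

Lemma int_DplusD (T1 T2 : C -> C) : form11_near (Dplus D) T1 -> form11_near (Dplus D) T2 ->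
  int_Dplus D (fun l => T1 l + T2 l) = int_Dplus D T1 + int_Dplus D T2.
Proof.
move=> h1 h2; rewrite !int_DplusE (cint2D (@closed_Dplus R D) h1 h2).
by rewrite mulrDr opprD.
Qed.

Lemma eq_int_Dplus (T1 T2 : C -> C) : (forall l, Dplus D (Some l) -> T1 l = T2 l) ->
  int_Dplus D T1 = int_Dplus D T2.
Proof.
move=> e; rewrite !int_DplusE; congr (- (_ * _)); apply: complex_ext; rewrite /cint2 /=.
  by apply: eq_Rintegral => p; rewrite inE => hp; rewrite e.
by apply: eq_Rintegral => p; rewrite inE => hp; rewrite e.
Qed.

End Discs.

(** Scaling a non-zero vector is injective, so [xget] has a single candidate. *)
Lemma line_quotientZ (L : vectType C) (k : C) (s : L) : s != 0 -> line_quotient (k *: s) s = k.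
Proof.
move=> s0; rewrite /line_quotient; case: xgetP => [c _ /= /eqP|/(_ k) h]; last by case: h.
by rewrite -subr_eq0 -scalerBl scaler_eq0 (negbTE s0) orbF subr_eq0 => /eqP.
Qed.

End LiftedVariation.

(** * Assembling the lifts of a vector field and of a gauge transformation *)

Section Variation.
Variable R : realType.
Local Notation C := R[i].
Local Notation Mx := 'M[C]_2.

Lemma dl_traceless (M : C -> Mx) l : mCk 1 l M -> (forall w, \tr (M w) = 0) -> \tr (dl M l) = 0.
Proof.
move=> h t0; rewrite -[LHS](mxd_tr (d := dhol (1 : C^o)) (@dholD _ _ _) h).
have -> : (fun w => \tr (M w)) = (fun=> 0) by apply/funext.
exact: dhol_cst.
Qed.

Lemma dlb_traceless (M : C -> Mx) l : mCk 1 l M -> (forall w, \tr (M w) = 0) -> \tr (dlb M l) = 0.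
Proof.
move=> h t0; rewrite -(dbar_tr h).
have -> : (fun w => \tr (M w)) = (fun=> 0) by apply/funext.
exact: dbar_cst.
Qed.

Lemma comm_traceless (A B : Mx) : \tr (A *m B - B *m A) = 0.
Proof. by rewrite raddfB /= mxtrace_mulC subrr. Qed.

Variables (D : discs R) (Q : quillen_det D).
Variables (g : CP1 R -> Mx) (a : C -> Mx).
Hypothesis g_smooth : mx_smooth_near setT g.
Hypothesis g_det : forall z, \det (g z) = 1.
Hypothesis g_conj : forall l, conjugates_at a g l.
Hypothesis a_tr : forall l, \tr (a l) = 0.
Hypothesis a_supp : vanishes_near (Dminus_closed D) a.
Variables (x1 x2 : C -> C) (u : C -> Mx).
Hypothesis x1_tens : tens (fun z => (jz z)^-1) (Dplus D) x1.
Hypothesis x1_holo : forall l, Dplus D (Some l) -> dbar (1 : C^o) (x1 : C^o -> C) l = 0.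
Hypothesis x2_tens : tens (fun z => (jzb z)^-1) (Dplus D) x2.
Hypothesis u_tens : mtens (Dplus D) (fun=> 1) u.
Hypothesis u_tr : forall l, \tr (u l) = 0.

Let c := frame_c g a.
Let Ax := contr1 (x1, x2) (conn a).
Let sub J M (h : mtens setT J M) : mtens (Dplus D) J M :=
  fun i j => tens_sub (@subsetT _ _) (h i j).
Let aT := sub (mtens_a g_smooth g_det g_conj).
Let A1T := sub (mtens_conn1 g_smooth g_det g_conj).
Let cT := sub (mtens_c g_smooth g_det g_conj).
Let Ha l : mCk 1 l a := mtens_mCk 1 l (mtens_a g_smooth g_det g_conj).
Let HA1 l : mCk 1 l (conn a).1 := mtens_mCk 1 l (mtens_conn1 g_smooth g_det g_conj).

(** In the contraction of a vector field with a form the transition factors cancel. *)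
Let AxT : mtens (Dplus D) (fun=> 1) Ax.
Proof.
apply: mtensD.
  apply: (mtens_ext (J := fun z => (jz z)^-1 * jz z)); last exact: mtensZ x1_tens A1T.
  by move=> z /jz_neq0 z0; rewrite mulVf.
apply: (mtens_ext (J := fun z => (jzb z)^-1 * jzb z)); last exact: mtensZ x2_tens aT.
by move=> z /jzb_neq0 z0; rewrite mulVf.
Qed.

Let dlbT M : mtens (Dplus D) (fun=> 1) M -> mtens (Dplus D) (@jzb R) (dlb M).
Proof.
move=> h; apply: (mtens_ext (J := fun z => jzb z * 1)); first by move=> z _; rewrite mulr1.
apply: (mtens_dlb (J := fun=> 1) _ _ h) => z; first exact: smooth_at_cst.
exact: dbar_cst.
Qed.

Let d1T : mtens (Dplus D) (fun z => jz z * jzb z) (d1 (conn a)).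
Proof.
apply: mtensD.
  exact: (mtens_dl (@smooth_jzb R) (@dhol_jzb R) aT).
apply: mtensN; apply: (mtens_ext (J := fun z => jzb z * jz z)).
  by move=> z _; rewrite mulrC.
exact: (mtens_dlb (@smooth_jz R) (@dbar_jz R) A1T).
Qed.

Let curvT : mtens (Dplus D) (fun z => jz z * jzb z) (curv a).
Proof.
apply: mtensD d1T _; apply: mtensD; first exact: mtensM A1T aT.
apply: mtensN; apply: (mtens_ext (J := fun z => jzb z * jz z)).
  by move=> z _; rewrite mulrC.
exact: mtensM aT A1T.
Qed.

Let thv := (lie1 (x1, x2) (conn a)).2.
Let thu := fun l => - (cov_d a u).2 l.

Let thvT : mtens (Dplus D) (@jzb R) thv.
Proof.
apply: mtensD; last exact: dlbT AxT.
apply: (mtens_ext (J := fun z => (jz z)^-1 * (jz z * jzb z))).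
  by move=> z /jz_neq0 z0; rewrite mulKf.
exact: mtensZ x1_tens d1T.
Qed.

Let thuT : mtens (Dplus D) (@jzb R) thu.
Proof.
apply: mtensN; apply: mtensD; first exact: dlbT u_tens.
apply: mtensD.
  apply: (mtens_ext (J := fun z => jzb z * 1)); first by move=> z _; rewrite mulr1.
  exact: mtensM aT u_tens.
apply: mtensN; apply: (mtens_ext (J := fun z => 1 * jzb z)); first by move=> z _; rewrite mul1r.
exact: mtensM u_tens aT.
Qed.

Let A1_tr l : \tr ((conn a).1 l) = 0.
Proof.
rewrite /conn /= raddfN /= /adj mxtrace2 !mxE !conj_conjc -rmorphD -mxtrace2 a_tr.
by rewrite rmorph0 oppr0.
Qed.

Let Ax_tr l : \tr (Ax l) = 0.
Proof. by rewrite /Ax /contr1 /= mxtraceD !mxtraceZ A1_tr a_tr !mulr0 addr0. Qed.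

Let Ck1 J (M : C -> Mx) l : Dplus D (Some l) -> mtens (Dplus D) J M -> mCk 1 l M.
Proof. by move=> Dl h i j; apply: smooth_Ck_at; exact: ((h i j).1 l Dl). Qed.

Let a_form : sl2_form01 D a.
Proof. by split=> [|l _]; [exact: mtens_form01 aT|exact: a_tr]. Qed.

Let thv_form : sl2_form01 D thv.
Proof.
split=> [|l Dl]; first exact: mtens_form01 thvT.
rewrite /thv /lie1 /= mxtraceD mxtraceZ /d1 raddfB /=.
rewrite (dl_traceless (Ha l) a_tr) (dlb_traceless (HA1 l) A1_tr).
by rewrite (dlb_traceless (Ck1 Dl AxT) Ax_tr) subrr mulr0 addr0.
Qed.

Let thu_form : sl2_form01 D thu.
Proof.
split=> [|l Dl]; first exact: mtens_form01 thuT.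
rewrite /thu /cov_d /= raddfN /= mxtraceD comm_traceless.
by rewrite (dlb_traceless (Ck1 Dl u_tens) u_tr) addr0 oppr0.
Qed.

Let a_circ j s : mden (dmob (d := D) j) (cis s) != 0 -> a (circ j s) = 0.
Proof.
move=> /circ_closed_disc h.
by have /nbhs_singleton := a_supp (k := false) (z := circ j s) h; apply.
Qed.

Let adj0 : adj 0 = 0 :> Mx.
Proof. by apply/matrixP => i k; rewrite !mxE rmorph0. Qed.

(** The support of [a] avoids the closed discs, so the extension by the standard operator has no
    jump. *)
Let extend_a : extend D a = a.
Proof.
apply/funext => l; rewrite /extend; case: asboolP => // h; apply/esym.
have [j _ [z z1 e]] := contrapT h.
have : Dminus_closed D (Some l) by exists j => //; exists z => //=; exact: ltW.
by move=> /(a_supp (k := false) (z := l))/nbhs_singleton; apply.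
Qed.

Let triv : trivializes D a g.
Proof.
split=> //.
- by move=> k z i j; exact: (Ck_at_continuous (smooth_Ck_at 0 (g_smooth (k := k) (z := z) I i j))).
- by exists g; split=> // k z _; exact: g_smooth.
- by exists g; split=> // k z _; exact: g_smooth.
- by move=> l _; rewrite extend_a; exact: g_conj.
Qed.

Let quillenE th : quillen_form D g th =
  'i%C / (2 * pi%:C) * int_Dplus D (fun l => \tr (c l *m th l)).
Proof.
rewrite /quillen_form; f_equal.
apply: eq_int_Dplus => l _; exact: quillen_integrand.
Qed.

Let boundary_gauge : int_bdry_tr D (Defs.mulf (conn a) u) = 0.
Proof.
by apply: int_bdry0 => j s d0; rewrite /= a_circ// adj0 oppr0 !mul0mx mxtrace0.
Qed.

Let boundary_vect : int_bdry_tr D (Defs.mulf (conn a) Ax) = 0.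
Proof.
by apply: int_bdry0 => j s d0; rewrite /= a_circ// adj0 oppr0 !mul0mx mxtrace0.
Qed.

Let prim := primitive g a x1 x2 u.

Let primT : tens (@jz R) (Dplus D) prim.
Proof.
have h1 : tens (fun z => 1 * ((jz z)^-1 * (jz z * jz z))) (Dplus D)
    (fun l => - 2^-1 * (x1 l * \tr (c l *m c l))).
  exact: tensM (tens_cst _ _) (tensM x1_tens (mtens_tr (mtensM cT cT))).
have h2 : tens (fun z => jz z * 1) (Dplus D) (fun l => \tr (c l *m (Ax l - u l))).
  exact: mtens_tr (mtensM cT (mtensD AxT (mtensN u_tens))).
apply: tensD.
  by apply: tens_ext h1 => z /jz_neq0 z0; rewrite mul1r mulKf.
by apply: tens_ext h2 => z _; rewrite mulr1.
Qed.

(** [dbar_primitive] integrated over [Dplus]; the transition laws of the five integrands provide the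
    integrability on which additivity rests. *)
Let integral_sum :
  int_Dplus D (fun l => \tr (c l *m thv l)) + int_Dplus D (fun l => \tr (c l *m thu l)) =
  int_Dplus D (dbar (1 : C^o) (prim : C^o -> C)) +
  int_Dplus D (fun l => \tr (curv a l *m Ax l)) - int_Dplus D (fun l => \tr (curv a l *m u l)).
Proof.
have f1 := tens_form11 (mtens_tr (mtensM cT thvT)).
have f2 := tens_form11 (mtens_tr (mtensM cT thuT)).
have f3 : form11_near (Dplus D) (fun l => \tr (curv a l *m Ax l)).
  apply: tens_form11; apply: (tens_ext (J := fun z => jz z * jzb z * 1)).
    by move=> z _; rewrite mulr1.
  exact: mtens_tr (mtensM curvT AxT).
have f4 : form11_near (Dplus D) (fun l => \tr (curv a l *m u l)).
  apply: tens_form11; apply: (tens_ext (J := fun z => jz z * jzb z * 1)).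
    by move=> z _; rewrite mulr1.
  exact: mtens_tr (mtensM curvT u_tens).
have f0 := form10_dbar (tens_form10 primT).
apply/eqP; rewrite eq_sym subr_eq; apply/eqP.
rewrite -(int_DplusD f0 f3) -(int_DplusD f1 f2) -(int_DplusD (form11_nearD f1 f2) f4).
apply: eq_int_Dplus => l Dl.
have H1 := smooth_Ck_at 1 (x1_tens.1 l Dl); have H2 := smooth_Ck_at 1 (x2_tens.1 l Dl).
have := dbar_primitive g_smooth g_det g_conj H1 H2 (Ck1 Dl u_tens) (x1_holo Dl).
by move=> /(canLR (addrNK _)) /esym.
Qed.

(** The area integrals cancel between Quillen's form and the functions [H]. What Stokes' theorem
    leaves is [primitive] on the circles, where [w1] is its value. *)
Lemma lifts_quotient (w1 w2 : C -> C) : det_sec Q a != 0 ->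
  (forall j s, mden (dmob (d := D) j) (cis s) != 0 ->
    w1 (circ j s) = - 2^-1 * (x1 (circ j s) *
        \tr (frame_dlog g (circ j s) *m frame_dlog g (circ j s))) -
      \tr (frame_dlog g (circ j s) *m u (circ j s)) /\
    w2 (circ j s) = 0) ->
  line_quotient (lift_vect Q a (x1, x2) + lift_gauge Q a u) (det_sec Q a) =
  - ('i%C / (2 * pi%:C)) * int_bdry D w1 w2.
Proof.
move=> s0 wE.
have bd : int_Dplus D (dbar (1 : C^o) (prim : C^o -> C)) = - int_bdry D w1 w2.
  apply: stokes; first exact: (tens_form10 primT).
  move=> j s d0; rewrite /circ_integrand; have [-> ->] := wE j s d0.
  rewrite mul0r addr0; congr (_ * _).
  (* On the circles [A] vanishes, hence so does [Ax], and [c] reduces to [frame_dlog]. *)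
  rewrite /prim /primitive /contr1 /frame_c /= a_circ// adj0 oppr0.
  by rewrite add0r !scaler0 addr0 sub0r mulmxN raddfN.
have lin (V : vectType C) (k1 k2 k3 k4 : C) (v : V) :
    k1 *: v - k2 *: v + (k3 *: v - k4 *: v) = (k1 - k2 + (k3 - k4)) *: v.
  by rewrite scalerDl !scalerBl.
have -> : lift_vect Q a (x1, x2) + lift_gauge Q a u =
    (quillen_form D g thv - 'i%C * H_vect D a (x1, x2) +
     (quillen_form D g thu - 'i%C * H_gauge D a u)) *: det_sec Q a.
  rewrite -lin; congr (_ - _ + (_ - _)).
    exact: (det_nablaE Q a_form thv_form triv).
  exact: (det_nablaE Q a_form thu_form triv).
rewrite (line_quotientZ _ s0) (quillenE thv) (quillenE thu).
have -> : H_vect D a (x1, x2) = 1 / (2 * pi%:C) * int_Dplus D (fun l => \tr (curv a l *m Ax l)).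
  by rewrite /H_vect boundary_vect mulr0 subr0.
have -> : H_gauge D a u = - (1 / (2 * pi%:C)) * int_Dplus D (fun l => \tr (curv a l *m u l)).
  by rewrite /H_gauge boundary_gauge mulr0 addr0.
have := integral_sum; rewrite bd.
move: (int_Dplus D (fun l => \tr (c l *m thv l))) (int_Dplus D (fun l => \tr (c l *m thu l)))
  (int_Dplus D (fun l => \tr (curv a l *m Ax l))) (int_Dplus D (fun l => \tr (curv a l *m u l)))
  (int_bdry D w1 w2) => i1 i2 i3 i4 b /(canRL (addrK _)) ->.
have p0 : pi%:C != 0 :> C.
  by apply/eqP => /(f_equal (@complex.Re R)) /=; apply/eqP; rewrite gt_eqF// pi_gt0.
by move: 'i%C (pi%:C) p0 => j q q0; field.
Qed.

End Variation.

(** What remains after [lifts_quotient] are the behaviour at infinity of [- h V] and [- h Phi] and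
    the comparison of boundary integrands. *)
Theorem mainTheorem7 (R : realType) (X : sym_coef R)
  (E : twistor_bundle R) (I : invariant_under X E)
  (D : discs R) (Q : quillen_det D)
  (U : set (C3 R))
  (Y : C3 R -> C3 R) (f0 f1 h : C3 R -> CP1 R -> R[i])
  (U_open : open U) (U_connected : connected U)
  (Y_holo : holo_vect_on U Y)
  (fh_mero : forall p, U p ->
     [/\ meromorphic (f0 p), meromorphic (f1 p) & meromorphic (h p)])
  (Y_dec : forall p, U p -> decomposes X p (Y p) (f0 p) (f1 p) (h p))
  (h_holo : forall p, U p -> fun_holo_near (Dplus D) (h p))
  (supp_a : forall p, U p -> vanishes_near (Dminus_closed D) (pull_a E p)) :
  forall p, U p -> det_sec Q (pull_a E p) != 0 ->
  forall g : CP1 R -> 'M[R[i]]_2,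
    mx_smooth_near setT g -> (forall z, \det (g z) = 1) ->
    (forall l, conjugates_at (pull_a E p) g l) ->
  forall e, completes D (xi10 X (h p)) e ->
  Y_dlog_tau Q I p (h p) e =
  - ('i / (2 * pi%:C)) *
    int_bdry D (tau_form I p (h p) g (d0 (fun l => g (Some l))).1)
               (tau_form I p (h p) g (d0 (fun l => g (Some l))).2).
Proof.
move=> p Up s0 g gs gd gc e [es ec].
have hs : fun_smooth_near (Dplus D) (h p).
  by move=> k z Sz; apply: holo_smooth_at; exact: (h_holo p Up k z Sz).
have hT := tens_fun hs.
have vT := tens_Vcoef (Dplus D) X.
have phiS : mx_smooth_near (Dplus D) (pull_phi I p).
  by move=> k z _; exact: smooth_pull_phi.
have xT : tens (fun z => (jz z)^-1) (Dplus D) (xi10 X (h p)).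
  apply: (tens_ext (J := fun z => 1 * (jz z)^-1)); first by move=> z _; rewrite mul1r.
  exact: (tensN (tensM hT vT)).
have xH l : Dplus D (Some l) ->
    dbar (1 : R[i]^o) (xi10 X (h p) : R[i]^o -> R[i]) l = 0.
  move=> Dl; have h1 := smooth_Ck_at 1 (hT.1 l Dl); have v1 := smooth_Ck_at 1 (vT.1 l Dl).
  rewrite (dbarN _ (Ck_atM h1 v1)) (dbarM _ h1 v1) dbar_Vcoef mulr0 addr0.
  by rewrite (holo_dbar (h_holo p Up false l Dl)) mul0r oppr0.
have uT : mtens (Dplus D) (fun=> 1) (fun l => - h p (Some l) *: pull_phi I p (Some l)).
  apply: (mtens_ext (J := fun z => 1 * 1)); first by move=> z _; rewrite mulr1.
  exact: (mtensZ (tensN hT) (mtens_fun phiS)).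
have uN l : \tr (- h p (Some l) *: pull_phi I p (Some l)) = 0.
  by rewrite mxtraceZ iv_tr mulr0.
have aN l : \tr (pull_a E p l) = 0 by exact: tb_tr.
apply: (lifts_quotient gs gd gc aN (supp_a p Up) xT xH (vect01_tens es) uT uN s0) => j s d0.
have a0 : pull_a E p (circ j s) = 0.
  have := supp_a p Up false (circ j s) (circ_closed_disc d0).
  by move=> /nbhs_singleton; apply.
move: (circ j s) a0 => l a0; split; rewrite /tau_form /=.
  (* With [x1 = - h V] and [u = - h Phi] the two signs cancel, and the boundary value of the
     primitive is the [d lambda] component of the form in the theorem. *)
  rewrite /frame_dlog /frame_inv /xi10; move: (dl _ l) => dg.
  rewrite !mxtraceD !mxtraceZ -!scalemxAl !mxtraceZ -!scalemxAr !mxtraceZ.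
  rewrite [\tr (_ *m pull_phi I p _)]mxtrace_mulC !mulmxA.
  by field.
(* On the boundary [dbar g = - a g] is zero, so [d g] has no component along [d (conj lambda)]. *)
rewrite (frame_dlb gs gd gc) a0 mul0mx oppr0 !mulmx0 !mul0mx scaler0 addr0.
by rewrite mxtrace0 mulr0.
Qed.
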